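(* Let $\Omega\subseteq\mathbb{R}^3$ be open and bounded with Lipschitz boundary and let $0<\alpha<\beta$. Let $(\varepsilon_n)_n$ be a sequence in $\mathcal{M}(\alpha,\beta)$ and $\varepsilon\in\mathcal{M}(\alpha,\beta)$ with $\varepsilon_n\to\varepsilon$ in $\tau_\Omega$. For all $f\in H^{-1}(\Omega)$, $g\in H^{-1}(\mathrm{curl}_{\mathrm{red}})$ and $x\in\mathcal{H}_D(\Omega)$, if $E_n\in L_2(\Omega)^3$ solves $$\mathrm{div}\,\varepsilon_nE_n=f,\qquad \mathrm{curl}_{\mathrm{red}}^\diamond E_n=g,\qquad \pi_D\pi_{\varepsilon_n}E_n=x$$ for every $n$, then $$E_n\to E\quad\text{weakly in }L_2(\Omega)^3,$$ where $E\in L_2(\Omega)^3$ is the unique solution of $$\mathrm{div}\,\varepsilon E=f,\qquad \mathrm{curl}_{\mathrm{red}}^\diamond E=g,\qquad \pi_D\pi_{\varepsilon}E=x.$$ Moreover, $\varepsilon_nE_n\to\varepsilon E$ weakly in $L_2(\Omega)^3$ and $$\langle\varepsilon_nE_n,E_n\rangle_{L_2}\to\langle\varepsilon E,E\rangle_{L_2}.$$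
   Context: Let $\mathbb{K}\in\{\mathbb{R},\mathbb{C}\}$; all Hilbert spaces are over $\mathbb{K}$, scalar products are antilinear in the first and linear in the second argument; $\operatorname{Re}T:=\tfrac12(T+T^* )$. Operators: $\mathring{\mathrm{grad}}\colon H_0^1(\Omega)\subseteq L_2(\Omega)\to L_2(\Omega)^3$, $u\mapsto\nabla u$; $\mathrm{div}$ and $\mathrm{curl}$ are the distributional divergence and curl with maximal domains in $L_2(\Omega)^3$; $\mathring{\mathrm{curl}}:=\mathrm{curl}^*$ is the restriction of $\mathrm{curl}$ to the closure of $C_c^\infty(\Omega)^3$ in the graph norm of $\mathrm{curl}$; $\mathrm{div}=-\mathring{\mathrm{grad}}^*$. For bounded Lipschitz $\Omega$ the ranges of $\mathring{\mathrm{grad}}$ and $\mathrm{curl}$ are closed and $\mathcal{H}_D(\Omega):=\ker(\mathrm{div})\cap\ker(\mathring{\mathrm{curl}})$ is finite-dimensional. Distribution spaces: $H^{-1}(\Omega):=H_0^1(\Omega)'$, and for $\psi\in L_2(\Omega)^3$, $\mathrm{div}\,\psi\in H^{-1}(\Omega)$ is $u\mapsto-\langle\psi,\nabla u\rangle_{L_2}$. $\mathrm{curl}_{\mathrm{red}}$ is $\mathrm{curl}$ restricted to $\operatorname{dom}(\mathrm{curl})\cap\ker(\mathrm{curl})^\perp$, viewed as an operator from $\ker(\mathrm{curl})^\perp$ to $\operatorname{ran}(\mathrm{curl})$; $H^1(\mathrm{curl}_{\mathrm{red}})$ is its domain with graph norm, $H^{-1}(\mathrm{curl}_{\mathrm{red}})$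 is the dual of $H^1(\mathrm{curl}_{\mathrm{red}})$; for $\psi\in L_2(\Omega)^3$, $\mathrm{curl}_{\mathrm{red}}^\diamond\psi\in H^{-1}(\mathrm{curl}_{\mathrm{red}})$ is $\phi\mapsto\langle\psi,\mathrm{curl}\,\phi\rangle_{L_2}$. $\mathcal{M}(\alpha,\beta):=\{a\in\mathcal{B}(L_2(\Omega)^3):\operatorname{Re}a\ge\alpha,\ \operatorname{Re}a^{-1}\ge1/\beta\}$. A nonlocal $H$-topology on $\mathcal{M}(\alpha,\beta)$ is a topology obtained from a closed subspace $\mathcal{H}_0\subseteq L_2(\Omega)^3$ with $\operatorname{ran}(\mathring{\mathrm{grad}})\subseteq\mathcal{H}_0$, $\operatorname{ran}(\mathrm{curl})\subseteq\mathcal{H}_1:=\mathcal{H}_0^\perp$ as the initial topology induced by $a\mapsto a_{00}^{-1}$, $a\mapsto a_{00}^{-1}a_{01}$, $a\mapsto a_{10}a_{00}^{-1}$, $a\mapsto a_{11}-a_{10}a_{00}^{-1}a_{01}$, where $(a_{jk})$ is the block matrix of $a$ with respect to $\mathcal{H}_0\oplus\mathcal{H}_1$ and the targets carry the weak operator topologies. $\tau_\Omega$ denotes the unique nonlocal $H$-topology on $\mathcal{M}(\alpha,\beta)$ (since $\dim\mathcal{H}_D(\Omega)<\infty$, all admissible choices of $\mathcal{H}_0$, e.g. $\mathcal{H}_0=\operatorname{ran}(\mathring{\mathrm{grad}})$, give the same topology). Projections: for $\varepsilon\in\mathcal{M}(\alpha,\beta)$, $\mathcal{H}_\varepsilon:=\ker(\mathrm{div}\,\varepsilon)\cap\ker(\mathring{\mathrm{curl}})$;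 one has the direct decomposition $L_2(\Omega)^3=\operatorname{ran}(\mathring{\mathrm{grad}})\dot{+}\varepsilon^{-1}\operatorname{ran}(\mathrm{curl})\dot{+}\mathcal{H}_\varepsilon$, and $\pi_\varepsilon\colon L_2(\Omega)^3\to\mathcal{H}_\varepsilon$ is the corresponding continuous projection onto $\mathcal{H}_\varepsilon$. $\pi_D$ is the orthogonal projection of $L_2(\Omega)^3$ onto $\mathcal{H}_D(\Omega)$. *)

(* Defs.v *)
From HB Require Import structures.
From mathcomp Require Import all_boot all_order all_algebra.
From mathcomp Require Import all_classical all_reals all_analysis.
From mathcomp Require Import complex ring_quotient.

Set Implicit Arguments.
Unset Strict Implicit.
Unset Printing Implicit Defensive.

Import Order.TTheory GRing.Theory Num.Theory.
Import numFieldNormedType.Exports.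

Local Open Scope classical_set_scope.
Local Open Scope ring_scope.

Variant scalars := RealScalars | ComplexScalars.

Section scalar_field.
Variable R : realType.

Definition scal (k : scalars) : numFieldType :=
  match k with RealScalars => R | ComplexScalars => R[i] end.

Definition reK (k : scalars) : scal k -> R :=
  match k with RealScalars => id | ComplexScalars => @complex.Re R end.

Definition imK (k : scalars) : scal k -> R :=
  match k with RealScalars => fun=> 0 | ComplexScalars => @complex.Im R end.

(* [mkK k a b] is a + i b; the imaginary part is dropped over the reals. *)
Definition mkK (k : scalars) : R -> R -> scal k :=
  match k with RealScalars => fun a _ => a | ComplexScalars => @Complex R end.

Definition ofR (k : scalars) (a : R) : scal k := mkK k a 0.

Definition conjK (k : scalars) (z : scal k) : scal k :=
  mkK k (reK z) (- imK z).

Lemma reKD k (z w : scal k) : reK (z + w) = reK z + reK w.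
Proof. by case: k z w => // -[? ?] []. Qed.

Lemma imKD k (z w : scal k) : imK (z + w) = imK z + imK w.
Proof. by case: k z w => [? ?|[? ?] []//]; rewrite addr0. Qed.

Lemma reKM k (z w : scal k) : reK (z * w) = reK z * reK w - imK z * imK w.
Proof. by case: k z w => [? ?|[? ?] []//]; rewrite mul0r subr0. Qed.

Lemma imKM k (z w : scal k) : imK (z * w) = reK z * imK w + imK z * reK w.
Proof. by case: k z w => [? ?|[? ?] []//]; rewrite mulr0 mul0r addr0. Qed.

Lemma reK0 k : reK (0 : scal k) = 0. Proof. by case: k. Qed.

Lemma imK0 k : imK (0 : scal k) = 0. Proof. by case: k. Qed.

End scalar_field.

Section L2.
Context d (T : measurableType d) (R : realType).
Variables (mu : {measure set T -> \bar R}) (k : scalars).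
Local Notation K := (scal R k).

(* f is in L_2 iff its real and imaginary parts are, as |f|^2 = re^2 + im^2. *)
Definition sqint : {pred (T -> K^o)} := fun f =>
  ((fun x => reK (f x)) \in Lfun mu 2%:E) &&
  ((fun x => imK (f x)) \in Lfun mu 2%:E).

Lemma sqint_submod_closed : submod_closed sqint.
Proof.
have l2S (a : R) (g : T -> R) : g \in Lfun mu 2%:E ->
    (fun x => a * g x) \in Lfun mu 2%:E.
  have := Lfun_submod_closed mu (lee1n 2) => -[h0 h] hg.
  by have := h a g 0 hg h0; rewrite addr0.
have l2D (g h : T -> R) : g \in Lfun mu 2%:E -> h \in Lfun mu 2%:E ->
    (fun x => g x + h x) \in Lfun mu 2%:E.
  have := Lfun_submod_closed mu (lee1n 2) => -[_ hh] hg hh'.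
  by have := hh 1 g h hg hh'; rewrite scale1r.
have l20 : (fun=> 0 : R) \in Lfun mu 2%:E.
  by have := Lfun_submod_closed mu (lee1n 2) => -[].
split.
  apply/andP; split.
    by rewrite (_ : (fun _ => _) = (fun=> 0))//; apply/funext => x; exact: reK0.
  by rewrite (_ : (fun _ => _) = (fun=> 0))//; apply/funext => x; exact: imK0.
move=> c f g /andP[rf jf] /andP[rg jg]; apply/andP; split.
  rewrite (_ : (fun _ => _) = (fun x =>
      (reK c * reK (f x) + - imK c * imK (f x)) + reK (g x))).
    by apply: (l2D) => //; apply: (l2D); exact: l2S.
  by apply/funext => x; rewrite reKD reKM mulNr.
rewrite (_ : (fun _ => _) = (fun x =>
    (reK c * imK (f x) + imK c * reK (f x)) + imK (g x))).
  by apply: (l2D) => //; apply: (l2D); exact: l2S.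
by apply/funext => x; rewrite imKD imKM.
Qed.

HB.instance Definition _ :=
  GRing.isSubmodClosed.Build K (T -> K^o) sqint sqint_submod_closed.

Record sqint_fun := SqintFun {
  sqint_val :> T -> K^o ; _ : sqint_val \in sqint }.

HB.instance Definition _ := [isSub for sqint_val].
HB.instance Definition _ := [Choice of sqint_fun by <:].
HB.instance Definition _ := [SubChoice_isSubLmodule of sqint_fun by <:].

Definition null_fun : {pred sqint_fun} :=
  fun f => `[< {ae mu, forall x, f x = 0} >].

Lemma null_fun_submod_closed : submod_closed null_fun.
Proof.
split; first by apply/asboolP; exact: nearW.
move=> c f g /asboolP f0 /asboolP g0; apply/asboolP.
apply: filterS2 f0 g0 => x fx gx.
by rewrite -[LHS]/(c *: f x + g x) fx gx scaler0 addr0.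
Qed.

HB.instance Definition _ :=
  GRing.isSubmodClosed.Build K sqint_fun null_fun null_fun_submod_closed.

Definition L2 : Type := Quotient.quot null_fun.

HB.instance Definition _ := GRing.Zmodule.on L2.

Definition L2_scale (c : K) (u : L2) : L2 := \pi_L2%qT (c *: repr u).

Let pi_scale c (f : sqint_fun) : L2_scale c (\pi_L2%qT f) = \pi_L2%qT (c *: f).
Proof.
have : c *: repr (\pi_L2%qT f) - c *: f \in null_fun.
  by rewrite -scalerBr; apply: rpredZ; rewrite Quotient.idealrBE reprK.
by rewrite Quotient.idealrBE => /eqP.
Qed.

Let piK u : exists f, u = \pi_L2%qT f.
Proof. by exists (repr u); rewrite reprK. Qed.

Let piD (f g : sqint_fun) : \pi_L2%qT (f + g) = \pi_L2%qT f + \pi_L2%qT g.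
Proof. exact: (Quotient.pi_add null_fun f g). Qed.

Let L2_scaleA a b u : L2_scale a (L2_scale b u) = L2_scale (a * b) u.
Proof. by have [f ->] := piK u; rewrite !pi_scale scalerA. Qed.

Let L2_scale1 : left_id 1 L2_scale.
Proof. by move=> u; have [f ->] := piK u; rewrite pi_scale scale1r. Qed.

Let L2_scaleDr : right_distributive L2_scale +%R.
Proof.
move=> c u v; have [f ->] := piK u; have [g ->] := piK v.
by rewrite !pi_scale -!piD pi_scale scalerDr.
Qed.

Let L2_scaleDl u : {morph L2_scale^~ u : a b / a + b}.
Proof.
move=> a b; have [f ->] := piK u.
by rewrite !pi_scale -piD scalerDl.
Qed.

HB.instance Definition _ := GRing.Zmodule_isLmodule.Build K L2
  L2_scaleA L2_scale1 L2_scaleDr L2_scaleDl.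

End L2.

(* Points of R^3; a copy of [R * R * R] with its product topology and norm and
   with the Borel sets of R on each factor. *)
Notation R3 R := (measurableTypeR R * measurableTypeR R * measurableTypeR R)%type.


Section points.
Variable R : realType.

Definition unitv (i : 'I_3) : R3 R :=
  ((i == 0%N :> nat)%:R, (i == 1%N :> nat)%:R, (i == 2%N :> nat)%:R).

Definition dot3 (x y : R3 R) : R :=
  x.1.1 * y.1.1 + x.1.2 * y.1.2 + x.2 * y.2.

Definition orthonormal3 (e : 'I_3 -> R3 R) :=
  forall i j, dot3 (e i) (e j) = (i == j)%:R.

Definition vol3 : {measure set (R3 R) -> \bar R} :=
  (@lebesgue_measure R \x @lebesgue_measure R \x @lebesgue_measure R)%E.

(* Around every boundary point p, in suitable orthonormal coordinates y centred
   at p, the set Om is the strict epigraph of a Lipschitz function. *)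
Definition lipschitz_boundary (Om : set (R3 R)) :=
  forall p, (closure Om `\` interior Om) p ->
  exists (e : 'I_3 -> R3 R) (r : R) (gam : R * R -> R),
    [/\ orthonormal3 e, 0 < r, [lipschitz gam x | x in setT] &
      forall y : 'I_3 -> R, \sum_i y i ^+ 2 < r ^+ 2 ->
        (Om (p + \sum_i y i *: e i) <-> gam (y 0, y 1) < y (1 + 1))].

Let nbhs_ratoo (x : R) (A : set R) : nbhs x A ->
  exists a b : rat, [/\ ratr a < x, x < ratr b & `]ratr a, ratr b[ `<=` A].
Proof.
move=> /nbhs_ballP[e /= e0 eA].
have [a] : exists q : rat, ratr q \in `]x - e, x[.
  by apply: rat_in_itvoo; rewrite ltrBlDr ltrDl.
have [b] : exists q : rat, ratr q \in `]x, x + e[.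
  by apply: rat_in_itvoo; rewrite ltrDl.
rewrite !in_itv/= => /andP[xb be] /andP[ae ax].
exists a, b; split => // y /=; rewrite in_itv/= => /andP[ay yb].
apply: eA; rewrite /ball/= ltr_norml; apply/andP; split.
  by rewrite ltrBrDr addrC ltrBlDr (lt_trans yb)// addrC.
by rewrite ltrBlDr -ltrBlDl (lt_trans _ ay).
Qed.

Lemma open_measurable3 (A : set (R3 R)) : open A -> measurable A.
Proof.
move=> oA.
pose I (q : rat * rat) : set (measurableTypeR R) := [set` `]ratr q.1, ratr q.2[].
pose box (q : rat * rat * (rat * rat) * (rat * rat)) : set (R3 R) :=
  I q.1.1 `*` I q.1.2 `*` I q.2.
pose F q := if `[< box q `<=` A >] then box q else set0.
have -> : A = \bigcup_q F q.
  apply/seteqP; split=> [[[x y] z] Axyz|p [q _]]; last first.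
    by rewrite /F; case: asboolP => [sA pq|_ []]; exact: sA.
  have [[B C] /= [[[B1 B2] /= [nB1 nB2] sB] nC] sA] : nbhs ((x, y), z) A.
    exact: open_nbhs_nbhs.
  have [a1 [b1 [a1x xb1 s1]]] := nbhs_ratoo nB1.
  have [a2 [b2 [a2y yb2 s2]]] := nbhs_ratoo nB2.
  have [a3 [b3 [a3z zb3 s3]]] := nbhs_ratoo nC.
  exists ((a1, b1), (a2, b2), (a3, b3)) => //; rewrite /F asboolT.
    by split=> /=; [split => /=|]; rewrite /I/= in_itv/=; apply/andP.
  move=> [[x' y'] z'] [[/= h1 h2] h3]; apply: sA; split => /=.
    by apply: sB; split => /=; [exact: s1|exact: s2].
  exact: s3.
apply: countable_bigcupT_measurable => [|q]; first exact: countableP.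
rewrite /F; case: ifP => _; last exact: measurable0.
by apply: measurableX; [apply: measurableX|]; exact: measurable_itv.
Qed.

End points.

Section calculus.
Variable R : realType.

Fixpoint Ck (m : nat) (f : R3 R -> R) : Prop :=
  continuous f /\
  if m is m'.+1 then
    forall i, (forall x, derivable f x (unitv R i)) /\ Ck m' ('D_(unitv R i) f)
  else True.

Definition smooth (f : R3 R -> R) := forall m, Ck m f.

Variables (k : scalars) (Om : set (R3 R)).
Local Notation K := (scal R k).

Definition Cc_infty (phi : R3 R -> K) :=
  [/\ smooth (@reK R k \o phi), smooth (@imK R k \o phi),
      compact (closure [set x | phi x != 0]) &
      closure [set x | phi x != 0] `<=` Om].

Definition partial (i : 'I_3) (phi : R3 R -> K) (x : R3 R) : K :=
  mkK k ('D_(unitv R i) (@reK R k \o phi) x)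
        ('D_(unitv R i) (@imK R k \o phi) x).

End calculus.

(* An unbounded operator between function spaces is represented by its graph. *)
Section graphs.
Variables (X Y : Type).
Implicit Type A : set (X * Y).

Definition dom A : set X := [set x | exists y, A (x, y)].
Definition ran A : set Y := [set y | exists x, A (x, y)].

End graphs.

Definition ker (X : Type) (Y : zmodType) (A : set (X * Y)) : set X :=
  [set x | A (x, 0)].

Section Omega.
Variables (R : realType) (k : scalars) (Om : set (R3 R)) (oOm : open Om).
Local Notation K := (scal R k).

Definition leb_Om : {measure set (R3 R) -> \bar R} :=
  mrestr (@vol3 R) (open_measurable3 oOm).

Definition L2s : lmodType K := L2 leb_Om k.
Definition L2v : lmodType K := {ffun 'I_3 -> L2s}.

Definition represents (u : L2s) (phi : R3 R -> K) :=
  {ae leb_Om, forall x, repr u x = phi x}.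

Definition representsv (u : L2v) (phi : 'I_3 -> R3 R -> K) :=
  forall i, represents (u i) (phi i).

Definition ips (u v : L2s) : K :=
  mkK k (\int[leb_Om]_x reK (conjK (repr u x) * repr v x))
        (\int[leb_Om]_x imK (conjK (repr u x) * repr v x)).

Definition ip (u v : L2v) : K := \sum_i ips (u i) (v i).

Definition nrms (u : L2s) : R := Num.sqrt (reK (ips u u)).
Definition nrm (u : L2v) : R := Num.sqrt (reK (ip u u)).

Definition perp (V : set L2v) : set L2v :=
  [set x | forall v, V v -> ip v x = 0].

Definition closed_subspace (V : set L2v) :=
  [/\ V 0, forall (c : K) u v, V u -> V v -> V (c *: u + v) &
      forall x, (forall e, 0 < e -> exists2 v, V v & nrm (x - v) < e) -> V x].

(* Orthogonal projection; it exists whenever V is a closed subspace, so that the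
   default value 0 is not used. *)
Definition proj (V : set L2v) (x : L2v) : L2v :=
  xget 0 [set p | V p /\ perp V (x - p)].

Definition weakly_to (u_ : nat -> L2v) (u : L2v) :=
  forall phi, (fun n => ip phi (u_ n)) @ \oo --> ip phi u.

(* The classical operators on test functions; the distributional operators grad,
   div and curl below are defined by duality with them. *)
Definition grad_c : set (L2s * L2v) := [set p | exists phi : R3 R -> K,
  [/\ Cc_infty Om phi, represents p.1 phi &
      representsv p.2 (fun i => partial i phi)]].

Definition div_c : set (L2v * L2s) := [set p | exists phi : 'I_3 -> R3 R -> K,
  [/\ forall i, Cc_infty Om (phi i), representsv p.1 phi &
      represents p.2 (fun x => \sum_i partial i (phi i) x)]].

(* Indices are taken modulo 3. *)
Definition curl_c : set (L2v * L2v) := [set p | exists phi : 'I_3 -> R3 R -> K,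
  [/\ forall i, Cc_infty Om (phi i), representsv p.1 phi &
      representsv p.2 (fun i x =>
        partial (i + 1) (phi (i + 2)) x - partial (i + 2) (phi (i + 1)) x)]].

Definition grad : set (L2s * L2v) :=
  [set p | forall psi d, div_c (psi, d) -> ips d p.1 = - ip psi p.2].

Definition div : set (L2v * L2s) :=
  [set p | forall phi d, grad_c (phi, d) -> ip d p.1 = - ips phi p.2].

Definition curl : set (L2v * L2v) :=
  [set p | forall phi d, curl_c (phi, d) -> ip d p.1 = ip phi p.2].

(* The domain of grad0 is H_0^1(Om), the closure of the test functions in the
   H^1-norm. *)
Definition grad0 : set (L2s * L2v) :=
  [set p | grad p /\ forall e, 0 < e -> exists phi d,
     [/\ grad_c (phi, d), nrms (p.1 - phi) < e & nrm (p.2 - d) < e]].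

Definition adjoint_graph (A : set (L2v * L2v)) : set (L2v * L2v) :=
  [set p | forall u w, A (u, w) -> ip w p.1 = ip u p.2].

(* The curl with vanishing tangential trace, defined as the Hilbert space adjoint
   of the curl with maximal domain. *)
Definition curl0 : set (L2v * L2v) := adjoint_graph curl.

Definition curl_red : set (L2v * L2v) :=
  [set p | curl p /\ perp (ker curl) p.1].

(* [f] represents an element of the dual of [dom A] with its graph norm; only
   the values of [f] on [dom A] matter. *)
Definition dual_dom (X : lmodType K) (nX : X -> R) (A : set (X * L2v))
    (f : X -> K) :=
  (forall (c : K) u v, dom A u -> dom A v -> f (c *: u + v) = c * f u + f v) /\
  exists C : R, forall u w, A (u, w) ->
    `|f u| <= ofR k (C * Num.sqrt (nX u ^+ 2 + nrm w ^+ 2)).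

Definition Hm1 : (L2s -> K) -> Prop := dual_dom nrms grad0.
Definition Hm1_curl_red : (L2v -> K) -> Prop := dual_dom nrm curl_red.

Definition bounded_operator (a : L2v -> L2v) :=
  (forall (c : K) u v, a (c *: u + v) = c *: a u + a v) /\
  exists C : R, forall u, nrm (a u) <= C * nrm u.

Definition adjoint (a b : L2v -> L2v) := forall x y, ip (b x) y = ip x (a y).

(* Re a >= c, in the sense of quadratic forms, with Re a = (a + a^* ) / 2 *)
Definition Re_ge (a : L2v -> L2v) (c : R) :=
  exists2 b, bounded_operator b /\ adjoint a b &
    forall x, ofR k c * ip x x <= ip x (2^-1 *: (a x + b x)).

Definition M (al be : R) : set (L2v -> L2v) :=
  [set a | [/\ bounded_operator a, Re_ge a al &
    exists b, [/\ bounded_operator b, cancel a b, cancel b a & Re_ge b be^-1]]].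

Definition inv_op (a : L2v -> L2v) (x : L2v) : L2v := xget 0 [set y | a y = x].

(* Operators from V to W (closed subspaces) with the weak operator topology. They
   are represented by functions on the whole space, whose values outside V do
   not matter. *)
Definition wot (V W : set L2v) : topologicalType :=
  initial_topology (fun (t : L2v -> L2v) =>
    (fun p => ip (val p.2) (t (val p.1))) : {ptws V * W -> K}).

Section nonlocal.
Variable H0 : set L2v.
Local Notation H1 := (perp H0).

Definition nonlocal_admissible :=
  [/\ closed_subspace H0, ran grad0 `<=` H0 & ran curl `<=` H1].

(* the inverse of the block a_00 : H0 -> H0 *)
Definition inv00 (a : L2v -> L2v) (x : L2v) : L2v :=
  xget 0 [set y | H0 y /\ proj H0 (a y) = x].

(* On H0 + H1: a00^-1, a00^-1 a01, a10 a00^-1 and a11 - a10 a00^-1 a01, where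
   a_jk is [fun x => proj Hj (a x)] on Hk. *)
Definition nonlocal_maps (al be : R) (a : M al be) :
    wot H0 H0 * wot H1 H0 * wot H0 H1 * wot H1 H1 :=
  let a := val a in
  (inv00 a,
   fun x => inv00 a (proj H0 (a x)),
   fun x => proj H1 (a (inv00 a x)),
   fun x => proj H1 (a x) - proj H1 (a (inv00 a (proj H0 (a x))))).

(* The initial topology of a family of four maps is that of the map into the
   product space. When HD is finite-dimensional, it is the same for all
   admissible H0, for instance for H0 = ran grad0. *)
Definition nonlocal_H (al be : R) : topologicalType :=
  initial_topology (@nonlocal_maps al be).

Definition nonlocal_cvg (al be : R) (a_ : nat -> M al be) (a : M al be) :=
  (a_ : nat -> nonlocal_H al be) @ \oo --> (a : nonlocal_H al be).

End nonlocal.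

Definition HD : set L2v := ker div `&` ker curl0.

Definition Heps (a : L2v -> L2v) : set L2v :=
  [set h | ker div (a h) /\ ker curl0 h].

(* The projection onto Heps a along ran grad0 + a^{-1} (ran curl), with respect to
   the direct decomposition of L_2(Om)^3 into these three spaces. *)
Definition pi_op (a : L2v -> L2v) (x : L2v) : L2v :=
  xget 0 [set h | Heps a h /\ exists u w,
    [/\ ran grad0 u, (inv_op a @` ran curl) w & x = u + w + h]].

(* The first two equations hold in H^-1(Om) and H^-1(curl_red), where div psi is
   u |-> - <psi, grad u> and curl_red^<> psi is phi |-> <psi, curl phi>. *)
Definition solves (a : L2v -> L2v) (f : L2s -> K) (g : L2v -> K) (x E : L2v) :=
  [/\ forall u du, grad0 (u, du) -> f u = - ip (a E) du,
      forall phi w, curl_red (phi, w) -> g phi = ip E w &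
      proj HD (pi_op a E) = x].

End Omega.

Arguments M {R} k {Om} oOm al be.
Arguments HD {R} k {Om} oOm.

(* Main.v *)
(* Write P0 and P1 for the orthogonal projections onto H0 and its complement, and put
   Phi_a E = P0 (a E) + P1 E and Psi_a E = P0 E + P1 (a E). Then
   Re <Phi_a E, Psi_a E> = Re <E, a E>, and Psi_a E = B_a (Phi_a E) for an operator B_a whose
   blocks are the four maps defining the topology; so eps_n -> eps means that
   B_{eps_n} -> B_eps in the weak operator topology. The equations split E_n into the parts
   x + w_n and eps_n^-1 z_n, where w_n in ran grad0 and z_n in ran curl solve one Lax-Milgram
   problem each. For either part, Phi varies with n only within the finite-dimensional space
   HD, and orthogonally to the variation of Psi. Hence coercivity turns the weak convergence
   of B_{eps_n} into strong convergence of Phi and weak convergence of Psi, and these two give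
   the weak limits of E_n and eps_n E_n and the limit of their products.

   That HD is finite-dimensional and ran curl closed follows from the estimate
   |w| <= C (|curl w| + sum_i |<b_i, w>|) for w in dom curl0 orthogonal to ran grad0. To prove
   it for test fields w, take near each boundary point a vector v along which one enters Om:
   x - v lies outside of Om, and x - s v in Om with 0 <= s <= 1 implies x in Om. Then
   u = eta int_0^1 v . w(x - s v) ds, for a bump function eta, is a test function on Om whose
   gradient is eta w up to a term in curl w and up to the product of grad eta with the mean of
   v . w; by Rellich's inequality the latter is controlled by finitely many functionals of w. *)

Require Import Defs.
From HB Require Import structures.
From mathcomp Require Import all_boot all_order all_algebra.
From mathcomp Require Import all_classical all_reals all_analysis.
From mathcomp Require Import complex ring_quotient.
From mathcomp Require Import measurable_realfun ring lra.

Set Implicit Arguments.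
Unset Strict Implicit.
Unset Printing Implicit Defensive.

Import Order.TTheory GRing.Theory Num.Theory.
Import numFieldNormedType.Exports.

Local Open Scope classical_set_scope.
Local Open Scope ring_scope.

(** * Scalars *)

(** Weak operator convergence controls [Psi] only while [Phi] stays fixed, and neither a varying
    [Phi] nor the product of two weak limits can be handled weakly. What rescues both is that the
    part of [H0] orthogonal to [ran grad0], and the part of its complement orthogonal to [ran curl],
    lie in [HD], where finitely many functionals bound the norm. The data [f] and [g] enter through
    the square-integrable fields [eps_0 E_0] and [E_0], which turns the equations into tests against
    [ran grad0] and [ran curl] in one Hilbert space.

    The estimate for [curl0] may be proved on test fields because [curl0], the adjoint of the
    adjoint of [curl_c], is the closure of [curl_c]. Approximating test fields are not orthogonal to
    gradients, so the estimate compares them with a limit that is. The mean over the segment from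
    [x - v] to [x] is replaced by means of dyadic translates: these commute with derivatives, do not
    increase the L_2 norm, and leave only limits of numbers to be taken. The integral calculus on
    the whole space rests on translation invariance combined with Taylor's formula. *)

Section scalars.
Variables (R : realType) (k : scalars).
Local Notation K := (scal R k).
Implicit Types (z w : K) (a b : R).

Lemma eqK z w : reK z = reK w -> imK z = imK w -> z = w.
Proof. by case: k z w => [? ? //|[? ?] [? ?] /= -> ->]. Qed.

Lemma reK_ofR a : reK (ofR k a) = a. Proof. by case: k. Qed.
Lemma imK_ofR a : imK (ofR k a) = 0. Proof. by case: k. Qed.
Lemma reK_conj z : reK (conjK z) = reK z. Proof. by case: k z. Qed.
Lemma imK_conj z : imK (conjK z) = - imK z.
Proof. by case: k z => //= ?; rewrite oppr0. Qed.
Lemma reKN z : reK (- z) = - reK z. Proof. by case: k z => // -[]. Qed.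
Lemma imKN z : imK (- z) = - imK z.
Proof. by case: k z => [?|[]//]; rewrite /= oppr0. Qed.
Lemma reKB z w : reK (z - w) = reK z - reK w. Proof. by rewrite reKD reKN. Qed.
Lemma imKB z w : imK (z - w) = imK z - imK w. Proof. by rewrite imKD imKN. Qed.
Lemma reK1 : reK (1 : K) = 1. Proof. by case: k. Qed.
Lemma imK1 : imK (1 : K) = 0. Proof. by case: k. Qed.
Lemma reK_mk a b : reK (mkK k a b) = a. Proof. by case: k. Qed.

Definition reKE := (reKD, reKN, reKM, reK0, reK1, reK_conj, reK_ofR, reK_mk).
Definition imKE := (imKD, imKN, imKM, imK0, imK1, imK_conj, imK_ofR).

Lemma ofRD a b : ofR k (a + b) = ofR k a + ofR k b.
Proof. by apply: eqK; rewrite !(reKE, imKE) ?addr0. Qed.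
Lemma ofR0 : ofR k (0 : R) = 0.
Proof. by apply: eqK; rewrite !(reKE, imKE). Qed.
Lemma conjKD z w : conjK (z + w) = conjK z + conjK w.
Proof. by apply: eqK; rewrite !(reKE, imKE) ?opprD. Qed.
Lemma conjKM z w : conjK (z * w) = conjK z * conjK w.
Proof. by apply: eqK; rewrite !(reKE, imKE); ring. Qed.
Lemma conjK_ofR a : conjK (ofR k a) = ofR k a.
Proof. by apply: eqK; rewrite !(reKE, imKE) ?oppr0. Qed.
Lemma conjK0 : conjK (0 : K) = 0.
Proof. by rewrite -ofR0 conjK_ofR. Qed.

Definition sqK z : R := reK z ^+ 2 + imK z ^+ 2.

Lemma sqK_ge0 z : 0 <= sqK z. Proof. by rewrite addr_ge0 ?sqr_ge0. Qed.
Lemma reK_conjM z : reK (conjK z * z) = sqK z.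
Proof. by rewrite !(reKE, imKE) /sqK; ring. Qed.
Lemma sqK0_eq0 z : sqK z = 0 -> z = 0.
Proof.
move=> /eqP; rewrite paddr_eq0 ?sqr_ge0// !sqrf_eq0 => /andP[/eqP h1 /eqP h2].
by apply: eqK; rewrite ?reK0 ?imK0.
Qed.

(** With [c] the conjugate of [z - w] the real part is a squared modulus. Identities between scalar
    products can thus be proved on real parts alone, provided one argument may be rescaled. *)
Lemma eqK_reM z w : (forall c : K, reK (c * z) = reK (c * w)) -> z = w.
Proof.
move=> h; apply/subr0_eq/sqK0_eq0; rewrite -reK_conjM mulrBr reKB.
by apply/eqP; rewrite subr_eq0 h.
Qed.

Lemma normK z : `|z| = ofR k (Num.sqrt (sqK z)).
Proof.
rewrite /sqK; case: k z => [z|[a b]] /=.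
  by rewrite expr0n addr0 sqrtr_sqr.
by rewrite normc_def.
Qed.

Lemma lt_ofR a b : (ofR k a < ofR k b) = (a < b).
Proof. by case: k => //=; rewrite ltcR. Qed.
Lemma gt0_ofR z : 0 < z -> exists2 e, 0 < e & z = ofR k e.
Proof.
case: k z => [z z0|[a b]] /=; first by exists z.
by rewrite ltcE /= => /andP[/eqP -> a0]; exists a.
Qed.

Lemma le_reK z w : z <= w -> reK z <= reK w.
Proof. by case: k z w => [//|[a b] [c d]]; rewrite lecE /= => /andP[]. Qed.

Lemma reK_half z : reK (2^-1 * z) = 2^-1 * reK z.
Proof.
suff -> : (2^-1 : K) = ofR k 2^-1 by rewrite !(reKE, imKE) mul0r subr0.
by case: k {z} => //=; rewrite -[RHS]/((2^-1)%:C%C) fmorphV rmorph_nat.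
Qed.

Lemma normr_reK z : `|reK z| <= Num.sqrt (sqK z).
Proof.
by rewrite -[leLHS]sqrtr_sqr ler_wsqrtr// /sqK lerDl sqr_ge0.
Qed.
Lemma normr_imK z : `|imK z| <= Num.sqrt (sqK z).
Proof.
by rewrite -[leLHS]sqrtr_sqr ler_wsqrtr// /sqK lerDr sqr_ge0.
Qed.
Lemma sqK_le z : Num.sqrt (sqK z) <= `|reK z| + `|imK z|.
Proof.
rewrite -[leRHS]ger0_norm ?addr_ge0// -[leRHS]sqrtr_sqr ler_wsqrtr//.
rewrite sqrrD !real_normK ?num_real// /sqK addrAC lerDl mulrn_wge0// mulr_ge0//.
Qed.

Lemma cvgK (u : nat -> K) (l : K) :
  u @ \oo --> l <-> ((fun n => reK (u n)) @ \oo --> reK l /\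
                    (fun n => imK (u n)) @ \oo --> imK l).
Proof.
split=> [/cvgrPdist_lt h|[/cvgrPdist_lt h1 /cvgrPdist_lt h2]].
  split; apply/cvgrPdist_lt => e e0.
    have /h : 0 < ofR k e by rewrite -ofR0 lt_ofR.
    apply: filterS => n; rewrite normK lt_ofR -reKB; apply: le_lt_trans.
    exact: normr_reK.
  have /h : 0 < ofR k e by rewrite -ofR0 lt_ofR.
  apply: filterS => n; rewrite normK lt_ofR -imKB; apply: le_lt_trans.
  exact: normr_imK.
apply/cvgrPdist_lt => e0 /gt0_ofR[e e00 ->].
have e2 : 0 < e / 2 by rewrite divr_gt0.
have := h1 _ e2; have := h2 _ e2; apply: filterS2 => n hi hr.
rewrite normK lt_ofR (le_lt_trans (sqK_le _))// [ltRHS]splitr ltrD//.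
  by rewrite reKB.
by rewrite imKB.
Qed.

End scalars.

(** * Hilbert spaces *)

Lemma squeeze0 (R : realType) (a b : nat -> R) : (forall n, 0 <= a n <= b n) ->
  b @ \oo --> (0 : R) -> a @ \oo --> (0 : R).
Proof.
move=> h hb; apply: (@squeeze_cvgr _ _ _ _ (fun=> 0) b) => //; last exact: cvg_cst.
exact: nearW.
Qed.

Lemma cvg0D (R : realType) (a b : nat -> R) : a @ \oo --> (0 : R) ->
  b @ \oo --> (0 : R) -> (fun n => a n + b n) @ \oo --> (0 : R).
Proof. by move=> ha hb; rewrite -(addr0 0); apply: cvgD. Qed.

Section hilbert.
Variables (R : realType) (k : scalars).
Local Notation K := (scal R k).

Definition hnrm (V : lmodType K) (ip : V -> V -> K) (u : V) : R :=
  Num.sqrt (reK (ip u u)).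

Definition hcvg (V : lmodType K) (ip : V -> V -> K) (u_ : nat -> V) (l : V) :=
  (fun n => hnrm ip (u_ n - l)) @ \oo --> (0 : R).

(** A predicate on a form rather than a structure, so that it applies directly to [ips] and [ip],
    and to the sums of forms on pairs and on finite families. *)
Record hilbert (V : lmodType K) (ip : V -> V -> K) : Prop := Hilbert {
  ip_lin : forall c u v w, ip u (c *: v + w) = c * ip u v + ip u w;
  ip_conj : forall u v, ip v u = conjK (ip u v);
  ip_ge0 : forall u, 0 <= reK (ip u u);
  ip_def : forall u, reK (ip u u) = 0 -> u = 0;
  ip_complete : forall u_ : nat -> V,
    (forall e : R, 0 < e -> exists N, forall m n, (N <= m)%N -> (N <= n)%N ->
      hnrm ip (u_ m - u_ n) < e) ->
    exists l, hcvg ip u_ l }.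

Section basics.
Variables (V : lmodType K) (ip : V -> V -> K) (hV : hilbert ip).
Local Notation nm := (hnrm ip).
Implicit Types (u v w : V) (c : K).

Lemma ipDr u v w : ip u (v + w) = ip u v + ip u w.
Proof. by have := ip_lin hV 1 u v w; rewrite scale1r mul1r. Qed.

Lemma ip0r u : ip u 0 = 0.
Proof. by have /eqP := ipDr u 0 0; rewrite addr0 -subr_eq0 opprD addNKr oppr_eq0 => /eqP. Qed.

Lemma ipZr c u v : ip u (c *: v) = c * ip u v.
Proof. by have := ip_lin hV c u v 0; rewrite ip0r !addr0. Qed.

Lemma ipNr u v : ip u (- v) = - ip u v.
Proof. by rewrite -scaleN1r ipZr mulN1r. Qed.

Lemma ipBr u v w : ip u (v - w) = ip u v - ip u w.
Proof. by rewrite ipDr ipNr. Qed.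

Lemma ipDl u v w : ip (u + v) w = ip u w + ip v w.
Proof. by rewrite (ip_conj hV w) ipDr conjKD -!(ip_conj hV). Qed.

Lemma ip0l u : ip 0 u = 0.
Proof. by rewrite (ip_conj hV) ip0r conjK0. Qed.

Lemma ipZl c u v : ip (c *: u) v = conjK c * ip u v.
Proof. by rewrite (ip_conj hV v) ipZr conjKM -(ip_conj hV). Qed.

Lemma ipNl u v : ip (- u) v = - ip u v.
Proof.
by apply/eqP; rewrite -addr_eq0 -ipDl addNr ip0l.
Qed.

Lemma ipBl u v w : ip (u - v) w = ip u w - ip v w.
Proof. by rewrite ipDl ipNl. Qed.

Definition ipE := (ipDr, ipDl, ipNr, ipNl, ipZr, ipZl).

Lemma ip_eq0C u v : ip u v = 0 -> ip v u = 0.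
Proof. by move=> h; rewrite (ip_conj hV) h conjK0. Qed.

Lemma ripC u v : reK (ip u v) = reK (ip v u).
Proof. by rewrite (ip_conj hV) reK_conj. Qed.

Lemma sqr_nm u : nm u ^+ 2 = reK (ip u u).
Proof. by rewrite sqr_sqrtr// (ip_ge0 hV). Qed.

Lemma nm_ge0 u : 0 <= nm u. Proof. exact: sqrtr_ge0. Qed.

Lemma nm_eq0 u : nm u = 0 -> u = 0.
Proof. by move=> h; apply: (ip_def hV); rewrite -sqr_nm h expr0n. Qed.

Lemma nm0 : nm 0 = 0. Proof. by rewrite /hnrm ip0r reK0 sqrtr0. Qed.

Lemma sqr_nmD u v : nm (u + v) ^+ 2 = nm u ^+ 2 + 2 * reK (ip u v) + nm v ^+ 2.
Proof. by rewrite !sqr_nm !ipE !reKD (ripC v u); ring. Qed.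

Lemma nmN u : nm (- u) = nm u.
Proof. by rewrite /hnrm ipNl ipNr opprK. Qed.

Lemma nmB u v : nm (u - v) = nm (v - u).
Proof. by rewrite -nmN opprB. Qed.

Lemma sqr_nmB u v : nm (u - v) ^+ 2 = nm u ^+ 2 - 2 * reK (ip u v) + nm v ^+ 2.
Proof. by rewrite sqr_nmD nmN ipNr reKN; ring. Qed.

Lemma sqr_nmZ c u : nm (c *: u) ^+ 2 = sqK c * nm u ^+ 2.
Proof.
rewrite !sqr_nm ipZl ipZr mulrA reKM (_ : imK (conjK c * c) = 0) ?mul0r ?subr0 ?reK_conjM//.
by rewrite !(reKE, imKE); ring.
Qed.

Lemma nmZ c u : nm (c *: u) = Num.sqrt (sqK c) * nm u.
Proof.
apply/eqP; rewrite -(eqrXn2 (n := 2))// ?nm_ge0// ?mulr_ge0 ?sqrtr_ge0 ?nm_ge0//.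
by rewrite sqr_nmZ exprMn (sqr_sqrtr (sqK_ge0 c)).
Qed.

Lemma nmZr (a : R) u : nm (ofR k a *: u) = `|a| * nm u.
Proof.
by rewrite nmZ /sqK reK_ofR imK_ofR expr0n addr0 sqrtr_sqr.
Qed.

Lemma ripZr (a : R) u v : reK (ip u (ofR k a *: v)) = a * reK (ip u v).
Proof. by rewrite ipZr reKM reK_ofR imK_ofR mul0r subr0. Qed.

Lemma rip_le u v : reK (ip u v) <= nm u * nm v.
Proof.
have [u0|u0] := eqVneq (nm u) 0.
  by rewrite (nm_eq0 u0) ip0l reK0 nm0 mul0r.
have up : 0 < nm u by rewrite lt_def u0 nm_ge0.
have [v0|v0] := eqVneq (nm v) 0.
  by rewrite (nm_eq0 v0) ip0r reK0 nm0 mulr0.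
have vp : 0 < nm v by rewrite lt_def v0 nm_ge0.
have : 0 <= nm (ofR k (nm v) *: u - ofR k (nm u) *: v) ^+ 2 by rewrite sqr_ge0.
rewrite sqr_nmB !nmZr !ger0_norm ?nm_ge0// ripZr ripC ripZr ripC !exprMn => h.
have : 0 <= (2 * (nm u * nm v)) * (nm u * nm v - reK (ip u v)) by lra.
by rewrite pmulr_rge0 ?subr_ge0// mulr_gt0// mulr_gt0.
Qed.

Lemma ip_le u v : Num.sqrt (sqK (ip u v)) <= nm u * nm v.
Proof.
set z := ip u v.
have [z0|z0] := eqVneq (sqK z) 0; first by rewrite z0 sqrtr0 mulr_ge0// nm_ge0.
have sz : 0 < sqK z by rewrite lt_def z0 sqK_ge0.
have := rip_le (z *: u) v; rewrite ipZl reK_conjM nmZ.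
rewrite -{1}(sqr_sqrtr (ltW sz)) expr2 -mulrA ler_pM2l ?sqrtr_gt0//.
Qed.

Lemma nmD u v : nm (u + v) <= nm u + nm v.
Proof.
rewrite -(ler_pXn2r (n := 2))// ?nnegrE ?addr_ge0 ?nm_ge0//.
by rewrite sqr_nmD; have := rip_le u v; lra.
Qed.

Lemma nm_tri w u v : nm (u - v) <= nm (u - w) + nm (w - v).
Proof. by rewrite (le_trans _ (nmD _ _))// addrA subrK. Qed.

Lemma nm_leB u v : nm u <= nm v + nm (u - v).
Proof. by rewrite -{1}(subrK v u) addrC nmD. Qed.

Lemma hcvg_cauchy (u_ : nat -> V) (d : nat -> R) : d @ \oo --> (0 : R) ->
  (forall m n, nm (u_ m - u_ n) <= d m + d n) -> exists l, hcvg ip u_ l.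
Proof.
move=> d0 h; apply: (ip_complete hV) => e e0.
have e2 : 0 < e / 2 by rewrite divr_gt0.
move/cvgr0Pnorm_lt : d0 => /(_ _ e2)[N _ hN].
exists N => m n /hN /= hm /hN /= hn; apply: le_lt_trans (h m n) _.
rewrite [ltRHS]splitr; apply: ltrD.
  by rewrite (le_lt_trans (ler_norm _)).
by rewrite (le_lt_trans (ler_norm _)).
Qed.

Lemma hcvgP (u_ : nat -> V) l : hcvg ip u_ l <->
  (forall e : R, 0 < e -> exists N, forall n, (N <= n)%N -> nm (u_ n - l) < e).
Proof.
split=> [/cvgr0Pnorm_lt h e /h [N _ hN]|h].
  by exists N => n /hN /=; rewrite ger0_norm ?nm_ge0.
apply/cvgr0Pnorm_lt => e /h [N hN].
by exists N => // n /hN /=; rewrite ger0_norm ?nm_ge0.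
Qed.

Lemma hcvg_nm (u_ : nat -> V) l : hcvg ip u_ l -> (fun n => nm (u_ n)) @ \oo --> nm l.
Proof.
move=> /hcvgP h; apply/cvgrPdist_lt => e /h [N hN].
exists N => // n /hN /=; apply: le_lt_trans.
rewrite ler_norml lerBrDl; apply/andP; split; last first.
  by rewrite lerBlDr addrC nmB nm_leB.
by rewrite lerBlDr nm_leB.
Qed.

(** Strong convergence on one side pays for weak convergence on the other; the bound on [v_]
    controls the error [ip (u_ n - u) (v_ n)]. *)
Lemma hcvg_ip (u_ v_ : nat -> V) u v : hcvg ip u_ u ->
  (forall phi, (fun n => ip phi (v_ n)) @ \oo --> ip phi v) ->
  (exists C, forall n, nm (v_ n) <= C) ->
  (fun n => ip (u_ n) (v_ n)) @ \oo --> ip u v.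
Proof.
move=> hu hv [C hC]; have C0 : 0 <= C := le_trans (nm_ge0 _) (hC 0%N).
have h0 : (fun n => C * nm (u_ n - u)) @ \oo --> 0.
  by rewrite -(mulr0 C); apply: cvgMr; exact: hu.
have /cvgr0Pnorm_lt {}h0 := h0.
apply/cvgrPdist_lt => e0 /gt0_ofR[e ep ->].
have e2 : 0 < e / 2 by rewrite divr_gt0.
have := h0 _ e2; have /cvgrPdist_lt /(_ (ofR k (e / 2))) := hv u.
rewrite -{1}ofR0 lt_ofR => /(_ e2); apply: filterS2 => n h1 h2.
have -> : ip u v - ip (u_ n) (v_ n) = (ip u v - ip u (v_ n)) - ip (u_ n - u) (v_ n).
  by rewrite ipBl; ring.
rewrite (le_lt_trans (ler_normB _ _))// [e in ofR k e]splitr ofRD ltrD//.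
rewrite normK lt_ofR (le_lt_trans (ip_le _ _))// mulrC.
rewrite (le_lt_trans _ h2)// (le_trans _ (ler_norm _))//.
by rewrite ler_wpM2r// nm_ge0.
Qed.

Lemma hcvg_ipr (u_ : nat -> V) u phi : hcvg ip u_ u ->
  (fun n => ip phi (u_ n)) @ \oo --> ip phi u.
Proof.
move=> hu; apply/cvgrPdist_lt => e0 /gt0_ofR[e ep ->].
have h0 : (fun n => nm phi * nm (u_ n - u)) @ \oo --> 0.
  by rewrite -(mulr0 (nm phi)); apply: cvgMr; exact: hu.
have /cvgr0Pnorm_lt/(_ _ ep) := h0.
apply: filterS => n; rewrite ger0_norm ?mulr_ge0 ?nm_ge0// => h.
rewrite -ipBr normK lt_ofR (le_lt_trans (ip_le _ _))//.
by rewrite nmB.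
Qed.

Lemma hcvg_ip0 (u_ : nat -> V) u phi : hcvg ip u_ u ->
  (forall n, ip phi (u_ n) = 0) -> ip phi u = 0.
Proof.
move=> hu h; have := @hcvg_ipr _ _ phi hu; under eq_fun do rewrite h.
move=> /cvgK[h1 h2]; apply: eqK; rewrite ?(reK0, imK0).
  apply: (@cvg_unique R^o (@norm_hausdorff _ R^o) _ _ _ _ h1).
  by rewrite /= reK0; exact: cvg_cst.
apply: (@cvg_unique R^o (@norm_hausdorff _ R^o) _ _ _ _ h2).
by rewrite /= imK0; exact: cvg_cst.
Qed.

Lemma hcvgD (u_ v_ : nat -> V) u v : hcvg ip u_ u -> hcvg ip v_ v ->
  hcvg ip (fun n => u_ n + v_ n) (u + v).
Proof.
move=> hu hv; apply: squeeze0 (cvg0D hu hv) => n; rewrite nm_ge0 /=.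
by rewrite (le_trans _ (nmD _ _))// opprD addrACA.
Qed.

Lemma hcvgZ c (u_ : nat -> V) u : hcvg ip u_ u -> hcvg ip (fun n => c *: u_ n) (c *: u).
Proof.
move=> hu; rewrite /hcvg.
under eq_fun do rewrite -scalerBr nmZ.
rewrite -(mulr0 (Num.sqrt (sqK c))); apply: cvgMr; exact: hu.
Qed.

(* [L] is the graph of a functional on a subspace, and [b] lies in the closure of this
   subspace. *)
Lemma riesz (L : V -> K -> Prop) (C : R) : L 0 0 ->
  (forall c v s v' s', L v s -> L v' s' -> L (c *: v + v') (c * s + s')) ->
  (forall v s, L v s -> reK s <= C * nm v) ->
  exists b, (exists v_ : nat -> V, (forall n, exists s, L (v_ n) s) /\ hcvg ip v_ b) /\
    forall v s, L v s -> s = ip b v.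
Proof.
move=> L0 Llin LC.
(* The representing vector is the limit of a minimising sequence of this quadratic functional; the
   parallelogram law makes the sequence Cauchy. *)
pose J v (s : K) := nm v ^+ 2 - 2 * reK s.
pose E : set R := [set r | exists v s, L v s /\ r = J v s].
have LZ c v s : L v s -> L (c *: v) (c * s).
  by move=> h; have := Llin c _ _ _ _ h L0; rewrite !addr0.
have LD v s v' s' : L v s -> L v' s' -> L (v + v') (s + s').
  by move=> h h'; have := Llin 1 _ _ _ _ h h'; rewrite scale1r mul1r.
have Elb : has_inf E.
  split; first by exists (J 0 0), 0, 0.
  exists (- C ^+ 2) => _ [v [s [h ->]]].
  have := LC _ _ h; have := sqr_ge0 (nm v - C); rewrite /J; lra.
have Jge v s : L v s -> inf E <= J v s.
  by move=> h; apply: ge_inf; [case: Elb|exists v, s].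
have /choice[p hp] n : exists p : V * K, L p.1 p.2 /\ J p.1 p.2 < inf E + harmonic n ^+ 2.
  have [|_ [v [s [h ->]]] hJ] := @inf_adherent _ E (harmonic n ^+ 2) _ Elb.
    by rewrite exprn_gt0// harmonic_gt0.
  by exists (v, s).
have [b hb] : exists b, hcvg ip (fun n => (p n).1) b.
  apply: (@hcvg_cauchy _ (fun n => 2 * harmonic n)) => [|m n].
    rewrite -(mulr0 2); apply: cvgMr; exact: cvg_harmonic.
  have [[hm Jm] [hn Jn]] := (hp m, hp n).
  rewrite -(ler_pXn2r (n := 2))// ?nnegrE ?nm_ge0 ?addr_ge0 ?mulr_ge0 ?harmonic_ge0//.
  have hmn := Jge _ _ (LZ (ofR k 2^-1) _ _ (LD _ _ _ _ hm hn)).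
  move: Jm Jn hmn; rewrite /J nmZr exprMn ger0_norm ?invr_ge0//.
  rewrite (reKM (ofR _ _)) reK_ofR imK_ofR mul0r subr0 reKD.
  rewrite sqr_nmB sqr_nmD.
  have : 0 <= harmonic m * harmonic n :> R by rewrite mulr_ge0 ?harmonic_ge0.
  have := sqr_ge0 (@harmonic R m); have := sqr_ge0 (@harmonic R n).
  lra.
exists b; split.
  by exists (fun n => (p n).1); split => // n; exists (p n).2; case: (hp n).
(* First variation at the minimiser: [2 r a + r^2 W] is nonnegative for every real [r], which forces
   [a = 0]. *)
have key w t : L w t -> reK t = reK (ip b w).
  move=> hw; set a := reK (ip b w) - reK t; set W := nm w ^+ 2.
  have ha r : 0 <= 2 * r * a + r ^+ 2 * W.
    have c1 : (fun n => 2 * r * (reK (ip (p n).1 w) - reK t) + r ^+ 2 * W) @ \oo -->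
        2 * r * a + r ^+ 2 * W.
      apply: cvgD; last exact: cvg_cst.
      apply: cvgMr; apply: cvgB; last exact: cvg_cst.
      have := @hcvg_ipr _ _ w hb => /cvgK[+ _].
      by under eq_fun do rewrite ripC; rewrite (ripC w).
    have c2 : (fun n => - (harmonic n ^+ 2)) @ \oo --> (0 : R).
      rewrite -oppr0; apply: cvgN; rewrite -(mulr0 0).
      by under eq_fun do rewrite expr2; apply: cvgM; exact: cvg_harmonic.
    apply: (ler_cvg_to c2 c1); apply: nearW => n.
    have [hn Jn] := hp n; have := Jge _ _ (LD _ _ _ _ hn (LZ (ofR k r) _ _ hw)).
    move: Jn; rewrite /J sqr_nmD ripZr nmZr exprMn real_normK ?num_real//.
    rewrite reKD (reKM (ofR _ _)) reK_ofR imK_ofR mul0r subr0 -/W; lra.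
  suff : a = 0 by rewrite /a; lra.
  have W0 : 0 <= W by rewrite sqr_ge0.
  have W1 : 0 < W + 1 by rewrite ltr_wpDl.
  apply/eqP; rewrite -sqrf_eq0 eq_le sqr_ge0 andbT.
  (* Nearly the minimiser of the quadratic in [r]; [W + 1] replaces [W], which may vanish. *)
  have := ha (- a / (W + 1)).
  have -> : 2 * (- a / (W + 1)) * a + (- a / (W + 1)) ^+ 2 * W =
     - ((W + 2) * a ^+ 2) / (W + 1) ^+ 2 by field; rewrite gt_eqF.
  rewrite pmulr_lge0 ?invr_gt0 ?exprn_gt0// oppr_ge0 pmulr_rle0//.
  by rewrite ltr_wpDl.
move=> v s h; apply: eqK_reM => c.
by rewrite -ipZr; apply: key; exact: LZ.
Qed.

Definition hclosed (W : set V) :=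
  [/\ W 0, forall c u v, W u -> W v -> W (c *: u + v) &
      forall (u_ : nat -> V) l, (forall n, W (u_ n)) -> hcvg ip u_ l -> W l].

Definition orth (W : set V) : set V := [set x | forall w, W w -> ip w x = 0].

Definition pr (W : set V) (x : V) : V := xget 0 [set p | W p /\ orth W (x - p)].

(** * Orthogonal projections and the Lax-Milgram lemma *)

Section proj.
Variables (W : set V) (hW : hclosed W).

Lemma hclosedD u v : W u -> W v -> W (u + v).
Proof. by case: hW => _ h _ hu hv; have := h 1 _ _ hu hv; rewrite scale1r. Qed.
Lemma hclosedZ c u : W u -> W (c *: u).
Proof. by case: hW => h0 h _ hu; have := h c _ _ hu h0; rewrite addr0. Qed.
Lemma hclosedN u : W u -> W (- u).
Proof. by move=> hu; rewrite -scaleN1r; exact: hclosedZ. Qed.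
Lemma hclosedB u v : W u -> W v -> W (u - v).
Proof. by move=> hu hv; apply: hclosedD => //; exact: hclosedN. Qed.

(** Riesz for the functional [ip x] restricted to [W]: the representing vector lies in the closure
    of [W], hence in [W], and agreement with [ip x] on [W] is orthogonality of the difference. *)
Lemma prP x : W (pr W x) /\ orth W (x - pr W x).
Proof.
case: hW => W0 Wlin Wcl.
have [|c v s v' s' [hv ->] [hv' ->]|v s [hv ->]|b [[v_ [hv hb]] hL]] :=
    @riesz (fun v s => W v /\ s = ip x v) (nm x).
- by rewrite ip0r.
- by split; [exact: Wlin|rewrite ipDr ipZr].
- exact: rip_le.
apply: (@xgetPex _ 0 [set p | W p /\ orth W (x - p)]).
exists b; split; first by apply: Wcl hb => n; have [s []] := hv n.
move=> w hw; apply: ip_eq0C; rewrite ipBl -(hL w (ip x w)) ?subrr//.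
Qed.

Lemma pr_in x : W (pr W x). Proof. by case: (prP x). Qed.

Lemma pr_orth x : orth W (x - pr W x). Proof. by case: (prP x). Qed.

Lemma orth_self x : W x -> orth W x -> x = 0.
Proof. by move=> h1 h2; apply: (ip_def hV); rewrite h2// reK0. Qed.

Lemma pr_uniq x p : W p -> orth W (x - p) -> pr W x = p.
Proof.
move=> hp ho; apply/subr0_eq/orth_self; first by apply: hclosedB => //; exact: pr_in.
move=> w hw; have -> : pr W x - p = (x - p) - (x - pr W x) by rewrite opprB [RHS]addrC addrA subrK.
by rewrite ipBr ho// pr_orth// subrr.
Qed.

Lemma pr_id x : W x -> pr W x = x.
Proof. by move=> h; apply: pr_uniq => // w _; rewrite subrr ip0r. Qed.

Lemma pr_of_orth x : orth W x -> pr W x = 0.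
Proof. by move=> h; apply: pr_uniq; [case: hW|rewrite subr0]. Qed.

Lemma ip_prr w x : W w -> ip w (pr W x) = ip w x.
Proof.
by move=> hw; apply/eqP; rewrite -subr_eq0 -opprB oppr_eq0 -ipBr pr_orth.
Qed.

Lemma ip_prl w x : W w -> ip (pr W x) w = ip x w.
Proof. by move=> hw; rewrite (ip_conj hV) ip_prr// -(ip_conj hV). Qed.

Lemma ip_pr x y : ip (pr W x) y = ip x (pr W y).
Proof. by rewrite -(ip_prl _ (pr_in y)) ip_prr//; exact: pr_in. Qed.

Lemma pr_lin c x y : pr W (c *: x + y) = c *: pr W x + pr W y.
Proof.
case: (hW) => _ Wlin _; apply: pr_uniq; first by apply: Wlin; exact: pr_in.
move=> w hw; rewrite opprD addrACA -scalerBr ipDr ipZr !pr_orth//.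
by rewrite mulr0 addr0.
Qed.

Lemma prD x y : pr W (x + y) = pr W x + pr W y.
Proof. by have := pr_lin 1 x y; rewrite !scale1r. Qed.

Lemma pr0 : pr W 0 = 0.
Proof. by rewrite pr_id//; case: hW. Qed.

Lemma prZ c x : pr W (c *: x) = c *: pr W x.
Proof. by have := pr_lin c x 0; rewrite pr0 !addr0. Qed.

Lemma prN x : pr W (- x) = - pr W x.
Proof. by rewrite -scaleN1r prZ scaleN1r. Qed.

Lemma prB x y : pr W (x - y) = pr W x - pr W y.
Proof. by rewrite prD prN. Qed.

Lemma sqr_nm_pr x : nm x ^+ 2 = nm (pr W x) ^+ 2 + nm (x - pr W x) ^+ 2.
Proof.
have := sqr_nmD (pr W x) (x - pr W x).
rewrite addrCA subrr addr0 => ->; rewrite (pr_orth x (pr_in x)).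
by rewrite reK0 mulr0 addr0.
Qed.

Lemma nm_pr x : nm (pr W x) <= nm x.
Proof.
rewrite -(ler_pXn2r (n := 2))// ?nnegrE ?nm_ge0// (sqr_nm_pr x).
by rewrite lerDl sqr_ge0.
Qed.

Lemma hclosed_orth : hclosed (orth W).
Proof.
split=> [w _|c u v hu hv w hw|u_ l hu hl w hw]; first by rewrite ip0r.
  by rewrite ipDr ipZr hu// hv// mulr0 addr0.
by apply: (hcvg_ip0 hl) => n; exact: hu.
Qed.

(** Coercivity bounds [w] by the projection of [a' w] onto [W], so that [pr W (a' w)] determines
    [ip p w] with bound [nm p / al]. The Riesz vector of this functional lies in [W] and is the
    solution once [a'] is moved back to [a]. *)
Lemma laxmilgram (a a' : V -> V) (al : R) (p : V) : 0 < al ->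
  (forall x y, ip (a' x) y = ip x (a y)) ->
  (forall w, W w -> al * nm w ^+ 2 <= reK (ip w (a w))) ->
  exists2 b, W b & forall w, W w -> ip w (a b) = ip w p.
Proof.
move=> al0 adj coer.
have alin c x y : a' (c *: x + y) = c *: a' x + a' y.
  apply/subr0_eq/(ip_def hV); set z := _ - _; suff -> : ip z z = 0 by rewrite reK0.
  rewrite {1}/z ipBl adj !(ipDl, ipZl) !adj; ring.
have bnd w : W w -> al * nm w <= nm (pr W (a' w)).
  move=> hw; have [->|w0] := eqVneq (nm w) 0; first by rewrite mulr0 nm_ge0.
  have wp : 0 < nm w by rewrite lt_def w0 nm_ge0.
  rewrite -(ler_pM2l wp) mulrCA -expr2 (le_trans (coer w hw))//.
  by rewrite -adj ripC -ip_prr// rip_le.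
case: (hW) => W0 Wlin Wcl.
have [||v s [w [hw -> ->]]|b [[v_ [hv hb]] hL]] :=
    @riesz (fun v s => exists w, [/\ W w, v = pr W (a' w) & s = ip p w]) (nm p / al).
- have a0 : a' 0 = 0 by have := alin (-1) 0 0; rewrite scaler0 addr0 scaleN1r addNr.
  by exists 0; rewrite ip0r a0 pr0.
- move=> c v s v' s' [w [hw -> ->]] [w' [hw' -> ->]]; exists (c *: w + w').
  by rewrite alin pr_lin ipDr ipZr; split => //; exact: Wlin.
- rewrite (le_trans (rip_le _ _))// -mulrA ler_wpM2l ?nm_ge0//.
  by rewrite ler_pdivlMl// bnd.
have Wb : W b by apply: Wcl hb => n; have [s [w [_ -> _]]] := hv n; exact: pr_in.
exists b => // w hw; rewrite (ip_conj hV) [RHS](ip_conj hV); congr conjK.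
rewrite [RHS](hL (pr W (a' w))); last by exists w.
by rewrite ip_prr// (ip_conj hV (a' w)) adj -(ip_conj hV).
Qed.

End proj.
End basics.

Definition ip2 (V : lmodType K) (ip : V -> V -> K) (p q : V * V) : K :=
  ip p.1 q.1 + ip p.2 q.2.

(** * Graphs of operators as subspaces of the space of pairs *)

Section prod.
Variables (V : lmodType K) (ip : V -> V -> K) (hV : hilbert ip).
Local Notation nm := (hnrm ip).
Local Notation nm2 := (hnrm (ip2 ip)).

Lemma sqr_nm2 p : nm2 p ^+ 2 = nm p.1 ^+ 2 + nm p.2 ^+ 2.
Proof.
by rewrite {1}/hnrm sqr_sqrtr /ip2 reKD ?addr_ge0 ?(ip_ge0 hV)// !(sqr_nm hV).
Qed.

Lemma nm2_fst p : nm p.1 <= nm2 p.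
Proof.
rewrite -(ler_pXn2r (n := 2))// ?nnegrE ?sqrtr_ge0// sqr_nm2.
by rewrite lerDl sqr_ge0.
Qed.

Lemma nm2_snd p : nm p.2 <= nm2 p.
Proof.
rewrite -(ler_pXn2r (n := 2))// ?nnegrE ?sqrtr_ge0// sqr_nm2.
by rewrite lerDr sqr_ge0.
Qed.

Lemma nm2_le p : nm2 p <= nm p.1 + nm p.2.
Proof.
rewrite -(ler_pXn2r (n := 2))// ?nnegrE ?addr_ge0 ?sqrtr_ge0// sqr_nm2.
have : 0 <= nm p.1 * nm p.2 by rewrite mulr_ge0 ?sqrtr_ge0.
rewrite sqrrD; lra.
Qed.

Lemma hcvg2 (u_ : nat -> V * V) l : hcvg (ip2 ip) u_ l <->
  hcvg ip (fun n => (u_ n).1) l.1 /\ hcvg ip (fun n => (u_ n).2) l.2.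
Proof.
split=> [h|[h1 h2]].
  split; apply: squeeze0 h => n; rewrite sqrtr_ge0.
    exact: (nm2_fst (u_ n - l)).
  exact: (nm2_snd (u_ n - l)).
by apply: squeeze0 (cvg0D h1 h2) => n; rewrite sqrtr_ge0 (nm2_le (u_ n - l)).
Qed.

Lemma hilbert2 : hilbert (ip2 ip).
Proof.
split=> [c [u1 u2] [v1 v2] [w1 w2]|u v|u|[u1 u2]|u_ hu].
- by rewrite /ip2 /= !(ip_lin hV); ring.
- by rewrite /ip2 conjKD -!(ip_conj hV).
- by rewrite reKD addr_ge0// (ip_ge0 hV).
- rewrite /ip2 reKD => /eqP; rewrite paddr_eq0 ?(ip_ge0 hV)// => /andP[].
  by move=> /eqP/(ip_def hV)/= -> /eqP/(ip_def hV)/= ->.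
have [l1 h1] : exists l, hcvg ip (fun n => (u_ n).1) l.
  apply: (ip_complete hV) => e /hu[N h]; exists N => m n hm hn.
  by apply: le_lt_trans (h _ _ hm hn); exact: (nm2_fst (u_ m - u_ n)).
have [l2 h2] : exists l, hcvg ip (fun n => (u_ n).2) l.
  apply: (ip_complete hV) => e /hu[N h]; exists N => m n hm hn.
  by apply: le_lt_trans (h _ _ hm hn); exact: (nm2_snd (u_ m - u_ n)).
by exists (l1, l2); apply/hcvg2.
Qed.

(** The adjoint of the adjoint is the closure. If [(b1, b2)] is the projection of [(w, c)] onto the
    closure of [A], orthogonality of the residual to [A] says that [(c - b2, - (w - b1))] belongs to
    the adjoint of [A]. Testing the hypothesis with this pair makes the residual orthogonal to
    [(w, c)] as well, hence to itself. *)
Lemma double_adjoint (A : set (V * V)) (w c : V) :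
  A 0 -> (forall (s : K) p q, A p -> A q -> A (s *: p + q)) ->
  (forall x y, (forall u d, A (u, d) -> ip d x = ip u y) -> ip y w = ip x c) ->
  exists2 p_ : nat -> V * V, (forall n, A (p_ n)) & hcvg (ip2 ip) p_ (w, c).
Proof.
move=> A0 Alin Aadj; have h2 := hilbert2.
have [|||[b1 b2] [[p_ [hp hb]] hL]] :=
  @riesz _ _ h2 (fun p s => A p /\ s = ip2 ip (w, c) p) (nm2 (w, c)).
- by rewrite (ip0r h2).
- by move=> s p t p' t' [hp ->] [hp' ->]; split; [exact: Alin|rewrite (ip_lin h2)].
- by move=> p s [_ ->]; exact: (rip_le h2).
have orthA p : A p -> ip2 ip p (w - b1, c - b2) = 0.
  move=> hA; apply: (ip_eq0C h2); rewrite (_ : (w - b1, c - b2) = (w, c) - (b1, b2))//.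
  by rewrite (ipBl h2) -(hL p (ip2 ip (w, c) p)) ?subrr.
have {}hp n : A (p_ n) by have [s []] := hp n.
have orthb : ip2 ip (b1, b2) (w - b1, c - b2) = 0.
  apply: (ip_eq0C h2); apply: (hcvg_ip0 h2 hb) => n.
  exact: (ip_eq0C h2 (orthA _ (hp _))).
suff [-> ->] : w = b1 /\ c = b2 by exists p_.
have hh : ip2 ip (w, c) (w - b1, c - b2) = 0.
  rewrite /ip2/= (ip_conj hV (w - b1) w) (ip_conj hV (c - b2) c).
  rewrite -(Aadj (c - b2) (- (w - b1))).
    by rewrite (ipNl hV) -conjKD subrr conjK0.
  move=> u d /orthA; rewrite /ip2/= (ipNr hV) => /eqP.
  by rewrite addr_eq0 => /eqP ->; rewrite opprK.
have : ip2 ip (w - b1, c - b2) (w - b1, c - b2) = 0.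
  by rewrite {1}(_ : (w - b1, c - b2) = (w, c) - (b1, b2))// (ipBl h2) hh orthb subrr.
move=> /(congr1 (@reK R k)); rewrite reK0 => /(ip_def h2)[/eqP + /eqP].
by rewrite !subr_eq0 => /eqP -> /eqP ->.
Qed.

(* A relation that is bounded below up to finitely many functionals is bounded
   below as soon as it is injective: each step removes one functional b, the
   complement of its kernel being at most one-dimensional. *)
Lemma bounded_below (bs : seq V) (D : set (V * V)) (C : R) :
  hclosed (ip2 ip) D -> 0 <= C ->
  (forall w c, D (w, c) ->
    nm w <= C * (nm c + \sum_(b <- bs) Num.sqrt (sqK (ip b w)))) ->
  (forall w, D (w, 0) -> w = 0) ->
  exists2 C' : R, 0 <= C' & forall w c, D (w, c) -> nm w <= C' * nm c.
Proof.
have h2 := hilbert2.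
elim: bs D C => [|b bs IH] D C hD C0 hC inj.
  by exists C => // w c /hC; rewrite big_nil addr0.
case: (hD) => D0 Dlin Dcl.
pose D' := [set p | D p /\ ip b p.1 = 0].
have hD' : hclosed (ip2 ip) D'.
  split=> [|s u v [hu ub] [hv vb]|u_ l hu hl].
  - by split => //; rewrite (ip0r hV).
  - by split; [exact: Dlin|rewrite (ip_lin hV) ub vb mulr0 addr0].
  split; first by apply: Dcl hl => n; case: (hu n).
  have [hl1 _] := (hcvg2 _ _).1 hl.
  by apply: (hcvg_ip0 hV hl1) => n; case: (hu n).
have [|w hw|C' C'0 hC'] := IH D' C hD' C0.
- by move=> w c [/hC h hb]; move: h; rewrite big_cons /= in hb *;
  rewrite hb /sqK reK0 imK0 expr0n addr0 sqrtr0 add0r.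
- by apply: inj; case: hw.
have [[p hp pb]|no] := pselect (exists2 p, D p & ip b p.1 != 0); last first.
  exists C' => // w c h; apply: hC'; split => //=.
  by apply: contrapT => /eqP h'; apply: no; exists (w, c).
(* Normalised so that [b] takes the value 1 on [q.1]: every element of [D] becomes an element of
   [D'] after subtracting a multiple of [q]. *)
pose q := (ip b p.1)^-1 *: p.
have hq : D q by exact: (hclosedZ hD).
have qb : ip b q.1 = 1 by rewrite /q /= (ipZr hV) mulVf.
(* Otherwise second components from [D'] approach [q.2]; by the estimate on [D'] the first
   components converge too, and injectivity identifies their limit with [q.1], on which [b] does not
   vanish. *)
have [e e0 he] : exists2 e : R, 0 < e & forall p, D' p -> e <= nm (q.2 - p.2).
  apply: contrapT => no.
  have /choice[p_ hp_] n : exists p, D' p /\ nm (q.2 - p.2) < harmonic n.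
    apply: contrapT => no'; apply: no; exists (harmonic n) => [|p' hp'].
      exact: harmonic_gt0.
    by rewrite leNgt; apply/negP => hlt; apply: no'; exists p'.
  have c2 : hcvg ip (fun n => (p_ n).2) q.2.
    apply: squeeze0 (@cvg_harmonic R) => n; rewrite sqrtr_ge0 /=.
    by rewrite (nmB hV) ltW//; case: (hp_ n).
  have [w1 c1] : exists l, hcvg ip (fun n => (p_ n).1) l.
    apply: (@hcvg_cauchy _ _ hV _ (fun n => C' * harmonic n)) => [|m n].
      rewrite -(mulr0 C'); apply: cvgMr; exact: cvg_harmonic.
    have : D' (p_ m - p_ n) by apply: (hclosedB hD'); case: (hp_ m); case: (hp_ n).
    case: (p_ m) (hp_ m) => u v [_ /= h1]; case: (p_ n) (hp_ n) => u' v' [_ /= h1'].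
    move=> /hC' /= h; rewrite (le_trans h)// -mulrDr ler_wpM2l//.
    rewrite (le_trans (nm_tri hV q.2 _ _))// lerD// ltW//.
    by rewrite (nmB hV).
  have [hl lb] : D' (w1, q.2).
    case: (hD') => _ _; apply; last by apply/hcvg2; split; [exact: c1|exact: c2].
    by move=> n; case: (hp_ n).
  have : D (q.1 - w1, 0).
    by have := hclosedB hD hq hl; rewrite (_ : q - _ = (q.1 - w1, q.2 - q.2))// subrr.
  move=> /inj/eqP; rewrite subr_eq0 => /eqP h; move: lb; rewrite /= -h qb.
  by apply/eqP; exact: oner_neq0.
exists (C' + (C' * nm q.2 + nm q.1) / e).
  apply: addr_ge0 => //; apply: divr_ge0; last exact: ltW.
  by rewrite addr_ge0 ?mulr_ge0 ?sqrtr_ge0.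
move=> w c h; set t := ip b w.
have hp' : D' (w - t *: q.1, c - t *: q.2).
  split; last by rewrite /= (ipBr hV) (ipZr hV) qb mulr1 subrr.
  by rewrite (_ : (_, _) = (w, c) - t *: q)//; apply: (hclosedB hD) => //; exact: (hclosedZ hD).
(* Divided by [- t], the element of [D'] above has second component [q.2 - t^-1 c], so the distance
   [e] bounds the functional [b] by [nm c]. *)
have ht : Num.sqrt (sqK t) <= nm c / e.
  rewrite ler_pdivlMr//; have [t0|t0] := eqVneq t 0.
    by rewrite t0 /sqK reK0 imK0 expr0n addr0 sqrtr0 mul0r sqrtr_ge0.
  have : D' (- t^-1 *: (w - t *: q.1, c - t *: q.2)) by exact: (hclosedZ hD').
  move=> /he/=; rewrite scaleNr opprK scalerBr scalerA mulVf// scale1r.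
  rewrite addrCA subrr addr0 => {}he.
  rewrite -[c in leRHS]scale1r -(mulfV t0) -scalerA (nmZ hV).
  by rewrite ler_wpM2l// sqrtr_ge0.
have h1 := hC' _ _ hp'.
have h3 : nm w <= nm (w - t *: q.1) + Num.sqrt (sqK t) * nm q.1.
  by rewrite -(nmZ hV) -{1}(subrK (t *: q.1) w) (nmD hV).
have h4 : nm (c - t *: q.2) <= nm c + Num.sqrt (sqK t) * nm q.2.
  by rewrite -(nmZ hV) (le_trans (nmD hV _ _))// (nmN hV).
have h5 : nm w <= C' * nm c + Num.sqrt (sqK t) * (C' * nm q.2 + nm q.1).
  rewrite (le_trans h3)// (le_trans (lerD h1 (lexx _)))//.
  have := ler_wpM2l C'0 h4; lra.
rewrite (le_trans h5)// mulrDl lerD2l -[leRHS]mulrA [leRHS]mulrC ler_wpM2r//.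
  by rewrite addr_ge0 ?mulr_ge0 ?sqrtr_ge0.
by rewrite mulrC.
Qed.

End prod.

End hilbert.

(** * Completeness of L_2 *)

Section square_integrable.
Context d (T : measurableType d) (R : realType).
Variable (mu : {measure set T -> \bar R}).

Lemma Lfun2P (f : T -> R) : f \in Lfun mu 2%:E <->
  measurable_fun setT f /\ (\int[mu]_x ((f x) ^+ 2)%:E < +oo)%E.
Proof.
split=> [h|[mf hf]].
  split; first by move: (h); rewrite inE => /andP[+ _]; rewrite inE.
  have /integrableP[_] := Lfun2_integrable_sqr h.
  by under eq_integral do rewrite /= ger0_norm ?sqr_ge0//.
rewrite inE; apply/andP; split; rewrite inE//= /finite_norm.
have h2 : (2 : R) != 0%R by [].
apply: (@lty_poweRy _ _ 2) => //.
rewrite (powR_Lnorm _ _ h2).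
by under eq_integral do rewrite poweR_EFin (powR_mulrn 2)// real_normK ?num_real//.
Qed.

Lemma Lfun2_mul_integrable (f g : T -> R) : f \in Lfun mu 2%:E ->
  g \in Lfun mu 2%:E -> mu.-integrable setT (EFin \o (f \* g)).
Proof. by move=> hf hg; apply/Lfun1_integrable; exact: Lfun2_mul_Lfun1. Qed.

Lemma Lfun2D (f g : T -> R) : f \in Lfun mu 2%:E ->
  g \in Lfun mu 2%:E -> (fun x => f x + g x) \in Lfun mu 2%:E.
Proof.
have := Lfun_submod_closed mu (lee1n 2) => -[_ hh] hf hg.
by have := hh 1 f g hf hg; rewrite scale1r.
Qed.

Lemma Lfun2Z a (f : T -> R) : f \in Lfun mu 2%:E -> (fun x => a * f x) \in Lfun mu 2%:E.
Proof.
have := Lfun_submod_closed mu (lee1n 2) => -[h0 hh] hf.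
by have := hh a f 0 hf h0; rewrite addr0.
Qed.

Lemma Lfun2N (f : T -> R) : f \in Lfun mu 2%:E -> (fun x => - f x) \in Lfun mu 2%:E.
Proof. by move=> /(Lfun2Z (-1)); under eq_fun do rewrite mulN1r. Qed.

Lemma Lfun2B (f g : T -> R) : f \in Lfun mu 2%:E ->
  g \in Lfun mu 2%:E -> (fun x => f x - g x) \in Lfun mu 2%:E.
Proof. by move=> hf /Lfun2N; exact: Lfun2D. Qed.

Lemma limn_einf_le (u : (\bar R)^nat) (e : \bar R) N :
  (forall n, (N <= n)%N -> (u n <= e)%E) -> (limn_einf u <= e)%E.
Proof.
move=> h; apply: (le_trans (limn_einf_sup u)).
rewrite limn_esup_lim; apply: lime_le; first exact: is_cvg_esups.
exists N => // n /= hn; apply: ub_ereal_sup => _ [m /= hm <-].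
by apply: h; exact: leq_trans hm.
Qed.

Lemma geometric_cvg (u : nat -> R) (C : R) :
  (forall n, `|u n.+1 - u n| <= geometric C 2^-1 n) -> cvgn u.
Proof.
move=> h.
have : cvgn (series (telescope u)).
  apply: normed_cvg; apply: (@series_le_cvg _ _ (geometric C 2^-1)) => //.
  - by move=> n; exact: normr_ge0.
  - by move=> n; exact: le_trans (h n).
  apply: is_cvg_geometric_series; rewrite ger0_norm ?invr_ge0//.
  by rewrite invf_lt1// ltr1n.
rewrite telescopeK => hc; have -> : u = (fun n => (u n - u 0%N) + u 0%N).
  by apply/funext => n; rewrite subrK.
by apply: is_cvgD => //; exact: is_cvg_cst.
Qed.

(** Riesz-Fischer. Along a fast subsequence the weighted squared gaps have an integrable sum [S];
    where [S] is finite it gives a geometric bound on the gaps, hence a pointwise limit, and Fatou's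
    lemma turns the Cauchy bound into a bound on the distance to the limit. *)
Lemma L2_complete (a : nat -> T -> R) : (forall n, a n \in Lfun mu 2%:E) ->
  (forall e : R, 0 < e -> exists N, forall m n, (N <= m)%N -> (N <= n)%N ->
     (\int[mu]_x ((a m x - a n x) ^+ 2)%:E < e%:E)%E) ->
  exists2 b, b \in Lfun mu 2%:E & forall e : R, 0 < e -> exists N, forall n,
     (N <= n)%N -> (\int[mu]_x ((a n x - b x) ^+ 2)%:E <= e%:E)%E.
Proof.
move=> ha hC.
have ma n : measurable_fun setT (a n) by case/Lfun2P: (ha n).
(* Gaps of order [8^-j] weighted by [4^j] still sum up, and [4^j] times a squared gap being at most
   [S] yields a gap of at most [sqrt S] times [2^-j]. *)
have tol0 j : 0 < (8^-1) ^+ j :> R by rewrite exprn_gt0// invr_gt0.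
have /choice[N_ hN] j := hC _ (tol0 j).
(* The sum of all thresholds up to [j] dominates each of them, without any monotonicity of [N_]; the
   summand [j] sends the index to infinity, as Fatou's lemma needs below. *)
pose nj j := (j + \sum_(i < j.+1) N_ i)%N.
have njge i j : (i <= j)%N -> (N_ i <= nj j)%N.
  move=> ij; rewrite /nj (bigD1 (Ordinal (ij : (i < j.+1)%N)))//=.
  by rewrite addnCA leq_addr.
pose c j := a (nj j).
pose h j x : \bar R := (4 ^+ j * (c j.+1 x - c j x) ^+ 2)%:E.
have mh j : measurable_fun setT (h j).
  apply/measurable_EFinP; apply: measurable_funM => //; apply: measurable_funX.
  by apply: measurable_funB; exact: ma.
have h0 j x : (0 <= h j x)%E by rewrite lee_fin mulr_ge0 ?sqr_ge0 ?exprn_ge0.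
pose S x := (\sum_(0 <= j <oo) h j x)%E.
have S0 x : (0 <= S x)%E by apply: nneseries_ge0 => *; exact: h0.
have mS : measurable_fun setT S.
  by apply: ge0_emeasurable_sum => // j x _ _; exact: h0.
have iS : (\int[mu]_x S x < +oo)%E.
  rewrite integral_nneseries//.
  have hj j : (\int[mu]_x h j x <= (2^-1 ^+ j)%:E)%E.
    rewrite /h; under eq_integral do rewrite EFinM.
    have mm : measurable_fun setT (fun x => ((c j.+1 x - c j x) ^+ 2)%:E).
      apply/measurable_EFinP; apply: measurable_funX.
      by apply: measurable_funB; exact: ma.
    rewrite ge0_integralZl//=; last by move=> x _; rewrite lee_fin sqr_ge0.
    have /ltW hle := hN j (nj j.+1) (nj j) (njge _ _ (leqnSn j)) (njge _ _ (leqnn j)).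
    apply: (le_trans (lee_wpmul2l _ hle)); first by rewrite lee_fin exprn_ge0.
    rewrite -EFinM lee_fin -exprMn.
    by rewrite (_ : 4 * 8^-1 = 2^-1 :> R)//; field.
  apply: (@le_lt_trans _ _ (\sum_(0 <= j <oo) (2^-1 ^+ j)%:E)%E).
    by apply: lee_nneseries => // j _ _; apply: integral_ge0 => x _; exact: h0.
  have hg := @cvg_geometric_series R 1 2^-1.
  have h12 : `|2^-1 : R| < 1 by rewrite ger0_norm ?invr_ge0// invf_lt1// ltr1n.
  have {hg} := hg h12 => hg.
  have -> : (\sum_(0 <= j <oo) (2^-1 ^+ j)%:E)%E = (1 / (1 - 2^-1) : R)%:E.
    apply/cvg_lim => //; apply/cvg_EFin.
      by apply: nearW => n; rewrite sumEFin.
    apply: cvg_trans hg; apply: near_eq_cvg; apply: nearW => n.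
    rewrite /= sumEFin /series/=; apply: eq_bigr => i _.
    by rewrite /geometric/= mul1r.
  exact: ltry.
have aeS : {ae mu, forall x, S x \is a fin_num}.
  have : mu.-integrable setT S.
    apply/integrableP; split => //.
    by under eq_integral do rewrite gee0_abs//.
  by move=> /integrable_ae => /(_ measurableT); apply: filterS => x /(_ Logic.I).
have cc x : S x \is a fin_num -> cvgn (c^~ x).
  move=> /fineK Sx; apply: (@geometric_cvg _ (Num.sqrt (fine (S x)))) => j.
  have : (h j x <= S x)%E.
    rewrite /S (@nneseriesD1 _ _ j) //.
    rewrite leeDl//; apply: nneseries_ge0 => *; exact: h0.
  rewrite -Sx lee_fin => hle.
  have fS : 0 <= fine (S x) by rewrite fine_ge0.
  rewrite /geometric/= -(ler_pXn2r (n := 2))// ?nnegrE ?mulr_ge0 ?sqrtr_ge0 ?exprn_ge0 ?invr_ge0//.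
  rewrite real_normK ?num_real// exprMn sqr_sqrtr// -exprM mulnC exprM.
  have -> : 2^-1 ^+ 2 = 4^-1 :> R by field.
  by rewrite exprVn ler_pdivlMr ?exprn_gt0// mulrC.
(* The upper limit is measurable whether or not the limit exists, and equals the limit where [S] is
   finite. *)
pose b x := fine (limn_esup (fun j => (c j x)%:E)).
have mb : measurable_fun setT b.
  apply: measurableT_comp; first exact: fine_measurable.
  by apply: measurable_fun_limn_esup => j; apply/measurable_EFinP; exact: ma.
have cb x : S x \is a fin_num -> c^~ x @ \oo --> b x.
  move=> /cc /cvg_ex[l hl]; suff -> : b x = l by [].
  have : (fun j => (c j x)%:E) @ \oo --> l%:E by exact: cvg_comp hl _.
  by rewrite /b => /cvg_limn_einf_sup[_ ->].
have key e N : (forall m n, (N <= m)%N -> (N <= n)%N ->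
     (\int[mu]_x ((a m x - a n x) ^+ 2)%:E < e%:E)%E) -> forall n, (N <= n)%N ->
     (\int[mu]_x ((a n x - b x) ^+ 2)%:E <= e%:E)%E.
  move=> he n hn.
  have mcj j : measurable_fun setT (fun x => ((a n x - c j x) ^+ 2)%:E).
    by apply/measurable_EFinP; apply: measurable_funX; apply: measurable_funB; exact: ma.
  rewrite (@ae_eq_integral _ _ _ mu setT (fun x => limn_einf (fun j =>
    ((a n x - c j x) ^+ 2)%:E)))//.
  - apply: (le_trans (fatou mu measurableT mcj _)) => //.
      by move=> j x _; rewrite lee_fin sqr_ge0.
    apply: (@limn_einf_le _ _ N) => j hj; apply/ltW/he => //.
    by rewrite /nj (leq_trans hj)// leq_addr.
  - by apply/measurable_EFinP; apply: measurable_funX; apply: measurable_funB.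
  - have -> : (fun x => limn_einf (fun j => ((a n x - c j x) ^+ 2)%:E)) =
       (fun x => - limn_esup (fun j => - ((a n x - c j x) ^+ 2)%:E))%E.
      by apply/funext => x; rewrite -[LHS]oppeK -limn_esupN.
    apply: measurableT_comp => //; apply: measurable_fun_limn_esup => j.
    exact: measurableT_comp.
  - apply: filterS aeS => x /cb hb _; apply/esym.
    suff /cvg_limn_einf_sup[-> //] : (fun j => ((a n x - c j x) ^+ 2)%:E) @ \oo -->
      ((a n x - b x) ^+ 2)%:E.
    suff h2 : (fun j => (a n x - c j x) ^+ 2) @ \oo --> (a n x - b x) ^+ 2.
      exact: cvg_comp h2 _.
    under eq_fun do rewrite expr2; rewrite expr2.
    by apply: cvgM; apply: cvgB => //; exact: cvg_cst.
exists b; last first.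
  by move=> e /hC[N hNe]; exists N => n hn; exact: (key _ N).
have [N hN1] := hC 1 ltr01.
have hab : (fun x => a N x - b x) \in Lfun mu 2%:E.
  apply/Lfun2P; split; first exact: measurable_funB.
  by rewrite (le_lt_trans (key _ _ hN1 N (leqnn N)))// ltry.
have := Lfun2B (ha N) hab.
by under eq_fun do rewrite opprB addrC subrK.
Qed.
End square_integrable.

Section L2_hilbert.
Context d (T : measurableType d) (R : realType).
Variables (mu : {measure set T -> \bar R}) (k : scalars).
Local Notation K := (scal R k).
Local Notation L := (L2 mu k).
Implicit Types (u v w : L) (c : K).

(** The form [ips] over an arbitrary measure space. *)
Definition ipL u v : K :=
  mkK k (\int[mu]_x reK (conjK (repr u x) * repr v x))
        (\int[mu]_x imK (conjK (repr u x) * repr v x)).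

Lemma sqint_re (f : sqint_fun mu k) : (fun x => reK (f x)) \in Lfun mu 2%:E.
Proof. by case: f => f /= /andP[]. Qed.

Lemma sqint_im (f : sqint_fun mu k) : (fun x => imK (f x)) \in Lfun mu 2%:E.
Proof. by case: f => f /= /andP[]. Qed.

Lemma repr_pi_ae (f : sqint_fun mu k) : {ae mu, forall x, repr (\pi_L%qT f) x = f x}.
Proof.
have : repr (\pi_L%qT f) - f \in @Defs.null_fun _ _ _ mu k.
  by rewrite Quotient.idealrBE reprK.
move=> /asboolP; apply: filterS => x /= h.
by apply/eqP; rewrite -subr_eq0; apply/eqP.
Qed.

Lemma L2_eq u v : {ae mu, forall x, repr u x = repr v x} -> u = v.
Proof.
move=> h; rewrite -[u]reprK -[v]reprK; apply/eqP; rewrite -Quotient.idealrBE.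
apply/asboolP; apply: filterS h => x hx.
by rewrite -[LHS]/(repr u x - repr v x) hx subrr.
Qed.

Lemma repr_lin_ae c u v :
  {ae mu, forall x, repr (c *: u + v) x = c * repr u x + repr v x}.
Proof.
have h1 : {ae mu, forall x, repr (c *: u) x = c * repr u x} := repr_pi_ae (c *: repr u).
have -> : c *: u + v = \pi_L%qT (repr (c *: u) + repr v).
  by rewrite (Quotient.pi_add (@Defs.null_fun _ _ _ mu k)) !reprK.
by apply: filterS2 h1 (repr_pi_ae (repr (c *: u) + repr v)) => x <- ->.
Qed.

Lemma ae_eq_Rintegral (f g : T -> R) : mu.-integrable setT (EFin \o f) ->
  mu.-integrable setT (EFin \o g) -> {ae mu, forall x, f x = g x} ->
  \int[mu]_x f x = \int[mu]_x g x.
Proof.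
move=> /integrableP[mf _] /integrableP[mg _] h; congr fine.
by apply: ae_eq_integral => //; apply: filterS h => x + _ /=; move=> ->.
Qed.

Lemma integrable_re_conjM (f g : sqint_fun mu k) :
  mu.-integrable setT (EFin \o (fun x => reK (conjK (f x) * g x))).
Proof.
have h1 := Lfun2_mul_integrable (sqint_re f) (sqint_re g).
have h2 := Lfun2_mul_integrable (sqint_im f) (sqint_im g).
have := integrableD measurableT h1 h2; apply: eq_integrable => // x _ /=.
by rewrite -EFinD !(reKE, imKE); congr EFin; ring.
Qed.

Lemma integrable_im_conjM (f g : sqint_fun mu k) :
  mu.-integrable setT (EFin \o (fun x => imK (conjK (f x) * g x))).
Proof.
have h1 := Lfun2_mul_integrable (sqint_re f) (sqint_im g).
have h2 := Lfun2_mul_integrable (sqint_im f) (sqint_re g).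
have := integrableB measurableT h1 h2; apply: eq_integrable => // x _ /=.
by rewrite -EFinB !(reKE, imKE); congr EFin; ring.
Qed.

Lemma reK_ipL u v : reK (ipL u v) = \int[mu]_x reK (conjK (repr u x) * repr v x).
Proof. exact: reK_mk. Qed.

Lemma imK_ipL u v : imK (ipL u v) = \int[mu]_x imK (conjK (repr u x) * repr v x).
Proof.
rewrite /ipL; case: k u v => //= u v.
under eq_Rintegral do rewrite /=.
by rewrite /Rintegral integral0.
Qed.

Lemma ipL_lin c u v w : ipL u (c *: v + w) = c * ipL u v + ipL u w.
Proof.
have hae := repr_lin_ae c v w.
apply: eqK.
  rewrite reKD reKM !(reK_ipL, imK_ipL).
  rewrite -RintegralZl//; last exact: integrable_re_conjM.
  rewrite -RintegralZl//; last exact: integrable_im_conjM.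
  rewrite -RintegralB//; [|exact: (integrableZl _ _ (integrable_re_conjM _ _))|exact:
    (integrableZl _ _ (integrable_im_conjM _ _))].
  rewrite -RintegralD//; [|exact: (integrableB _ (integrableZl _ _ (integrable_re_conjM _ _))
    (integrableZl _ _ (integrable_im_conjM _ _)))|exact: integrable_re_conjM].
  apply: ae_eq_Rintegral.
  - exact: integrable_re_conjM.
  - exact: (integrableD _ (integrableB _ (integrableZl _ _ (integrable_re_conjM _ _))
    (integrableZl _ _ (integrable_im_conjM _ _))) (integrable_re_conjM _ _)).
  apply: filterS hae => x ->; rewrite mulrDr mulrCA.
  by rewrite reKD (reKM c).
rewrite imKD imKM !(reK_ipL, imK_ipL).
rewrite -RintegralZl//; last exact: integrable_im_conjM.
rewrite -RintegralZl//; last exact: integrable_re_conjM.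
rewrite -RintegralD//; [|exact: (integrableZl _ _ (integrable_im_conjM _ _))|exact: (integrableZl
  _ _ (integrable_re_conjM _ _))].
rewrite -RintegralD//; [|exact: (integrableD _ (integrableZl _ _ (integrable_im_conjM _ _))
  (integrableZl _ _ (integrable_re_conjM _ _)))|exact: integrable_im_conjM].
apply: ae_eq_Rintegral.
- exact: integrable_im_conjM.
- exact: (integrableD _ (integrableD _ (integrableZl _ _ (integrable_im_conjM _ _)) (integrableZl
  _ _ (integrable_re_conjM _ _))) (integrable_im_conjM _ _)).
apply: filterS hae => x ->; rewrite mulrDr mulrCA.
by rewrite imKD (imKM c).
Qed.

Lemma ipL_conj u v : ipL v u = conjK (ipL u v).
Proof.
apply: eqK; rewrite ?reK_conj ?imK_conj !(reK_ipL, imK_ipL).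
  by apply: eq_Rintegral => x _; rewrite !(reKE, imKE); ring.
rewrite -mulN1r -RintegralZl//; last exact: integrable_im_conjM.
by apply: eq_Rintegral => x _; rewrite !(reKE, imKE); ring.
Qed.

Lemma EFin_nmL (f : sqint_fun mu k) u : {ae mu, forall x, repr u x = f x} ->
  (reK (ipL u u))%:E = (\int[mu]_x ((reK (f x)) ^+ 2)%:E + \int[mu]_x ((imK (f x)) ^+ 2)%:E)%E.
Proof.
move=> h; rewrite reK_ipL.
rewrite (@ae_eq_Rintegral _ (fun x => reK (conjK (f x) * f x))).
- rewrite fineK; last exact/integrable_fin_num/integrable_re_conjM.
  have [[mr _] [mi _]] := ((Lfun2P _ _).1 (sqint_re f), (Lfun2P _ _).1 (sqint_im f)).
  rewrite -ge0_integralD//.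
  - by apply: eq_integral => x _; rewrite reK_conjM EFinD.
  - by move=> x _; rewrite lee_fin sqr_ge0.
  - by apply/measurable_EFinP; exact: measurable_funX.
  - by move=> x _; rewrite lee_fin sqr_ge0.
  - by apply/measurable_EFinP; exact: measurable_funX.
- exact: integrable_re_conjM.
- exact: integrable_re_conjM.
by apply: filterS h => x ->.
Qed.

Lemma EFin_nmLB u v : (reK (ipL (u - v) (u - v)))%:E =
  (\int[mu]_x ((reK (repr u x) - reK (repr v x)) ^+ 2)%:E +
   \int[mu]_x ((imK (repr u x) - imK (repr v x)) ^+ 2)%:E)%E.
Proof.
rewrite (@EFin_nmL (repr u - repr v)).
  congr (_ + _)%E; apply: eq_integral => x _.
    by rewrite -reKB.
  by rewrite -imKB.
have := repr_lin_ae (-1) v u; rewrite scaleN1r addrC; apply: filterS => x ->.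
by rewrite mulN1r addrC.
Qed.

Lemma hilbertL : hilbert ipL.
Proof.
split; [exact: ipL_lin|exact: ipL_conj| | |].
- move=> u; rewrite -lee_fin (@EFin_nmL (repr u)); last exact: aeW.
  by rewrite adde_ge0// integral_ge0// => x _; rewrite lee_fin sqr_ge0.
- move=> u u0; have {u0} : (reK (ipL u u))%:E = 0%E by rewrite u0.
  rewrite (@EFin_nmL (repr u)); last exact: aeW.
  move/eqP; rewrite padde_eq0 ?integral_ge0//; last 2 first.
    by move=> x _; rewrite lee_fin sqr_ge0.
    by move=> x _; rewrite lee_fin sqr_ge0.
  have [[mr _] [mi _]] := ((Lfun2P _ _).1 (sqint_re (repr u)), (Lfun2P _ _).1 (sqint_im (repr u))).
  move=> /andP[/eqP h1 /eqP h2].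
  have e1 := (ae_eq_integral_abs mu measurableT (_ : measurable_fun setT (fun x =>
    ((reK (repr u x)) ^+ 2)%:E))).1.
  have e2 := (ae_eq_integral_abs mu measurableT (_ : measurable_fun setT (fun x =>
    ((imK (repr u x)) ^+ 2)%:E))).1.
  have {}e1 : ae_eq mu setT (fun x => ((reK (repr u x)) ^+ 2)%:E) (cst 0%E).
    apply: e1; first by apply/measurable_EFinP; exact: measurable_funX.
    by under eq_integral do rewrite gee0_abs ?lee_fin ?sqr_ge0//.
  have {}e2 : ae_eq mu setT (fun x => ((imK (repr u x)) ^+ 2)%:E) (cst 0%E).
    apply: e2; first by apply/measurable_EFinP; exact: measurable_funX.
    by under eq_integral do rewrite gee0_abs ?lee_fin ?sqr_ge0//.
  apply: L2_eq.
  have h0 : {ae mu, forall x, repr (0 : L) x = 0} 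
    by have := repr_lin_ae (-1) u u; rewrite scaleN1r addNr; apply: filterS => x ->;
      rewrite mulN1r addNr.
  near=> x; have -> : repr (0 : L) x = 0 by near: x.
  have : ((reK (repr u x)) ^+ 2)%:E = 0%E :> \bar R.
    by apply: (near e1 x) => //; near: x.
  have : ((imK (repr u x)) ^+ 2)%:E = 0%E :> \bar R.
    by apply: (near e2 x) => //; near: x.
  move=> [/eqP] + [/eqP]; rewrite !sqrf_eq0 => /eqP hi /eqP hr.
  by apply: eqK; rewrite ?hi ?hr ?reK0 ?imK0.
move=> u_ hC.
have hn m n e : 0 < e -> hnrm ipL (u_ m - u_ n) < e ->
    (\int[mu]_x ((reK (repr (u_ m) x) - reK (repr (u_ n) x)) ^+ 2)%:E < (e ^+ 2)%:E)%E /\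
    (\int[mu]_x ((imK (repr (u_ m) x) - imK (repr (u_ n) x)) ^+ 2)%:E < (e ^+ 2)%:E)%E.
  move=> e0; rewrite /hnrm => h.
  have {h} : reK (ipL (u_ m - u_ n) (u_ m - u_ n)) < e ^+ 2.
    by move: h; rewrite -[ltRHS]ger0_norm ?ltW// -sqrtr_sqr ltr_sqrt ?exprn_gt0.
  rewrite -lte_fin EFin_nmLB => h; split; apply: le_lt_trans h.
    by rewrite leeDl// integral_ge0// => x _; rewrite lee_fin sqr_ge0.
  by rewrite leeDr// integral_ge0// => x _; rewrite lee_fin sqr_ge0.
have hs e : 0 < e -> exists2 e' : R, 0 < e' & e' ^+ 2 <= e.
  move=> e0; exists (Num.sqrt e); first by rewrite sqrtr_gt0.
  by rewrite sqr_sqrtr// ltW.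
have [|br hbr cr] := @L2_complete _ _ _ mu (fun n x => reK (repr (u_ n) x)) (fun n => sqint_re _).
  move=> e /hs[e' e'0 he]; have [N hN] := hC _ e'0; exists N => m n hm hn'.
  have [h _] := hn _ _ _ e'0 (hN _ _ hm hn').
  by apply: lt_le_trans h _; rewrite lee_fin.
have [|bi hbi ci] := @L2_complete _ _ _ mu (fun n x => imK (repr (u_ n) x)) (fun n => sqint_im _).
  move=> e /hs[e' e'0 he]; have [N hN] := hC _ e'0; exists N => m n hm hn'.
  have [_ h] := hn _ _ _ e'0 (hN _ _ hm hn').
  by apply: lt_le_trans h _; rewrite lee_fin.
(* Over the reals [mkK] drops the imaginary part, while [bi] is only some limit of zero functions;
   an inequality covers both scalar fields. *)
have [f [fr fi]] : exists f : sqint_fun mu k, (forall x, reK (f x) = br x) /\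
    (forall x (z : K), (imK z - imK (f x)) ^+ 2 <= (imK z - bi x) ^+ 2).
  have him x : imK (mkK k (br x) (bi x)) = if k is RealScalars then 0 else bi x.
    by case: (k).
  have hf : (fun x => mkK k (br x) (bi x)) \in @sqint _ _ _ mu k.
    apply/andP; split; first by under eq_fun do rewrite reK_mk.
    under eq_fun do rewrite him; case: (k) => //.
    by have := Lfun2Z 0 hbr; under eq_fun do rewrite mul0r.
  exists (SqintFun hf); split => [x|x z] /=; first by rewrite reK_mk.
  rewrite him; case: k z {him hf} => //= z; by rewrite subrr expr0n sqr_ge0.
exists (\pi_L%qT f); apply/cvgr0Pnorm_lt => e e0.
(* Thirds, so that two non-strict bounds add up to a strict one. *)
have e3 : 0 < e ^+ 2 / 3 by rewrite divr_gt0// exprn_gt0.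
have [N1 h1] := cr _ e3; have [N2 h2] := ci _ e3.
exists (maxn N1 N2) => // n /=; rewrite geq_max => /andP[/h1 hr /h2 hi].
rewrite ger0_norm ?sqrtr_ge0// -[ltRHS]ger0_norm ?ltW// -sqrtr_sqr ltr_sqrt ?exprn_gt0//.
have fae := repr_pi_ae f.
rewrite -lte_fin (@EFin_nmL (repr (u_ n) - f)); last first.
  have := repr_lin_ae (-1) (\pi_L%qT f) (u_ n); rewrite scaleN1r addrC.
  by apply: filterS2 fae => x -> ->; rewrite mulN1r addrC.
apply: (@le_lt_trans _ _ ((e ^+ 2 / 3)%:E + (e ^+ 2 / 3)%:E)%E); last first.
  by rewrite -EFinD lte_fin; move: e3; lra.
have [[mr _] [mi _]] := ((Lfun2P _ _).1 (sqint_re (repr (u_ n))),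
  (Lfun2P _ _).1 (sqint_im (repr (u_ n)))).
have [[mfr _] [mfi _]] := ((Lfun2P _ _).1 (sqint_re f), (Lfun2P _ _).1 (sqint_im f)).
apply: leeD.
  apply: le_trans hr; apply: ge0_le_integral => //.
  - by move=> x _; rewrite lee_fin sqr_ge0.
  - apply/measurable_EFinP; apply: measurable_funX.
    by apply: (eq_measurable_fun (fun x => reK (repr (u_ n) x) - reK (f x))); [move=> x _;
      rewrite -reKB|exact: measurable_funB].
  - apply/measurable_EFinP; apply: measurable_funX; apply: measurable_funB => //.
    by case/Lfun2P: hbr.
  - by move=> x _; rewrite lee_fin -fr -reKB.
apply: le_trans hi; apply: ge0_le_integral => //.
- by move=> x _; rewrite lee_fin sqr_ge0.
- apply/measurable_EFinP; apply: measurable_funX.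
  by apply: (eq_measurable_fun (fun x => imK (repr (u_ n) x) - imK (f x))); [move=> x _;
    rewrite -imKB|exact: measurable_funB].
- apply/measurable_EFinP; apply: measurable_funX; apply: measurable_funB => //.
  by case/Lfun2P: hbi.
by move=> x _; rewrite lee_fin imKB fi.
Unshelve. all: by end_near.
Qed.

End L2_hilbert.

Section finite_products.
Variables (R : realType) (k : scalars) (n : nat).
Local Notation K := (scal R k).
Variables (V : lmodType K) (ip : V -> V -> K) (hV : hilbert ip).

Definition ipF (u v : {ffun 'I_n -> V}) : K := \sum_i ip (u i) (v i).

Lemma reK_sum (I : Type) (r : seq I) (P : pred I) (F : I -> K) :
  reK (\sum_(i <- r | P i) F i) = \sum_(i <- r | P i) reK (F i).
Proof. by apply: (big_morph (@reK R k)); [exact: reKD|exact: reK0]. Qed.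

Lemma hnrmF_ge (u : {ffun 'I_n -> V}) i : hnrm ip (u i) <= hnrm ipF u.
Proof.
rewrite ler_wsqrtr// /ipF reK_sum (bigD1 i)//= lerDl.
by apply: sumr_ge0 => j _; exact: (ip_ge0 hV).
Qed.

Lemma sqr_hnrmF (u : {ffun 'I_n -> V}) : hnrm ipF u ^+ 2 = \sum_i hnrm ip (u i) ^+ 2.
Proof.
rewrite sqr_sqrtr /ipF reK_sum; last by apply: sumr_ge0 => i _; exact: (ip_ge0 hV).
by apply: eq_bigr => i _; rewrite (sqr_nm hV).
Qed.

Lemma hnrmF_le (u : {ffun 'I_n -> V}) : hnrm ipF u <= \sum_i hnrm ip (u i).
Proof.
rewrite -[leRHS]ger0_norm; last by apply: sumr_ge0 => i _; exact: sqrtr_ge0.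
rewrite -[leRHS]sqrtr_sqr ler_wsqrtr// /ipF reK_sum.
under eq_bigr do rewrite -(sqr_nm hV).
elim: (index_enum _) => [|i r IH]; first by rewrite !big_nil expr0n.
rewrite !big_cons; set a := hnrm ip (u i).
have a0 : 0 <= a := sqrtr_ge0 _.
have s0 : 0 <= \sum_(j <- r) hnrm ip (u j) by apply: sumr_ge0 => j _; exact: sqrtr_ge0.
have := mulr_ge0 a0 s0; move: IH; rewrite sqrrD; lra.
Qed.

Lemma hcvgF (u_ : nat -> {ffun 'I_n -> V}) l : hcvg ipF u_ l <->
  forall i, hcvg ip (fun m => u_ m i) (l i).
Proof.
split=> [h i|h].
  apply: squeeze0 h => m; rewrite sqrtr_ge0 /=.
  by have := hnrmF_ge (u_ m - l) i; rewrite !ffunE.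
have : (fun m => \sum_i hnrm ip (u_ m i - l i)) @ \oo --> (0 : R).
  elim: (index_enum _) => [|i r IH].
    by under eq_fun do rewrite big_nil; exact: cvg_cst.
  by under eq_fun do rewrite big_cons; apply: cvg0D => //; exact: h.
apply: squeeze0 => m; rewrite sqrtr_ge0 /= (le_trans (hnrmF_le _))//.
by apply: ler_sum => i _; rewrite !ffunE.
Qed.

Lemma hilbertF : hilbert ipF.
Proof.
split=> [c u v w|u v|u|u|u_ hC].
- rewrite /ipF mulr_sumr -big_split /=; apply: eq_bigr => i _.
  by rewrite !ffunE (ip_lin hV).
- rewrite /ipF (big_morph _ (@conjKD R k) (@conjK0 R k)).
  by apply: eq_bigr => i _; exact: (ip_conj hV).
- by rewrite /ipF reK_sum; apply: sumr_ge0 => i _; exact: (ip_ge0 hV).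
- rewrite /ipF reK_sum => /eqP; rewrite psumr_eq0 => [/allP h|i _]; last exact: (ip_ge0 hV).
  apply/ffunP => i; rewrite ffunE; apply: (ip_def hV); apply/eqP/h.
  by rewrite mem_index_enum.
have /choice[l hl] i : exists l, hcvg ip (fun m => u_ m i) l.
  apply: (ip_complete hV) => e /hC[N hN]; exists N => m m' hm hm'.
  by apply: le_lt_trans (hN _ _ hm hm'); have := hnrmF_ge (u_ m - u_ m') i; rewrite !ffunE.
by exists [ffun i => l i]; apply/hcvgF => i; rewrite ffunE.
Qed.

End finite_products.

Section L2_domain.
Variables (R : realType) (k : scalars) (Om : set (R3 R)) (oOm : open Om).

Lemma hilbert_ips : hilbert (@ips R k Om oOm).
Proof. exact: hilbertL. Qed.

Lemma hilbert_ip : hilbert (@ip R k Om oOm).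
Proof. exact: (@hilbertF _ _ 3 _ _ hilbert_ips). Qed.

Lemma closed_subspace_hclosed (V : set (L2v k oOm)) :
  closed_subspace V <-> hclosed (@ip R k Om oOm) V.
Proof.
split=> -[V0 Vlin Vcl]; split => //.
  move=> u_ l hu /hcvgP h; apply: Vcl => e /h[N hN].
  by exists (u_ N) => //; rewrite /nrm -/(hnrm _ _) (nmB hilbert_ip) hN.
move=> x hx; have /choice[v_ hv] n : exists v, V v /\ nrm (x - v) < harmonic n.
  by have [v Vv hv] := hx (harmonic n) (harmonic_gt0 _); exists v.
apply: (Vcl v_) => [n|]; first by case: (hv n).
apply: squeeze0 (@cvg_harmonic R) => n; rewrite sqrtr_ge0 /=.
by rewrite (nmB hilbert_ip) ltW//; case: (hv n).
Qed.

End L2_domain.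

(** * Volume and integrals on R^3 *)

(* The product measure with its structure of sigma-finite measure, which is not
   inferred on [m1 \x m2]. *)
Section sigma_finite_product.
Local Open Scope ereal_scope.
Context d1 d2 (T1 : measurableType d1) (T2 : measurableType d2) (R : realType).
Variables (m1 : {sigma_finite_measure set T1 -> \bar R})
  (m2 : {sigma_finite_measure set T2 -> \bar R}).

Definition sfprod : set (T1 * T2) -> \bar R := (m1 \x m2).

HB.instance Definition _ := Measure.on sfprod.

Let sfprod_sigma_finite : sigma_finite setT sfprod.
Proof.
have /sigma_finiteP[F [TF ndF Foo]] := sigma_finiteT m1.
have /sigma_finiteP[G [TG ndG Goo]] := sigma_finiteT m2.
exists (fun n => F n `*` G n).
  apply/seteqP; split => [[x y] _|//].
  have [n _ Fx] : (\bigcup_n F n) x by rewrite -TF.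
  have [m _ Gy] : (\bigcup_n G n) y by rewrite -TG.
  exists (maxn n m) => //; split => /=.
    by move: Fx; apply/subsetPset/ndF; exact: leq_maxl.
  by move: Gy; apply/subsetPset/ndG; exact: leq_maxr.
move=> n; have [mF Fn] := Foo n; have [mG Gn] := Goo n.
split; first exact: measurableX.
by rewrite /sfprod product_measure1E// lte_mul_pinfty// ge0_fin_numE.
Qed.

HB.instance Definition _ :=
  Measure_isSigmaFinite.Build _ _ _ sfprod sfprod_sigma_finite.

End sigma_finite_product.

(** The push-forward agrees with the product measure on rectangles, and rectangles determine it. *)
Lemma product_measure_invariant d1 d2 (T1 : measurableType d1) (T2 : measurableType d2)
    (R : realType) (m1 : {sigma_finite_measure set T1 -> \bar R})
    (m2 : {sigma_finite_measure set T2 -> \bar R}) (f1 : T1 -> T1) (f2 : T2 -> T2)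
    (mf1 : measurable_fun setT f1) (mf2 : measurable_fun setT f2) :
  (forall A, measurable A -> m1 (f1 @^-1` A) = m1 A) ->
  (forall A, measurable A -> m2 (f2 @^-1` A) = m2 A) ->
  forall A, measurable A ->
    (m1 \x m2)%E ((fun x => (f1 x.1, f2 x.2)) @^-1` A) = (m1 \x m2)%E A.
Proof.
move=> h1 h2 A mA.
have mf : measurable_fun setT (fun x : T1 * T2 => (f1 x.1, f2 x.2)).
  apply: measurable_fun_pair.
    exact: (measurableT_comp mf1 measurable_fst).
  exact: (measurableT_comp mf2 measurable_snd).
have hu := @product_measure_unique _ _ _ _ _ m1 m2
  (measure_function_pushforward__canonical__measure_function_Measure (m1 \x m2)%E mf).
apply/esym/hu => // B C mB mC.
rewrite /= /pushforward -(h1 B mB) -(h2 C mC) -product_measure1E//.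
  by rewrite -[X in measurable X]setTI; exact: mf1.
by rewrite -[X in measurable X]setTI; exact: mf2.
Qed.

Section volume.
Variable R : realType.
Local Notation leb := (@lebesgue_measure R).
Local Notation vol := (@vol3 R).
Local Notation T1 := (measurableTypeR R).

Definition shift1 (a x : T1) : T1 := x + a.
Definition shift3 (a x : R3 R) : R3 R := x + a.

Lemma measurable_shift1 (a : R) : measurable_fun setT (shift1 a).
Proof. by apply: measurable_funD => //; exact: measurable_cst. Qed.

Lemma lebesgue_shift (a : R) (A : set T1) : measurable A -> leb (shift1 a @^-1` A) = leb A.
Proof.
move=> mA; have ms := measurable_shift1 a.
have hu := @lebesgue_measure_unique _
  (measure_function_pushforward__canonical__measure_function_Measure leb ms).
apply/esym/hu => // _ [[x y]] _ <-; rewrite /= /pushforward.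
rewrite (_ : _ @^-1` _ = `]x - a, y - a]%classic); last first.
  by apply/seteqP; split => z /=; rewrite !in_itv/= ltrBlDr lerBrDr.
rewrite !lebesgue_measure_itv/= !lte_fin ltrBlDr subrK.
by case: ifP => // _; rewrite -!EFinB opprB addrA addrNK.
Qed.

Lemma vol3E (A : set (R3 R)) : vol A = (leb \x leb \x leb)%E A.
Proof. by []. Qed.

Lemma vol3_shift (a : R3 R) (A : set (R3 R)) : measurable A ->
  vol (shift3 a @^-1` A) = vol A.
Proof.
move=> mA.
have m2 : measurable_fun setT (fun x : T1 * T1 => (shift1 a.1.1 x.1, shift1 a.1.2 x.2)).
  apply: measurable_fun_pair.
    exact: (measurableT_comp (measurable_shift1 _) measurable_fst).
  exact: (measurableT_comp (measurable_shift1 _) measurable_snd).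
have h1 b := @lebesgue_shift b.
have h2 := @product_measure_invariant _ _ _ _ R leb leb _ _
  (measurable_shift1 a.1.1) (measurable_shift1 a.1.2) (h1 _) (h1 _).
have -> : shift3 a = (fun x => ((shift1 a.1.1 x.1.1, shift1 a.1.2 x.1.2), shift1 a.2 x.2)).
  by apply/funext => -[[x y] z].
rewrite !vol3E; have := @product_measure_invariant _ _ (T1 * T1)%type T1 R (sfprod leb leb) leb _ _
  m2 (measurable_shift1 a.2) h2 (h1 _) A mA.
exact.
Qed.

Lemma measurable_shift3 (a : R3 R) : measurable_fun setT (shift3 a).
Proof.
apply: measurable_fun_pair; last first.
  exact: (measurableT_comp (measurable_shift1 a.2) measurable_snd).
apply: measurable_fun_pair.
  apply: (measurableT_comp (measurable_shift1 a.1.1)).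
  exact: (measurableT_comp measurable_fst measurable_fst).
apply: (measurableT_comp (measurable_shift1 a.1.2)).
exact: (measurableT_comp measurable_snd measurable_fst).
Qed.

Lemma ge0_integral_shift (a : R3 R) (f : R3 R -> \bar R) : measurable_fun setT f ->
  (forall x, 0 <= f x)%E -> (\int[vol]_x f (shift3 a x) = \int[vol]_x f x)%E.
Proof.
move=> mf f0; have ms := measurable_shift3 a.
transitivity (\int[pushforward vol (shift3 a)]_x f x)%E.
  by rewrite ge0_integral_pushforward.
by apply: eq_measure_integral => A mA _; exact: vol3_shift.
Qed.

Definition cube (r : R) : set (R3 R) :=
  [set` `[(- r)%R, r]] `*` [set` `[(- r)%R, r]] `*` [set` `[(- r)%R, r]].

Lemma cubeE r x : cube r x <-> [/\ `|x.1.1| <= r, `|x.1.2| <= r & `|x.2| <= r].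
Proof.
rewrite /cube /=; case: x => [[x y] z] /=; rewrite !in_itv/= !ler_norml.
by split=> [[[]]|[]].
Qed.

Lemma measurable_cube r : measurable (cube r).
Proof. by apply: measurableX; [apply: measurableX|]; exact: measurable_itv. Qed.

Lemma vol_cube r : 0 <= r -> vol (cube r) = ((2 * r) ^+ 3)%:E.
Proof.
move=> r0; set I := [set` `[(- r)%R, r]] : set T1.
have mI : measurable I by exact: measurable_itv.
have h : leb I = (2 * r)%:E.
  rewrite lebesgue_measure_itv/= lte_fin; case: ltP => h.
    by rewrite -EFinB; congr EFin; ring.
  by congr EFin; move: r0 h; lra.
have h2 := @product_measure1E _ _ T1 T1 R leb leb I I mI mI.
have h3 := @product_measure1E _ _ (T1 * T1)%type T1 R (sfprod leb leb) leb
  (I `*` I) I (measurableX mI mI) mI.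
transitivity ((leb I * leb I) * leb I)%E; last first.
  by rewrite h -!EFinM; congr EFin; ring.
by apply: (etrans h3); congr (_ * _)%E; exact: h2.
Qed.

Lemma continuous_measurable3 (f : R3 R -> R) : continuous f -> measurable_fun setT f.
Proof.
move=> /continuousP cf; apply: (measurability _ (RGenOpens.measurableE R)).
move=> _ [_ [a [b ->] <-]]; rewrite setTI; apply: open_measurable3.
exact/cf/interval_open.
Qed.

(** A class closed under sums, products and translations on which all integrals are finite, so that
    integrability is not rechecked for every integrand. *)
Definition BM (f : R3 R -> R) := [/\ measurable_fun setT f,
  exists M, forall x, `|f x| <= M & exists r, forall x, ~ cube r x -> f x = 0].

Definition I3 (f : R3 R -> R) : R := \int[vol]_x f x.

Lemma cube_mono r s : r <= s -> cube r `<=` cube s.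
Proof.
by move=> rs x /cubeE[h1 h2 h3]; apply/cubeE; split; exact: le_trans rs.
Qed.

Lemma BM_integrable f : BM f -> vol.-integrable setT (EFin \o f).
Proof.
move=> [mf [M hM] [r hr]].
have mc := measurable_cube `|r|.
have : vol.-integrable (cube `|r|) (EFin \o f).
  apply: measurable_bounded_integrable => //.
  - by rewrite vol_cube// ltry.
  - exact: measurable_funS mf.
  - exists M; split; first exact: num_real.
    by move=> x hx y _ /=; rewrite (le_trans (hM y))// ltW.
move=> /(integrable_mkcond _ mc); apply: eq_integrable => // x _.
rewrite /patch; case: ifPn => // /negP hx; rewrite /= hr//.
by move=> /(cube_mono (ler_norm r)) h; apply: hx; rewrite inE.
Qed.

Lemma BM_cst0 : BM (fun=> 0).
Proof. by split; [exact: measurable_cst|exists 0 => x; rewrite normr0|exists 0]. Qed.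

Lemma BMD f g : BM f -> BM g -> BM (fun x => f x + g x).
Proof.
move=> [mf [M hM] [r hr]] [mg [M' hM'] [r' hr']]; split.
- exact: measurable_funD.
- by exists (M + M') => x; rewrite (le_trans (ler_normD _ _))// lerD.
exists (Num.max r r') => x hx; rewrite hr ?hr' ?addr0// => h; apply: hx.
  by apply: cube_mono h; rewrite le_max lexx orbT.
by apply: cube_mono h; rewrite le_max lexx.
Qed.

Lemma BMMl (f g : R3 R -> R) : measurable_fun setT f -> (exists M : R, forall x, `|f x| <= M) ->
  BM g -> BM (fun x => f x * g x).
Proof.
move=> mf [M hM] [mg [M' hM'] [r' hr']]; split.
- exact: measurable_funM.
- exists (M * M') => x; rewrite normrM ler_pM//.
by exists r' => x hx; rewrite hr' ?mulr0.
Qed.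

Lemma BMM f g : BM f -> BM g -> BM (fun x => f x * g x).
Proof. by move=> [mf bf _]; exact: BMMl. Qed.

Lemma BMZ c f : BM f -> BM (fun x => c * f x).
Proof. by apply: BMMl; [exact: measurable_cst|exists `|c|]. Qed.

Lemma BMN f : BM f -> BM (fun x => - f x).
Proof. by move=> /(BMZ (-1)); under eq_fun do rewrite mulN1r. Qed.

Lemma BMB f g : BM f -> BM g -> BM (fun x => f x - g x).
Proof. by move=> hf hg; apply: BMD => //; exact: BMN. Qed.

Lemma BMX2 f : BM f -> BM (fun x => f x ^+ 2).
Proof. by move=> h; under eq_fun do rewrite expr2; exact: BMM. Qed.

Lemma BM_shift a f : BM f -> BM (fun x => f (x + a)).
Proof.
move=> [mf [M hM] [r hr]]; split.
- exact: (measurableT_comp mf (measurable_shift3 a)).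
- by exists M.
exists (r + (`|a.1.1| + `|a.1.2| + `|a.2|)) => x hx; apply: hr => /cubeE[h1 h2 h3].
apply: hx; apply/cubeE; split.
- rewrite -(addrK a.1.1 x.1.1) (le_trans (ler_normB _ _))// lerD//.
  by rewrite -addrA lerDl addr_ge0.
- rewrite -(addrK a.1.2 x.1.2) (le_trans (ler_normB _ _))// lerD//.
  by rewrite addrAC lerDr addr_ge0.
- rewrite -(addrK a.2 x.2) (le_trans (ler_normB _ _))// lerD//.
  by rewrite lerDr addr_ge0.
Qed.

Lemma BM_sum (J : Type) (r : seq J) (F : J -> R3 R -> R) : (forall j, BM (F j)) ->
  BM (fun x => \sum_(j <- r) F j x).
Proof.
move=> h; elim: r => [|j r IH]; first by under eq_fun do rewrite big_nil; exact: BM_cst0.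
by under eq_fun do rewrite big_cons; exact: BMD.
Qed.

Lemma I3D f g : BM f -> BM g -> I3 (fun x => f x + g x) = I3 f + I3 g.
Proof. by move=> /BM_integrable hf /BM_integrable hg; rewrite /I3 RintegralD. Qed.

Lemma I3Z c f : BM f -> I3 (fun x => c * f x) = c * I3 f.
Proof. by move=> /BM_integrable hf; rewrite /I3 RintegralZl. Qed.

Lemma I3N f : BM f -> I3 (fun x => - f x) = - I3 f.
Proof. by move=> h; rewrite -mulN1r -I3Z//; congr I3; apply/funext => x; rewrite mulN1r. Qed.

Lemma I3B f g : BM f -> BM g -> I3 (fun x => f x - g x) = I3 f - I3 g.
Proof. by move=> hf hg; rewrite I3D ?I3N//; exact: BMN. Qed.

Lemma I30 : I3 (fun=> 0) = 0.
Proof. by rewrite /I3 /Rintegral integral0. Qed.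

Lemma I3_sum (J : Type) (r : seq J) (F : J -> R3 R -> R) : (forall j, BM (F j)) ->
  I3 (fun x => \sum_(j <- r) F j x) = \sum_(j <- r) I3 (F j).
Proof.
move=> h; elim: r => [|j r IH].
  by rewrite big_nil -[RHS]I30; congr I3; apply/funext => x; rewrite big_nil.
rewrite big_cons -IH -I3D//; last exact: BM_sum.
by congr I3; apply/funext => x; rewrite big_cons.
Qed.

Lemma le_I3 f g : BM f -> BM g -> (forall x, f x <= g x) -> I3 f <= I3 g.
Proof.
by move=> /BM_integrable hf /BM_integrable hg h; apply: le_Rintegral.
Qed.

Lemma I3_ge0 f : (forall x, 0 <= f x) -> 0 <= I3 f.
Proof. by move=> h; apply: Rintegral_ge0 => x _. Qed.

Lemma EFin_I3 f : BM f -> (I3 f)%:E = (\int[vol]_x (f x)%:E)%E.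
Proof. by move=> /BM_integrable h; rewrite fineK//; exact: integrable_fin_num. Qed.

Lemma I3_shift a f : BM f -> I3 (fun x => f (x + a)) = I3 f.
Proof.
move=> hf; have [mf bf rf] := hf.
pose fp x := Num.max (f x) 0; pose fm x := Num.max (- f x) 0.
have hmax h : BM h -> BM (fun x => Num.max (h x) 0).
  move=> [mh [M hM] [r hr]]; split.
  - by apply: measurable_maxr => //; exact: measurable_cst.
  - exists M => x; rewrite (le_trans _ (hM x))//.
    by rewrite ger0_norm ?le_max ?lexx ?orbT// ge_max ler_norm normr_ge0.
  - by exists r => x /hr ->; rewrite maxxx.
have hp : BM fp by exact: hmax.
have hm : BM fm by apply: hmax; exact: BMN.
have fE x : f x = fp x - fm x.
  rewrite /fp /fm; have [h|h] := leP (f x) 0.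
    by rewrite max_l ?oppr_ge0// sub0r opprK.
  by rewrite max_r ?subr0// oppr_le0 ltW.
have ge0 h : BM h -> (forall x, 0 <= h x) -> I3 (fun x => h (x + a)) = I3 h.
  move=> hh h0; rewrite /I3 /Rintegral; congr fine.
  apply: (@ge0_integral_shift a (EFin \o h)) => [|x]; last by rewrite lee_fin.
  by apply/measurable_EFinP; case: hh.
have -> : I3 f = I3 fp - I3 fm.
  by rewrite -I3B//; congr I3; apply/funext => x.
have -> : I3 (fun x => f (x + a)) = I3 (fun x => fp (x + a)) - I3 (fun x => fm (x + a)).
  rewrite -I3B; [|exact: BM_shift|exact: BM_shift].
  by congr I3; apply/funext => x.
by rewrite !ge0// => x; rewrite le_max lexx orbT.
Qed.

Lemma le_I3_cube f M r : BM f -> 0 <= r -> (forall x, `|f x| <= M) ->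
  (forall x, ~ cube r x -> f x = 0) -> `|I3 f| <= M * (2 * r) ^+ 3.
Proof.
move=> hf r0 hM hr; have M0 : 0 <= M := le_trans (normr_ge0 _) (hM 0).
have ib := BM_integrable hf; have mf : measurable_fun setT f by case: hf.
rewrite (le_trans (le_normr_Rintegral _ ib))//.
rewrite /Rintegral -lee_fin fineK; last first.
  by apply: integrable_fin_num => //; exact: integrable_norm.
rewrite (_ : (\int[vol]_x _ = \int[vol]_(x in cube r) `|(f x)%:E|)%E); last first.
  rewrite [RHS]integral_mkcond; apply: eq_integral => x _; rewrite /patch.
  by case: ifPn => // /negP hx; rewrite hr ?normr0// => h; apply: hx; rewrite inE.
have mc := measurable_cube r.
apply: (le_trans (integral_le_bound M%:E mc _ _ _)).
- by apply/measurable_EFinP; exact: measurable_funS mf.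
- by rewrite lee_fin.
- by apply: aeW => x _; rewrite lee_fin.
by rewrite [X in (_ * X)%E]vol_cube.
Qed.

End volume.

(** * Rellich's inequality *)

Section rellich.
Variable R : realType.
Local Notation leb := (@lebesgue_measure R).
Local Notation vol := (@vol3 R).
Local Notation T1 := (measurableTypeR R).
Local Notation sfvol := (sfprod (sfprod leb leb) leb).

Lemma tonelli33 (F : R3 R * R3 R -> \bar R) : measurable_fun setT F ->
  (forall p, 0 <= F p)%E ->
  (\int[vol]_x \int[vol]_h F (x, h) = \int[vol]_h \int[vol]_x F (x, h))%E.
Proof. by move=> mF F0; exact: (@fubini_tonelli _ _ _ _ _ sfvol sfvol F mF F0). Qed.

Lemma measurable_tonelli33 (F : R3 R * R3 R -> \bar R) : measurable_fun setT F ->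
  (forall p, 0 <= F p)%E -> measurable_fun setT (fun x => \int[vol]_h F (x, h))%E.
Proof.
move=> mF F0; have h := @measurable_fun_fubini_tonelli_F _ _ _ _ _ sfvol F mF F0.
exact h.
Qed.

Lemma measurable_tonelli33' (F : R3 R * R3 R -> \bar R) : measurable_fun setT F ->
  (forall p, 0 <= F p)%E -> measurable_fun setT (fun h => \int[vol]_x F (x, h))%E.
Proof.
move=> mF F0; have h := @measurable_fun_fubini_tonelli_G _ _ _ _ _ sfvol F mF F0.
exact h.
Qed.

Lemma measurable_add33 : measurable_fun setT (fun p : R3 R * R3 R => (p.2 + p.1 : R3 R)).
Proof.
have m11 : measurable_fun setT (fun x : R3 R => x.1.1 : T1) by exact: (measurableT_comp
  measurable_fst measurable_fst).
have m12 : measurable_fun setT (fun x : R3 R => x.1.2 : T1) by exact: (measurableT_comp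
  measurable_snd measurable_fst).
have m2 : measurable_fun setT (fun x : R3 R => x.2 : T1) by exact: measurable_snd.
have mf : measurable_fun setT (fun p : R3 R * R3 R => p.1) by exact: measurable_fst.
have ms : measurable_fun setT (fun p : R3 R * R3 R => p.2) by exact: measurable_snd.
apply: measurable_fun_pair; last first.
  by apply: measurable_funD; [exact: (measurableT_comp m2 ms)|exact: (measurableT_comp m2 mf)].
apply: measurable_fun_pair.
  by apply: measurable_funD; [exact: (measurableT_comp m11 ms)|exact: (measurableT_comp m11 mf)].
by apply: measurable_funD; [exact: (measurableT_comp m12 ms)|exact: (measurableT_comp m12 mf)].
Qed.

Definition box3 (u v : R3 R) : set (R3 R) :=
  `[u.1.1, v.1.1[ `*` `[u.1.2, v.1.2[ `*` `[u.2, v.2[.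

Lemma measurable_box3 u v : measurable (box3 u v).
Proof. by apply: measurableX; [apply: measurableX|]; exact: measurable_itv. Qed.

Lemma BM_indic (A : set (R3 R)) r : measurable A -> A `<=` cube r -> BM (\1_A : R3 R -> R).
Proof.
move=> mA Ar; split.
- exact: measurable_indic.
- by exists 1 => x; rewrite indicE; case: (x \in A); rewrite ?normr1 ?normr0.
- by exists r => x hx; rewrite indicE memNset// => /Ar.
Qed.

Lemma BM_cube r : BM (\1_(cube r) : R3 R -> R).
Proof. exact: BM_indic (measurable_cube r) (@subset_refl _ _). Qed.

Lemma box3_cube u v : exists r, box3 u v `<=` cube r.
Proof.
exists (`|u.1.1| + `|v.1.1| + (`|u.1.2| + `|v.1.2|) + (`|u.2| + `|v.2|)).
have h (x y z : R) : y <= x < z -> `|x| <= `|y| + `|z|.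
  move=> /andP[h1 h2]; rewrite ler_norml; apply/andP; split.
    have := ler_norm (- y); rewrite normrN; have := normr_ge0 z; lra.
  have := ler_norm z; have := normr_ge0 y; lra.
move=> [[x y] z] [[/=]]; rewrite !in_itv/= => /h h1 /h h2 /h h3.
have := normr_ge0 u.1.1; have := normr_ge0 v.1.1; have := normr_ge0 u.1.2.
have := normr_ge0 v.1.2; have := normr_ge0 u.2; have := normr_ge0 v.2.
by move=> *; apply/cubeE; split => /=; lra.
Qed.

Lemma BM_box3 u v : BM (\1_(box3 u v) : R3 R -> R).
Proof. by have [r h] := box3_cube u v; exact: BM_indic (measurable_box3 u v) h. Qed.

Lemma I3_indic (A : set (R3 R)) : measurable A -> I3 \1_A = fine (vol A).
Proof. by move=> mA; rewrite /I3 /Rintegral (integral_indic vol measurableT mA) setIT. Qed.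

Lemma I3_box3 u v : u.1.1 <= v.1.1 -> u.1.2 <= v.1.2 -> u.2 <= v.2 ->
  I3 \1_(box3 u v) = (v.1.1 - u.1.1) * (v.1.2 - u.1.2) * (v.2 - u.2).
Proof.
move=> h1 h2 h3; rewrite I3_indic; last exact: measurable_box3.
have hI (x y : R) : x <= y -> leb (`[x, y[%classic : set T1) = (y - x)%:E.
  move=> xy; rewrite lebesgue_measure_itv/= lte_fin; case: ltP => h.
    by rewrite -EFinB.
  by congr EFin; apply/esym/eqP; rewrite subr_eq0 eq_le h.
have mI (x y : R) : measurable (`[x, y[%classic : set T1) by exact: measurable_itv.
have e2 := @product_measure1E _ _ T1 T1 R leb leb _ _ (mI u.1.1 v.1.1) (mI u.1.2 v.1.2).
have e3 := @product_measure1E _ _ (T1 * T1)%type T1 R (sfprod leb leb) leb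
  _ _ (measurableX (mI u.1.1 v.1.1) (mI u.1.2 v.1.2)) (mI u.2 v.2).
suff -> : vol (box3 u v) = ((v.1.1 - u.1.1) * (v.1.2 - u.1.2) * (v.2 - u.2))%:E by [].
rewrite 2!EFinM; apply: (etrans e3); congr (_ * _)%E; last exact: hI.
by apply: (etrans e2); congr (_ * _)%E; exact: hI.
Qed.

Lemma I3_cube (r : R) : 0 <= r -> I3 (\1_(cube r) : R3 R -> R) = (2 * r) ^+ 3.
Proof. by move=> r0; rewrite I3_indic ?vol_cube//; exact: measurable_cube. Qed.

(** As a difference of two step functions the indicator telescopes when summed over consecutive
    knots. *)
Lemma indic_itvE (x u v : R) : u <= v ->
  \1_(`[u, v[%classic) x = (u <= x)%R%:R - (v <= x)%R%:R :> R.
Proof.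
move=> uv; rewrite indicE (_ : (x \in `[u, v[%classic) = (u <= x < v)); last first.
  by apply/idP/idP; rewrite inE /= in_itv.
have [h1|h1] := leP u x; have [h2|h2] := leP v x; rewrite ?subrr ?subr0//=.
by move: (le_lt_trans uv (le_lt_trans h2 h1)); rewrite ltxx.
Qed.

(** * The cube of half-width [a] cut into [N ^ 3] half-open cells *)

Section cells.
Variables (a : R) (N : nat).
Hypotheses (a0 : 0 < a) (N0 : (0 < N)%N).
Definition mesh : R := (2 * a) / N%:R.
Definition knot (i : nat) : R := - a + i%:R * mesh.
Definition cell (t : 'I_N * 'I_N * 'I_N) : set (R3 R) :=
  box3 (knot t.1.1, knot t.1.2, knot t.2) (knot t.1.1.+1, knot t.1.2.+1, knot t.2.+1).

Lemma mesh_gt0 : 0 < mesh.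
Proof. by rewrite divr_gt0 ?mulr_gt0 ?ltr0n. Qed.

Lemma knotS i : knot i.+1 - knot i = mesh.
Proof. by rewrite /knot -natr1; ring. Qed.

Lemma knot_le i : knot i <= knot i.+1.
Proof. by rewrite -subr_ge0 knotS ltW// mesh_gt0. Qed.

Lemma I3_cell t : I3 \1_(cell t) = mesh ^+ 3.
Proof. by rewrite I3_box3 ?knot_le//= !knotS; ring. Qed.

Lemma indic_cell t x : \1_(cell t) x =
  \1_(`[knot t.1.1, knot t.1.1.+1[%classic) x.1.1 *
  \1_(`[knot t.1.2, knot t.1.2.+1[%classic) x.1.2 *
  \1_(`[knot t.2, knot t.2.+1[%classic) x.2 :> R.
Proof. by rewrite /cell /box3 !indicE !in_setX -!natrM !mulnb. Qed.

Lemma sum_knots x : \sum_(i < N) \1_(`[knot i, knot i.+1[%classic) x =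
  (- a <= x)%R%:R - (a <= x)%R%:R :> R.
Proof.
under eq_bigr => i _ do rewrite indic_itvE ?knot_le// -opprB.
rewrite sumrN -(big_mkord xpredT (fun i => (knot i.+1 <= x)%R%:R - (knot i <= x)%R%:R)).
rewrite (telescope_sumr (fun i => (knot i <= x)%R%:R))// opprB.
rewrite (_ : knot 0 = - a); last by rewrite /knot mul0r addr0.
rewrite (_ : knot N = a)//.
by rewrite /knot /mesh mulrCA divff ?pnatr_eq0 -?lt0n//; lra.
Qed.

Lemma sum_cells x : \sum_t \1_(cell t) x =
  ((- a <= x.1.1)%R%:R - (a <= x.1.1)%R%:R) * ((- a <= x.1.2)%R%:R - (a <= x.1.2)%R%:R) *
  ((- a <= x.2)%R%:R - (a <= x.2)%R%:R) :> R.
Proof.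
rewrite -!sum_knots [X in _ = X * _]big_distrlr /= pair_big/=.
rewrite big_distrlr /= pair_big/=.
by apply: eq_bigr => t _; rewrite indic_cell.
Qed.

Lemma sum_cells1 x : `|x.1.1| < a -> `|x.1.2| < a -> `|x.2| < a ->
  \sum_t \1_(cell t) x = 1 :> R.
Proof.
have h (z : R) : `|z| < a -> (- a <= z)%R%:R - (a <= z)%R%:R = 1 :> R.
  by rewrite ltr_norml => /andP[/ltW -> h]; rewrite leNgt h subr0.
by move=> h1 h2 h3; rewrite sum_cells !h// !mulr1.
Qed.

Lemma sum_cells_le x : \sum_t \1_(cell t) x <= \1_(cube a) x :> R.
Proof.
have h (z : R) : (0 <= (- a <= z)%R%:R - (a <= z)%R%:R :> R) &&
    ((- a <= z)%R%:R - (a <= z)%R%:R <= (`|z| <= a)%R%:R :> R).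
  rewrite ler_norml; have [h1|h1] := leP (- a) z; have [h2|h2] := leP a z => /=.
  - by rewrite subrr lexx ler0n.
  - by rewrite subr0 (ltW h2) ler01 lexx.
  - by move: a0 h1 h2; lra.
  - by rewrite subrr lexx.
rewrite sum_cells.
rewrite (_ : \1_(cube a) x = (`|x.1.1| <= a)%R%:R * (`|x.1.2| <= a)%R%:R * (`|x.2| <= a)%R%:R);
  last first.
  rewrite indicE -!natrM !mulnb; congr (_%:R); congr nat_of_bool.
  apply/idP/idP; first by rewrite inE => /cubeE[-> -> ->].
  by move=> /andP[/andP[? ?] ?]; rewrite inE; apply/cubeE.
have /andP[p1 q1] := h x.1.1; have /andP[p2 q2] := h x.1.2; have /andP[p3 q3] := h x.2.
by rewrite !ler_pM// mulr_ge0.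
Qed.

Lemma cell_diff t x h : cell t x -> cell t (h + x) -> cube mesh h.
Proof.
have k (u v w z : R) : u <= z < v -> u <= w + z < v -> v - u = mesh -> `|w| <= mesh.
  by move=> /andP[h1 h2] /andP[h3 h4] h5; rewrite ler_norml; apply/andP; split; lra.
move=> [[/= c1 c2] c3] [[/= d1 d2] d3]; rewrite !in_itv/= in c1 c2 c3 d1 d2 d3.
by apply/cubeE; split; [apply: k c1 d1 _|apply: k c2 d2 _|apply: k c3 d3 _]; rewrite knotS.
Qed.

Lemma BM_sqr_diff (c f : R3 R -> R) v : BM c -> BM f ->
  BM (fun y => c y * (v - f y) ^+ 2).
Proof.
move=> hc hf; rewrite (_ : (fun _ => _) = (fun y => v ^+ 2 * c y - 2 * v * (c y * f y) +
  c y * f y ^+ 2)).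
  apply: BMD; last by apply: BMM => //; exact: BMX2.
  by apply: BMB; [exact: BMZ|apply: BMZ; exact: BMM].
by apply/funext => y; ring.
Qed.

Lemma BM_cell t : BM (\1_(cell t) : R3 R -> R).
Proof. exact: BM_box3. Qed.

Lemma I3_cell_diff t f v : BM f ->
  I3 (fun y => \1_(cell t) y * (v - f y) ^+ 2) = v ^+ 2 * mesh ^+ 3 -
    2 * v * I3 (fun y => \1_(cell t) y * f y) + I3 (fun y => \1_(cell t) y * f y ^+ 2).
Proof.
move=> hf; have hc := BM_cell t.
have h1 : BM (fun x => \1_(cell t) x * f x) by exact: BMM.
have h2 : BM (fun x => \1_(cell t) x * f x ^+ 2) by apply: BMM => //; exact: BMX2.
rewrite -(I3_cell t) -I3Z// -I3Z// -I3B; [|exact: BMZ|exact: BMZ].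
rewrite -I3D//; last by apply: BMB; exact: BMZ.
by congr I3; apply/funext => y; ring.
Qed.

Lemma BM_cell_diff t f : BM f ->
  BM (fun x => \1_(cell t) x * I3 (fun y => \1_(cell t) y * (f x - f y) ^+ 2)).
Proof.
move=> hf; have hc := BM_cell t.
set J := I3 (fun x => \1_(cell t) x * f x ^+ 2); set I := I3 (fun x => \1_(cell t) x * f x).
rewrite (_ : (fun _ => _) = (fun x => mesh ^+ 3 * (\1_(cell t) x * f x ^+ 2) -
    (2 * I) * (\1_(cell t) x * f x) + J * \1_(cell t) x)).
  apply: BMD; last exact: BMZ.
  by apply: BMB; apply: BMZ; apply: BMM => //; exact: BMX2.
by apply/funext => x; rewrite I3_cell_diff// -/I -/J; ring.
Qed.

(** Expanding the square. It splits the mass of [f] on a cell into its mean and an oscillation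
    between pairs of points, and the latter can be estimated through translates of [f]. *)
Lemma cell_variance t f : BM f ->
  I3 (fun x => \1_(cell t) x * I3 (fun y => \1_(cell t) y * (f x - f y) ^+ 2)) =
  2 * mesh ^+ 3 * I3 (fun x => \1_(cell t) x * f x ^+ 2) -
  2 * I3 (fun x => \1_(cell t) x * f x) ^+ 2.
Proof.
move=> hf; have hc := BM_cell t.
set J := I3 (fun x => _ * f x ^+ 2); set I := I3 (fun x => _ * f x).
have h1 : BM (fun x => \1_(cell t) x * f x) by exact: BMM.
have h2 : BM (fun x => \1_(cell t) x * f x ^+ 2) by apply: BMM => //; exact: BMX2.
transitivity (I3 (fun x => mesh ^+ 3 * (\1_(cell t) x * f x ^+ 2) - (2 * I) * (\1_(cell t) x * f
  x) + J * \1_(cell t) x)).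
  by congr I3; apply/funext => x; rewrite I3_cell_diff// -/I -/J; ring.
rewrite I3D; [|by apply: BMB; exact: BMZ|exact: BMZ].
rewrite I3B; [|exact: BMZ|exact: BMZ].
by rewrite !I3Z// I3_cell -/I -/J; ring.
Qed.

(** Two points of one cell differ by a vector of [cube mesh]. Tonelli in the variables [x] and
    [h = y - x] therefore bounds all pair oscillations by [D] times the volume [8 mesh^3] of that
    cube; dividing by the factor [2 mesh^3] of [cell_variance] leaves [4 D]. *)
Lemma rellich_cells f D : BM f -> (forall x, f x != 0 -> [/\ `|x.1.1| < a,
  `|x.1.2| < a & `|x.2| < a]) ->
  (forall h, cube mesh h -> I3 (fun x => (f x - f (h + x)) ^+ 2) <= D) ->
  I3 (fun x => f x ^+ 2) <= 4 * D + (mesh ^+ 3)^-1 * \sum_t I3 (fun x => \1_(cell t) x * f x) ^+ 2.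
Proof.
move=> hf fa hD.
pose m3 := mesh ^+ 3; have m30 : 0 < m3 by rewrite exprn_gt0// mesh_gt0.
have hc t : BM (\1_(cell t) : R3 R -> R) by exact: BM_box3.
pose F (p : R3 R * R3 R) : R := \1_(cube a) p.1 * (\1_(cube mesh) p.2 * (f p.1 - f (p.2 +
  p.1)) ^+ 2).
have F0 p : 0 <= F p.
  by rewrite /F; apply: mulr_ge0; [rewrite indicE|apply: mulr_ge0; [rewrite indicE|exact: sqr_ge0]].
have mF : measurable_fun setT F.
  have [mf _ _] := hf; apply: measurable_funM.
    exact: (measurableT_comp (measurable_indic (measurable_cube a)) measurable_fst).
  apply: measurable_funM.
    exact: (measurableT_comp (measurable_indic (measurable_cube mesh)) measurable_snd).
  apply: measurable_funX; apply: measurable_funB.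
    exact: (measurableT_comp mf measurable_fst).
  exact: (measurableT_comp mf measurable_add33).
have mF' : measurable_fun setT (EFin \o F) by exact/measurable_EFinP.
have F0' p : (0 <= (EFin \o F) p)%E by rewrite lee_fin.
have main : \sum_t I3 (fun x => \1_(cell t) x * I3 (fun y =>
  \1_(cell t) y * (f x - f y) ^+ 2)) <= 8 * m3 * D.
  have hout t := BM_cell_diff t hf.
  have hx x : BM (fun h => \1_(cube mesh) h * (f x - f (h + x)) ^+ 2).
    by apply: (@BM_sqr_diff _ (fun h => f (h + x))); [exact: BM_cube|exact: BM_shift].
  rewrite -I3_sum// -lee_fin EFin_I3; last exact: BM_sum.
  apply: (@le_trans _ _ (\int[vol]_x \int[vol]_h (F (x, h))%:E)%E).
    apply: ge0_le_integral => //.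
    - move=> x _; rewrite lee_fin; apply: sumr_ge0 => t _; apply: mulr_ge0; first by rewrite indicE.
      by apply: I3_ge0 => y; rewrite mulr_ge0 ?sqr_ge0// indicE.
    - by apply/measurable_EFinP; case: (BM_sum (index_enum _) hout).
    - exact: (measurable_tonelli33 mF' F0').
    move=> x _; rewrite /F /= -EFin_I3; last exact: BMZ.
    rewrite lee_fin I3Z//; set W := I3 _.
    have W0 : 0 <= W by apply: I3_ge0 => h; rewrite mulr_ge0 ?sqr_ge0// indicE.
    apply: (@le_trans _ _ ((\sum_t \1_(cell t) x) * W)); last first.
      by rewrite ler_wpM2r// sum_cells_le.
    rewrite mulr_suml; apply: ler_sum => t _; rewrite indicE.
    have [xt|xt] := boolP (x \in cell t); last by rewrite !mul0r.
    rewrite !mul1r -(I3_shift x); last exact: BM_sqr_diff.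
    apply: le_I3 => //; first exact: (BM_shift x (BM_sqr_diff _ _ _)).
    move=> h; rewrite ler_wpM2r ?sqr_ge0// !indicE.
    case: (boolP (h + x \in cell t)) => [ht|//].
    by rewrite mem_set//; apply: cell_diff (set_mem xt) (set_mem ht).
  have hcD : BM (fun h => \1_(cube mesh) h * D).
    by under eq_fun do rewrite mulrC; apply: BMZ; exact: BM_cube.
  rewrite (tonelli33 mF' F0').
  apply: (@le_trans _ _ (\int[vol]_h (\1_(cube mesh) h * D)%:E)%E).
    apply: ge0_le_integral => //.
    - by move=> h _; apply: integral_ge0 => x _; exact: F0'.
    - exact: (measurable_tonelli33' mF' F0').
    - by apply/measurable_EFinP; case: hcD.
    move=> h _; rewrite /F /= indicE; have [hh|hh] := boolP (h \in cube mesh); last first.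
      rewrite !mul0r; under eq_integral do rewrite mul0r mulr0.
      by rewrite integral0.
    rewrite !mul1r; under eq_integral do rewrite mul1r.
    have hs : BM (fun x => (f x - f (h + x)) ^+ 2).
      apply: BMX2; apply: BMB => //.
      by under eq_fun do rewrite addrC; exact: BM_shift.
    rewrite -EFin_I3; last by apply: BMM => //; exact: BM_cube.
    rewrite lee_fin (le_trans _ (hD h (set_mem hh)))//; apply: le_I3 => //.
      by apply: BMM => //; exact: BM_cube.
    by move=> x; rewrite indicE; case: (_ \in _); rewrite ?mul1r ?mul0r// sqr_ge0.
  rewrite -EFin_I3// lee_fin; under [X in I3 X]funext => h do rewrite mulrC.
  rewrite I3Z; last exact: BM_cube.
  by rewrite I3_cube ?(ltW mesh_gt0)// /m3; lra.
have tot : I3 (fun x => f x ^+ 2) = \sum_t I3 (fun x => \1_(cell t) x * f x ^+ 2).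
  rewrite -I3_sum; last by move=> t; apply: BMM => //; exact: BMX2.
  congr I3; apply/funext => x; rewrite -mulr_suml.
  have [->|/fa[h1 h2 h3]] := eqVneq (f x) 0; first by rewrite expr0n mulr0.
  by rewrite sum_cells1// mul1r.
move: main; under eq_bigr do rewrite cell_variance//.
rewrite sumrB -!mulr_sumr -tot -/m3 => main.
rewrite -(ler_pM2l m30) mulrDr mulVKf ?gt_eqF//; move: main; lra.
Qed.

End cells.
End rellich.

(** * Test functions *)

Section calculus3.
Variable R : realType.
Local Notation P := (R3 R).
Local Notation u := (unitv R).
Implicit Types (f g : P -> R) (x a v : P).
Local Notation D i f := ('D_(u i) f).

Lemma diff_quot_shift f a x v :
  (fun h : R => h^-1 *: (((fun y => f (y + a)) \o shift x) (h *: v) - f (x + a))) =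
  (fun h : R => h^-1 *: ((f \o shift (x + a)) (h *: v) - f (x + a))).
Proof. by apply/funext => h /=; rewrite addrA. Qed.

Lemma derivable_shift f a x v :
  derivable (fun y => f (y + a)) x v = derivable f (x + a) v.
Proof. by rewrite /derivable diff_quot_shift. Qed.

Lemma derive_shift f a x v : 'D_v (fun y => f (y + a)) x = 'D_v f (x + a).
Proof. by rewrite /derive diff_quot_shift. Qed.

Lemma continuous_shift f a : continuous f -> continuous (fun y : P => f (y + a)).
Proof.
move=> cf x; apply: (continuous_comp (f := fun y : P => y + a)); last exact: cf.
by apply: cvgD; [exact: cvg_id|exact: cvg_cst].
Qed.

Lemma CkW m f : Ck m.+1 f -> Ck m f.
Proof.
elim: m f => [|m IH] f [cf hf]; first by [].
by split=> // i; have [h1 h2] := hf i; split => //; exact: IH.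
Qed.

Lemma Ck_cst m (c : R) : Ck m (fun=> c : R).
Proof.
elim: m c => [|m IH] c; first by split=> // x; exact: cvg_cst.
split=> [x|i]; first exact: cvg_cst.
split=> [x|]; first exact: derivable_cst.
by rewrite (_ : 'D_(u i) _ = fun=> 0)//; apply/funext => x; exact: derive_cst.
Qed.

Lemma CkD m f g : Ck m f -> Ck m g -> Ck m (fun x => f x + g x).
Proof.
elim: m f g => [|m IH] f g [cf hf] [cg hg].
  by split=> // x; apply: cvgD; [exact: cf|exact: cg].
split=> [x|i]; first by apply: cvgD; [exact: cf|exact: cg].
have [f1 f2] := hf i; have [g1 g2] := hg i; split=> [x|]; first exact: derivableD.
rewrite (_ : 'D_(u i) _ = fun x => D i f x + D i g x); first exact: IH.
by apply/funext => x; exact: deriveD.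
Qed.

Lemma CkM m f g : Ck m f -> Ck m g -> Ck m (fun x => f x * g x).
Proof.
elim: m f g => [|m IH] f g hf hg.
  by case: hf hg => cf _ [cg _]; split=> // x; apply: cvgM; [exact: cf|exact: cg].
have [cf hf'] := hf; have [cg hg'] := hg.
split=> [x|i]; first by apply: cvgM; [exact: cf|exact: cg].
have [f1 f2] := hf' i; have [g1 g2] := hg' i; split=> [x|]; first exact: derivableM.
rewrite (_ : 'D_(u i) _ = fun x => f x * D i g x + g x * D i f x).
  by apply: CkD; apply: IH => //; exact: CkW.
by apply/funext => x; exact: deriveM.
Qed.

Lemma Ck_shift m f a : Ck m f -> Ck m (fun x => f (x + a)).
Proof.
elim: m f => [|m IH] f [cf hf]; first by split=> //; exact: continuous_shift.
split=> [|i]; first exact: continuous_shift.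
have [f1 f2] := hf i; split=> [x|]; first by rewrite derivable_shift.
rewrite (_ : 'D_(u i) _ = fun x => D i f (x + a)); first exact: (IH (D i f)).
by apply/funext => x; rewrite derive_shift.
Qed.

Lemma smooth_cst (c : R) : smooth (fun=> c : R). Proof. by move=> m; exact: Ck_cst. Qed.
Lemma smoothD f g : smooth f -> smooth g -> smooth (fun x => f x + g x).
Proof. by move=> hf hg m; exact: CkD. Qed.
Lemma smoothM f g : smooth f -> smooth g -> smooth (fun x => f x * g x).
Proof. by move=> hf hg m; exact: CkM. Qed.
Lemma smoothZ (c : R) f : smooth f -> smooth (fun x => c * f x).
Proof. by move=> hf; apply: smoothM => //; exact: smooth_cst. Qed.
Lemma smoothN f : smooth f -> smooth (fun x => - f x).
Proof. by move=> /(smoothZ (-1)); under eq_fun do rewrite mulN1r. Qed.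
Lemma smoothB f g : smooth f -> smooth g -> smooth (fun x => f x - g x).
Proof. by move=> hf hg; apply: smoothD => //; exact: smoothN. Qed.
Lemma smooth_shift f a : smooth f -> smooth (fun x => f (x + a)).
Proof. by move=> hf m; exact: Ck_shift. Qed.
Lemma smooth_sum (J : Type) (r : seq J) (F : J -> P -> R) : (forall j, smooth (F j)) ->
  smooth (fun x => \sum_(j <- r) F j x).
Proof.
move=> h; elim: r => [|j r IH]; first by under eq_fun do rewrite big_nil; exact: smooth_cst.
by under eq_fun do rewrite big_cons; exact: smoothD.
Qed.
Lemma smooth_continuous f : smooth f -> continuous f. Proof. by move=> /(_ 0%N)[]. Qed.
Lemma smooth_derivable f i x : smooth f -> derivable f x (u i).
Proof. by move=> /(_ 1%N)[_ /(_ i)[]]. Qed.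
Lemma smooth_derive f i : smooth f -> smooth (D i f).
Proof. by move=> hf m; have [_ /(_ i)[]] := hf m.+1. Qed.

Lemma derive_fD f g i : smooth f -> smooth g ->
  D i (fun x => f x + g x) = fun x => D i f x + D i g x.
Proof. by move=> hf hg; apply/funext => x; apply: deriveD; exact: smooth_derivable. Qed.
Lemma derive_fM f g i : smooth f -> smooth g ->
  D i (fun x => f x * g x) = fun x => f x * D i g x + g x * D i f x.
Proof. by move=> hf hg; apply/funext => x; apply: deriveM; exact: smooth_derivable. Qed.
Lemma derive_fcst (c : R) i : D i (fun=> c : R) = fun=> 0.
Proof. by apply/funext => x; exact: derive_cst. Qed.
Lemma derive_fZ (c : R) f i : smooth f -> D i (fun x => c * f x) = fun x => c * D i f x.
Proof.
move=> hf; rewrite derive_fM//; last exact: smooth_cst.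
by apply/funext => x; rewrite (derive_cst c) mulr0 addr0.
Qed.
Lemma mvt_coord f i x (t : R) : (forall y, derivable f y (u i)) ->
  exists2 s : R, `|s| <= `|t| & f (t *: u i + x) - f x = t * D i f (s *: u i + x).
Proof.
move=> df; pose phi (s : R) := f (s *: u i + x).
have hphi (s : R) : is_derive s 1 phi (D i f (s *: u i + x)).
  have e : (fun h : R => h^-1 *: ((phi \o shift s) (h *: (1 : R)) - phi s)) =
     (fun h => h^-1 *: ((f \o shift (s *: u i + x)) (h *: u i) - f (s *: u i + x))).
    by apply/funext => h; rewrite /phi /= scalerDl [h *: (1 : R)]mulr1 addrA.
  constructor; first by rewrite /derivable e; exact: df.
  by rewrite /derive e.
have cphi (p q : R) : {within `[p, q], continuous phi}.
  by apply: derivable_within_continuous => s _; case: (hphi s).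
have [t0|t0] := leP 0 t.
  have [s] := MVT_segment t0 (fun s _ => hphi s) (cphi _ _).
  rewrite in_itv/= => /andP[s0 st]; rewrite subr0 /phi scale0r add0r mulrC => ->; exists s => //.
  by rewrite !ger0_norm.
have [s] := MVT_segment (ltW t0) (fun s _ => hphi s) (cphi _ _).
rewrite in_itv/= /phi => /andP[ts s0] /eqP; rewrite -eqr_opp opprB => /eqP e; exists s.
  by rewrite !ler0_norm ?lerN2// ltW.
by move: e; rewrite scale0r add0r => ->; ring.
Qed.

Definition norm1 (w : P) : R := `|w.1.1| + `|w.1.2| + `|w.2|.

Lemma norm1_ge0 w : 0 <= norm1 w. Proof. by rewrite !addr_ge0. Qed.
Lemma norm1Z (c : R) w : norm1 (c *: w) = `|c| * norm1 w.
Proof. by rewrite /norm1 /= !normrM !mulrDr. Qed.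
Lemma norm1N w : norm1 (- w) = norm1 w.
Proof. by rewrite /norm1 /= !normrN. Qed.
Lemma norm1D v w : norm1 (v + w) <= norm1 v + norm1 w.
Proof.
rewrite /norm1 /=; have := ler_normD v.1.1 w.1.1; have := ler_normD v.1.2 w.1.2.
have := ler_normD v.2 w.2; lra.
Qed.
Lemma norm1_unit (t : R) i : norm1 (t *: u i) = `|t|.
Proof.
rewrite norm1Z /norm1 /unitv /=; case: i => -[|[|[|//]]] /= _;
by rewrite !normr0 normr1 ?addr0 ?add0r mulr1.
Qed.

Lemma unitv_decomp w : w = w.2 *: u (1 + 1) + (w.1.2 *: u 1 + w.1.1 *: u 0).
Proof.
case: w => [[x y] z]; rewrite /unitv /=.
congr ((_, _), _) => /=; rewrite /GRing.scale/= ?mulr0 ?mulr1 ?add0r ?addr0//.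
Qed.

(** The directional derivative expressed by the coordinate derivatives, which are the ones [Ck]
    speaks about. *)
Definition dirD (v : P) f : P -> R :=
  fun x => v.1.1 * D 0 f x + v.1.2 * D 1 f x + v.2 * D (1 + 1) f x.

Lemma lipschitz_deriv f (B : R) x w : (forall i y, derivable f y (u i)) ->
  (forall i y, `|D i f y| <= B) -> `|f (w + x) - f x| <= B * norm1 w.
Proof.
move=> df hB.
have step i (t : R) y : `|f (t *: u i + y) - f y| <= B * `|t|.
  have [s _ ->] := mvt_coord y t (df i); rewrite normrM mulrC.
  by rewrite ler_wpM2r.
rewrite {1}[w]unitv_decomp -!addrA.
set x1 := w.1.1 *: u 0 + x; set x2 := w.1.2 *: u 1 + x1.
have -> : f (w.2 *: u (1 + 1) + x2) - f x = (f (w.2 *: u (1 + 1) + x2) - f x2) +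
   (f (w.1.2 *: u 1 + x1) - f x1) + (f (w.1.1 *: u 0 + x) - f x).
  by rewrite -/x2 -/x1; ring.
have := step (1 + 1) w.2 x2; have := step 1 w.1.2 x1; have := step 0 w.1.1 x.
have := ler_normD (f (w.2 *: u (1 + 1) + x2) - f x2 + (f (w.1.2 *: u 1 +
  x1) - f x1)) (f (w.1.1 *: u 0 + x) - f x).
have := ler_normD (f (w.2 *: u (1 + 1) + x2) - f x2) (f (w.1.2 *: u 1 + x1) - f x1).
rewrite /norm1; lra.
Qed.

Lemma taylor_aux (F0 F1 F2 F3 d1 d2 d3 B : R) w : 0 <= B ->
  `|F1 - F0 - w.1.1 * d1| <= `|w.1.1| * (B * norm1 w) ->
  `|F2 - F1 - w.1.2 * d2| <= `|w.1.2| * (B * norm1 w) ->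
  `|F3 - F2 - w.2 * d3| <= `|w.2| * (B * norm1 w) ->
  `|F3 - F0 - (w.1.1 * d1 + w.1.2 * d2 + w.2 * d3)| <= 2 * B * norm1 w ^+ 2.
Proof.
move=> B0; rewrite /norm1; case: w => [[w1 w2] w3] /=.
set a := w1 * d1; set b := w2 * d2; set c := w3 * d3; move: a b c => a b c h1 h2 h3.
have -> : F3 - F0 - (a + b + c) = (F1 - F0 - a) + (F2 - F1 - b) + (F3 - F2 - c) by ring.
have e : `|w1| * (B * (`|w1| + `|w2| + `|w3|)) + `|w2| * (B * (`|w1| + `|w2| + `|w3|)) +
    `|w3| * (B * (`|w1| + `|w2| + `|w3|)) = B * (`|w1| + `|w2| + `|w3|) ^+ 2 by ring.
have e2 := mulr_ge0 B0 (sqr_ge0 (`|w1| + `|w2| + `|w3|)).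
rewrite (le_trans (ler_normD _ _))//.
have := lerD (le_trans (ler_normD _ _) (lerD h1 h2)) h3; rewrite e => /le_trans; apply.
by rewrite -mulrA ler_peMl// ler1n.
Qed.

(** The path from [x] to [w + x] runs along three coordinate segments. On each one the mean value
    theorem yields a partial derivative at a displaced point, and moving that point back to [x]
    costs [B * norm1 w]. *)
Lemma taylor1 f (B : R) x w : (forall i y, derivable f y (u i)) ->
  (forall i j y, derivable (D i f) y (u j)) ->
  (forall i j y, `|D j (D i f) y| <= B) ->
  `|f (w + x) - f x - dirD w f x| <= 2 * B * norm1 w ^+ 2.
Proof.
move=> df d2f hB.
have B0 : 0 <= B := le_trans (normr_ge0 _) (hB 0 0 0).
have step i (t : R) (p z : P) : p = z + x -> norm1 z + `|t| <= norm1 w ->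
    `|f (t *: u i + p) - f p - t * D i f x| <= `|t| * (B * norm1 w).
  move=> -> hz; have [s st ->] := mvt_coord (z + x) t (df i).
  rewrite -mulrBr normrM ler_wpM2l// addrA.
  rewrite (le_trans (lipschitz_deriv x _ (d2f i) (hB i)))// ler_wpM2l//.
  rewrite (le_trans (norm1D _ _))// norm1_unit addrC (le_trans _ hz)//.
  by rewrite lerD2l.
rewrite {1}[w]unitv_decomp -!addrA.
set p1 := w.1.1 *: u 0 + x; set p2 := w.1.2 *: u 1 + p1.
have s1 : `|f p1 - f x - w.1.1 * D 0 f x| <= `|w.1.1| * (B * norm1 w).
  apply: (step 0 w.1.1 x 0); first by rewrite add0r.
  by rewrite -{1}(scale0r (u 0)) norm1_unit normr0 add0r /norm1 -addrA lerDl addr_ge0.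
have s2 : `|f p2 - f p1 - w.1.2 * D 1 f x| <= `|w.1.2| * (B * norm1 w).
  apply: (step 1 w.1.2 p1 (w.1.1 *: u 0)) => //.
  by rewrite norm1_unit /norm1 lerDl.
have s3 : `|f (w.2 *: u (1 + 1) + p2) - f p2 - w.2 * D (1 + 1) f x| <= `|w.2| * (B * norm1 w).
  apply: (step (1 + 1) w.2 p2 (w.1.2 *: u 1 + w.1.1 *: u 0)); first by rewrite -addrA.
  rewrite /norm1 lerD2r (le_trans (norm1D _ _))// !norm1_unit addrC.
  by [].
rewrite addrA; exact: taylor_aux s1 s2 s3.
Qed.

(** Any compact set containing the nonzero points stands for the closed support, which makes
    stability under sums and products immediate; [Cc_inftyE] compares this with [Cc_infty]. *)
Definition Cc (A : set P) f := smooth f /\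
  exists2 Kc, compact Kc & Kc `<=` A /\ forall x, f x != 0 -> Kc x.

Lemma hausdorffP : hausdorff_space P.
Proof. exact: norm_hausdorff. Qed.

Lemma compact_closedP (A : set P) : compact A -> closed A.
Proof. by move=> cA; apply: compact_closed => //; exact: hausdorffP. Qed.

Lemma compact_sub_cube (A : set P) : compact A -> exists r, A `<=` cube r.
Proof.
move=> /compact_bounded[M [_ hM]]; exists (`|M| + 1) => x Ax.
have /hM/(_ _ Ax) : M < `|M| + 1 by rewrite (le_lt_trans (ler_norm _))// ltrDl.
rewrite /= prod_normE ge_max prod_normE ge_max => /andP[/andP[h1 h2] h3].
by apply/cubeE.
Qed.

Lemma derive_support f i (Kc : set P) x : closed Kc -> (forall x, f x != 0 -> Kc x) ->
  D i f x != 0 -> Kc x.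
Proof.
move=> cK h; apply: contra_neqP => nK; rewrite (near_eq_derive (g := fun=> 0)).
  exact: derive_cst.
have : nbhs x (~` Kc) by apply: open_nbhs_nbhs; split => //; exact: closed_openC.
by apply: filterS => y nKy; apply/eqP; apply: contra_notT nKy => /h.
Qed.

Lemma Cc_smooth A f : Cc A f -> smooth f. Proof. by case. Qed.

Lemma Cc_derive A i f : Cc A f -> Cc A (D i f).
Proof.
move=> [sf [Kc cK [KA hK]]]; split; first exact: smooth_derive.
by exists Kc => //; split=> // x; apply: derive_support hK; exact: compact_closedP.
Qed.

Lemma CcMl A f g : smooth f -> Cc A g -> Cc A (fun x => f x * g x).
Proof.
move=> sf [sg [Kc cK [KA hK]]]; split; first exact: smoothM.
by exists Kc => //; split=> // x; rewrite mulf_eq0 negb_or => /andP[_ /hK].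
Qed.

Lemma CcMr A f g : Cc A f -> smooth g -> Cc A (fun x => f x * g x).
Proof. by move=> hf hg; under eq_fun do rewrite mulrC; exact: CcMl. Qed.

Lemma CcZ A (c : R) f : Cc A f -> Cc A (fun x => c * f x).
Proof. by apply: CcMl; exact: smooth_cst. Qed.

Lemma Cc0 A : Cc A (fun=> 0).
Proof.
split; first exact: smooth_cst.
by exists set0; [exact: compact0|split=> [//|x]; rewrite eqxx].
Qed.

Lemma CcD A f g : Cc A f -> Cc A g -> Cc A (fun x => f x + g x).
Proof.
move=> [sf [Kf cf [fA hf]]] [sg [Kg cg [gA hg]]]; split; first exact: smoothD.
exists (Kf `|` Kg); first exact: compactU.
split=> [x [/fA|/gA]//|x h]; have [fx|/hf] := eqVneq (f x) 0; last by left.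
by right; apply: hg; move: h; rewrite fx add0r.
Qed.

Lemma CcN A f : Cc A f -> Cc A (fun x => - f x).
Proof. by move=> /(CcZ (-1)); under eq_fun do rewrite mulN1r. Qed.

Lemma CcB A f g : Cc A f -> Cc A g -> Cc A (fun x => f x - g x).
Proof. by move=> hf hg; apply: CcD => //; exact: CcN. Qed.

Lemma Cc_sum A (J : Type) (r : seq J) (F : J -> P -> R) : (forall j, Cc A (F j)) ->
  Cc A (fun x => \sum_(j <- r) F j x).
Proof.
move=> h; elim: r => [|j r IH]; first by under eq_fun do rewrite big_nil; exact: Cc0.
by under eq_fun do rewrite big_cons; exact: CcD.
Qed.

Lemma Cc_bounded A f : Cc A f -> exists2 M, 0 <= M & forall x, `|f x| <= M.
Proof.
move=> [sf [Kc cK [_ hK]]].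
have : compact (f @` Kc).
  apply: continuous_compact => //; apply: continuous_subspaceT.
  exact: smooth_continuous.
move=> /compact_bounded[M [_ hM]]; exists (`|M| + 1) => [|x]; first by rewrite addr_ge0.
have [->|/hK Kx] := eqVneq (f x) 0; first by rewrite normr0 addr_ge0.
have /hM : M < `|M| + 1 by rewrite (le_lt_trans (ler_norm _))// ltrDl.
by apply; exists x.
Qed.

Lemma Cc_support A f : Cc A f -> exists r, forall x, ~ cube r x -> f x = 0.
Proof.
move=> [_ [Kc cK [_ hK]]]; have [r hr] := compact_sub_cube cK; exists r => x hx.
by apply/eqP; apply: contra_notT hx => /hK/hr.
Qed.

Lemma Cc_BM A f : Cc A f -> BM f.
Proof.
move=> hf; have [M _ hM] := Cc_bounded hf; have [r hr] := Cc_support hf.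
split; [|by exists M|by exists r].
by apply: continuous_measurable3; apply: smooth_continuous; case: hf.
Qed.

Lemma Cc_lipschitz A f : Cc A f -> exists2 L, 0 <= L &
  forall x w, `|f (w + x) - f x| <= L * norm1 w.
Proof.
move=> hf; have /choice[M hM] i : exists M, 0 <= M /\ forall x, `|D i f x| <= M.
  by have [M M0 hM] := Cc_bounded (Cc_derive i hf); exists M.
exists (\sum_i M i); first by apply: sumr_ge0 => i _; case: (hM i).
move=> x w; apply: lipschitz_deriv => [i y|i y]; first by apply: smooth_derivable; case: hf.
have [M0 h] := hM i; rewrite (le_trans (h y))// (bigD1 i)//= lerDl.
by apply: sumr_ge0 => j _; case: (hM j).
Qed.

Lemma Cc_taylor A f : Cc A f -> exists2 B, 0 <= B &
  forall x w, `|f (w + x) - f x - dirD w f x| <= B * norm1 w ^+ 2.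
Proof.
move=> hf; have /choice[M hM] (p : 'I_3 * 'I_3) : exists M, 0 <= M /\ forall x,
  `|D p.2 (D p.1 f) x| <= M.
  by have [M M0 hM] := Cc_bounded (Cc_derive p.2 (Cc_derive p.1 hf)); exists M.
exists (2 * \sum_p M p); first by rewrite mulr_ge0//; apply: sumr_ge0 => i _; case: (hM i).
move=> x w; apply: taylor1 => [i y|i j y|i j y].
- by apply: smooth_derivable; case: hf.
- by apply: smooth_derivable; apply: smooth_derive; case: hf.
have [M0 h] := hM (i, j); rewrite (le_trans (h y))// (bigD1 (i, j))//= lerDl.
by apply: sumr_ge0 => p _; case: (hM p).
Qed.

(* [avg k v f] is the mean of the translates [f (x - (l / 2 ^ k) v)], l < 2 ^ k; it
   is a discrete substitute for the mean of f over the segment from x - v to x. *)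
Fixpoint avg (k : nat) (v : P) f : P -> R :=
  if k is k'.+1 then
    let g := avg k' (2^-1 *: v) f in fun x => 2^-1 * (g x + g (x - 2^-1 *: v))
  else f.

Lemma smooth_avg k v f : smooth f -> smooth (avg k v f).
Proof.
elim: k v => [|k IH] v hf //=; apply: smoothZ; apply: smoothD; first exact: IH.
by apply: smooth_shift; exact: IH.
Qed.

Lemma derive_avg k v f i : smooth f -> D i (avg k v f) = avg k v (D i f).
Proof.
move=> hf; elim: k v => [//|k IH] v /=.
have h := smooth_avg k (2^-1 *: v) hf.
rewrite derive_fZ; last by apply: smoothD => //; exact: smooth_shift.
have e := @derive_fD _ (fun x => avg k (2^-1 *: v) f (x - 2^-1 *: v)) i h (smooth_shift _ h).
by apply/funext => x; rewrite (congr1 (@^~ x) e) /= -IH -(derive_shift _ (- (2^-1 *: v)) x).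
Qed.

Lemma avgD k v f g : avg k v (fun x => f x + g x) = fun x => avg k v f x + avg k v g x.
Proof.
by elim: k v => [//|k IH] v /=; rewrite IH; apply/funext => x; ring.
Qed.

Lemma avgZ k v (c : R) f : avg k v (fun x => c * f x) = fun x => c * avg k v f x.
Proof.
by elim: k v => [//|k IH] v /=; rewrite IH; apply/funext => x; ring.
Qed.

Lemma avg_support k v f x : avg k v f x != 0 ->
  exists2 s, 0 <= s <= 1 & f (x - s *: v) != 0.
Proof.
elim: k v x => [|k IH] v x /= h.
  by exists 0; rewrite ?lexx ?ler01// scale0r subr0.
have [h0|/IH[s /andP[s0 s1] hs]] := eqVneq (avg k (2^-1 *: v) f x) 0; last first.
  exists (s / 2); first by rewrite divr_ge0//=; lra.
  by rewrite -scalerA.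
have /IH[s /andP[s0 s1] hs] : avg k (2^-1 *: v) f (x - 2^-1 *: v) != 0.
  by apply: contra_neq h => ->; rewrite h0 addr0 mulr0.
exists ((s + 1) / 2); first by apply/andP; split; lra.
by move: hs; rewrite -addrA -opprD scalerA -scalerDl; congr (f (x - _ *: v) != 0); ring.
Qed.

Lemma BM_avg k v f : BM f -> BM (avg k v f).
Proof.
elim: k v => [//|k IH] v hf /=; apply: BMZ; apply: BMD; first exact: IH.
by apply: BM_shift; exact: IH.
Qed.

(** Convexity of the square and translation invariance, applied at each halving. *)
Lemma I3_avg_sqr k v f : BM f -> I3 (fun x => avg k v f x ^+ 2) <= I3 (fun x => f x ^+ 2).
Proof.
move=> hf; elim: k v => [//|k IH] v /=; set g := avg k (2^-1 *: v) f.
have hg : BM g by exact: BM_avg.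
have h1 : BM (fun x => g x ^+ 2) by exact: BMX2.
have h2 : BM (fun x => g (x - 2^-1 *: v) ^+ 2) by exact: (BM_shift (- (2^-1 *: v)) h1).
apply: (@le_trans _ _ (I3 (fun x => 2^-1 * (g x ^+ 2 + g (x - 2^-1 *: v) ^+ 2)))).
  apply: le_I3; first by apply: BMX2; apply: BMZ; apply: BMD => //; exact: BM_shift.
    by apply: BMZ; exact: BMD.
  move=> x; have := sqr_ge0 (g x - g (x - 2^-1 *: v)); rewrite -subr_ge0 => h.
  rewrite -subr_ge0; move: h; rewrite !expr2; lra.
rewrite I3Z; last exact: BMD.
rewrite I3D// (I3_shift (- (2^-1 *: v)) h1).
by have := IH (2^-1 *: v); rewrite -/g; lra.
Qed.

Lemma dirDZ (c : R) v f x : dirD (c *: v) f x = c * dirD v f x.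
Proof.
rewrite /dirD; move: ('D_(u 0) f x) ('D_(u 1) f x) ('D_(u (1 + 1)) f x) => p q r.
by case: v => [[a b] d]; rewrite /= /GRing.scale /=; ring.
Qed.

Lemma dirDN v f x : dirD (- v) f x = - dirD v f x.
Proof. by rewrite -scaleN1r dirDZ mulN1r. Qed.

Lemma half_half (v : P) : 2^-1 *: v + 2^-1 *: v = v.
Proof. by rewrite -scalerDl (_ : 2^-1 + 2^-1 = 1 :> R) ?scale1r//; lra. Qed.

Lemma norm1_half (v : P) : norm1 (2^-1 *: v) = norm1 v / 2.
Proof.
by rewrite norm1Z; move: (norm1 v) => n; rewrite ger0_norm ?invr_ge0//; exact: mulrC.
Qed.

(** The discrete form of writing [f x - f (x - v)] as an integral of the derivative along the
    segment. Halving [v] produces two Taylor errors, each a quarter of the previous one, so every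
    halving gains a factor 2. *)
Lemma avg_taylor k v f (B : R) :
  (forall x w, `|f (w + x) - f x - dirD w f x| <= B * norm1 w ^+ 2) ->
  forall x, `|f x - f (x - v) - avg k v (dirD v f) x| <= B * norm1 v ^+ 2 * (2^-1) ^+ k.
Proof.
move=> hB; elim: k v => [|k IH] v x /=.
  have := hB x (- v); rewrite norm1N dirDN expr0 mulr1.
  rewrite -normrN [- v + x]addrC; congr (`|_| <= _).
  by move: (f x) (f (x - v)) (dirD v f x) => p q r; ring.
set w := 2^-1 *: v.
have -> : dirD v f = fun x => 2 * dirD w f x.
  by apply/funext => y; rewrite /w dirDZ mulrA divff ?mul1r// pnatr_eq0.
rewrite avgZ; have := IH w x; have := IH w (x - w).
have -> : x - w - w = x - v by rewrite -addrA -opprD half_half.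
have -> : norm1 w = norm1 v / 2 by exact: norm1_half.
rewrite (exprS _ k); set e := 2^-1 ^+ k; set n := norm1 v.
move: (avg k w _ x) (avg k w _ (x - w)) (f x) (f (x - w)) (f (x - v)) => p q r s t h1 h2.
have -> : r - t - 2^-1 * (2 * p + 2 * q) = (r - s - p) + (s - t - q) by field.
rewrite (le_trans (ler_normD _ _))//.
rewrite (le_trans (lerD h2 h1))// -subr_ge0 (_ : _ - _ = 0)//.
by rewrite !expr2; field.
Qed.

(** Makes integrals against [avg k v f] converge in [k], although the functions themselves are never
    passed to the limit. *)
Lemma avg_cauchy k v f (L : R) : (forall x w, `|f (w + x) - f x| <= L * norm1 w) ->
  forall x, `|avg k.+1 v f x - avg k v f x| <= L * norm1 v * (2^-1) ^+ k.+1.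
Proof.
move=> hL; elim: k v => [|k IH] v x.
  rewrite /= expr1; have := hL x (- (2^-1 *: v)); rewrite norm1N norm1_half [- _ + x]addrC.
  have -> : 2^-1 * (f x + f (x - 2^-1 *: v)) - f x = 2^-1 * (f (x - 2^-1 *: v) - f x) by field.
  have n0 := norm1_ge0 v; rewrite normrM ger0_norm ?invr_ge0// => h.
  have := le_trans (normr_ge0 _) h; lra.
have -> : avg k.+2 v f x = 2^-1 * (avg k.+1 (2^-1 *: v) f x +
  avg k.+1 (2^-1 *: v) f (x - 2^-1 *: v)) by [].
have -> : avg k.+1 v f x = 2^-1 * (avg k (2^-1 *: v) f x + avg k (2^-1 *: v) f (x - 2^-1 *: v))
  by [].
have := IH (2^-1 *: v) x; have := IH (2^-1 *: v) (x - 2^-1 *: v).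
rewrite norm1_half (exprS _ k.+1); set e := 2^-1 ^+ k.+1; set n := norm1 v.
move: (avg k.+1 _ _ x) (avg k.+1 _ _ _) (avg k _ _ x) (avg k _ _ _) => p q r s h1 h2.
have -> : 2^-1 * (p + q) - 2^-1 * (r + s) = 2^-1 * ((p - r) + (q - s)) by ring.
rewrite normrM ger0_norm ?invr_ge0//; have := ler_normD (p - r) (q - s).
have -> : L * n * (2^-1 * e) = L * (n / 2) * e by ring.
lra.
Qed.

End calculus3.

(** * Integration by parts and the inequalities of Poincare and Rellich *)

Section integral_calculus.
Variable R : realType.
Local Notation P := (R3 R).
Local Notation u := (unitv R).
Implicit Types (f g : P -> R) (x a v h : P).
Local Notation D i f := ('D_(u i) f).

Lemma eps_bound (a C : R) : (forall e, 0 < e -> e <= 1 -> a <= C * e) -> a <= 0.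
Proof.
move=> h; apply/ler_addgt0Pl => e e0; rewrite addr0.
have C1 : 0 < `|C| + 1 by rewrite ltr_wpDl.
have [l|l] := leP (e / (`|C| + 1)) 1.
  rewrite (le_trans (h _ (divr_gt0 e0 C1) l))// mulrA ler_pdivrMr// mulrC ler_wpM2l// ?ltW//.
  by have := ler_norm C; lra.
rewrite (le_trans (h 1 ltr01 (lexx _)))// mulr1.
by move: l; rewrite ltr_pdivlMr// mul1r; have := ler_norm C; lra.
Qed.

Lemma pow2_bound (a C : R) : (forall k, a <= C * 2^-1 ^+ k) -> a <= 0.
Proof.
move=> h; have hc : (fun k => C * 2^-1 ^+ k : R) @ \oo --> (C * 0 : R).
  by apply: cvgM; [exact: cvg_cst|apply: cvg_expr; rewrite ger0_norm ?invr_ge0//; lra].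
rewrite mulr0 in hc; rewrite -(cvg_lim (@Rhausdorff R) hc).
by apply: limr_ge; [apply/cvg_ex; exists 0|apply: nearW].
Qed.

Lemma dirD_unit i f x : dirD (u i) f x = D i f x.
Proof.
suff h (F : 'I_3 -> R) : (u i).1.1 * F 0 + (u i).1.2 * F 1 + (u i).2 * F (1 + 1) = F i.
  exact: (h (fun j => 'D_(u j) f x)).
case: i => -[|[|[|//]]] hi /=; rewrite ?mul0r ?mul1r ?add0r ?addr0; congr F; exact/val_inj.
Qed.

Lemma cube_grow (r s : R) x w : norm1 w <= s -> ~ cube (r + s) x -> ~ cube r (w + x).
Proof.
move=> ws hx /cubeE[h1 h2 h3]; apply: hx; apply/cubeE; move: ws h1 h2 h3.
rewrite /norm1; case: x w => [[x y] z] [[a b] c] /= ws h1 h2 h3.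
have k (p q t : R) : `|p + q| <= t -> `|q| <= t + `|p|.
  by move=> h; have := ler_normB (p + q) p; rewrite [p + q]addrC addrK [q + p]addrC; lra.
have := k _ _ _ h1; have := k _ _ _ h2; have := k _ _ _ h3.
have := normr_ge0 a; have := normr_ge0 b; have := normr_ge0 c.
by split; lra.
Qed.

Lemma BM_shiftl a f : BM f -> BM (fun x => f (a + x)).
Proof. by move=> h; under eq_fun do rewrite addrC; exact: BM_shift. Qed.

Lemma I3_shiftl a f : BM f -> I3 (fun x => f (a + x)) = I3 f.
Proof. by move=> h; under eq_fun do rewrite addrC; exact: I3_shift. Qed.

(** By translation invariance the increment [f (e u_i + x) - f x] integrates to 0, so [e] times the
    integral of the derivative is a Taylor error of order [e^2] on a fixed cube. The summand 1 in
    [s] makes room for shifts with [e <= 1]. *)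
Lemma I3_derive A i f : Cc A f -> I3 (D i f) = 0.
Proof.
move=> hf; have [B B0 hB] := Cc_taylor hf; have [r hr] := Cc_support hf.
have bf := Cc_BM hf; have bD := Cc_BM (Cc_derive i hf).
have [r' hr'] := Cc_support (Cc_derive i hf).
apply/eqP; rewrite -normr_le0; set s := `|r| + `|r'| + 1.
apply: (@eps_bound _ (B * (2 * s) ^+ 3)) => e e0 e1.
have bs := BM_shiftl (e *: u i) bf.
have bZ := BMZ e bD; have bb := BMB bs bf.
have eq : I3 (fun x => f (e *: u i + x) - f x - e * D i f x) = - (e * I3 (D i f)).
  by rewrite I3B// I3B// I3_shiftl// I3Z// subrr add0r.
have : `|I3 (fun x => f (e *: u i + x) - f x - e * D i f x)| <= B * e ^+ 2 * (2 * s) ^+ 3.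
  apply: le_I3_cube; first exact: BMB.
  - by rewrite /s !addr_ge0.
  - move=> x; have := hB x (e *: u i); rewrite dirDZ dirD_unit norm1_unit.
    by rewrite real_normK ?num_real.
  move=> x hx; rewrite hr ?hr ?hr' ?mulr0 ?subr0//.
  - move=> h; apply: hx; apply: cube_mono h; rewrite /s; have := ler_norm r'.
    by have := normr_ge0 r; lra.
  - move=> h; apply: hx; apply: cube_mono h; rewrite /s; have := ler_norm r.
    by have := normr_ge0 r'; lra.
  apply: (@cube_grow r 1); first by rewrite norm1_unit ger0_norm// ltW.
  move=> h; apply: hx; apply: cube_mono h; rewrite /s; have := ler_norm r.
  by have := normr_ge0 r'; lra.
rewrite eq normrN normrM (gtr0_norm e0) expr2.
have -> : B * (e * e) * (2 * s) ^+ 3 = e * (B * (2 * s) ^+ 3 * e) by ring.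
by rewrite ler_pM2l.
Qed.

Lemma I3_ibp A i f g : Cc A f -> smooth g ->
  I3 (fun x => D i f x * g x) = - I3 (fun x => f x * D i g x).
Proof.
move=> hf hg; have := I3_derive i (CcMr hf hg).
rewrite derive_fM//; last exact: Cc_smooth hf.
rewrite I3D; last 2 first.
- by apply: Cc_BM; apply: (CcMr hf); exact: smooth_derive.
- by apply: Cc_BM; apply: (CcMl hg); exact: Cc_derive hf.
move=> /eqP; rewrite addrC addr_eq0 => /eqP <-; congr I3.
by apply/funext => x; exact: mulrC.
Qed.

Definition dirichlet f : R := \sum_i I3 (fun x => D i f x ^+ 2).

Lemma lin3_sqr v (F : 'I_3 -> R) :
  (v.1.1 * F 0 + v.1.2 * F 1 + v.2 * F (1 + 1)) ^+ 2 <= norm1 v ^+ 2 * \sum_i F i ^+ 2.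
Proof.
rewrite 3!big_ord_recl big_ord0 addr0 /norm1.
rewrite (_ : lift ord0 (lift ord0 ord0) = 1 + 1); last exact/val_inj.
rewrite (_ : lift ord0 ord0 = 1); last exact/val_inj.
move: (F ord0) (F 1) (F (1 + 1)) => p q r.
case: v => [[a b] c] /=.
rewrite -[X in X <= _]real_normK ?num_real//.
set A := `|a|; set B := `|b|; set C := `|c|.
have [A0 B0 C0] : [/\ 0 <= A, 0 <= B & 0 <= C] by rewrite !normr_ge0.
set s := Num.sqrt (p ^+ 2 + (q ^+ 2 + r ^+ 2)).
have S0 : 0 <= p ^+ 2 + (q ^+ 2 + r ^+ 2) by rewrite !addr_ge0 ?sqr_ge0.
have sE : s ^+ 2 = p ^+ 2 + (q ^+ 2 + r ^+ 2) by rewrite sqr_sqrtr.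
have s0 : 0 <= s by exact: sqrtr_ge0.
have hs (z : R) : z ^+ 2 <= p ^+ 2 + (q ^+ 2 + r ^+ 2) -> `|z| <= s.
  by move=> h; rewrite -sqrtr_sqr ler_wsqrtr.
have hp : `|p| <= s by apply: hs; rewrite lerDl addr_ge0 ?sqr_ge0.
have hq : `|q| <= s by apply: hs; rewrite addrCA lerDl addr_ge0 ?sqr_ge0.
have hr : `|r| <= s by apply: hs; rewrite addrA lerDr addr_ge0 ?sqr_ge0.
have h : `|a * p + b * q + c * r| <= (A + B + C) * s.
  rewrite (le_trans (ler_normD _ _))// (le_trans (lerD (ler_normD _ _) (lexx _)))//.
  by rewrite !normrM !mulrDl !lerD// ler_wpM2l.
rewrite -sE -exprMn; apply: lerXn2r h => //; rewrite nnegrE// mulr_ge0// !addr_ge0//.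
Qed.

Lemma dirD_sqr v f x : dirD v f x ^+ 2 <= norm1 v ^+ 2 * \sum_i D i f x ^+ 2.
Proof. exact: (lin3_sqr v (fun j => 'D_(u j) f x)). Qed.

Lemma BM_dirD A v f : Cc A f -> Cc A (dirD v f).
Proof.
move=> hf; rewrite /dirD; apply: CcD; [apply: CcD|]; apply: CcZ; exact: Cc_derive.
Qed.

Lemma I3_dirD_sqr A v f : Cc A f ->
  I3 (fun x => dirD v f x ^+ 2) <= norm1 v ^+ 2 * dirichlet f.
Proof.
move=> hf; have bD i : BM (fun x => D i f x ^+ 2).
  by apply: BMX2; apply: Cc_BM; exact: Cc_derive hf.
rewrite /dirichlet -I3_sum// -I3Z; last exact: BM_sum.
apply: le_I3 => [||x]; last exact: dirD_sqr.
  by apply: BMX2; apply: Cc_BM; exact: BM_dirD hf.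
by apply: BMZ; exact: BM_sum.
Qed.

Lemma le_norm1_half (s : R) v : 0 <= s <= 1 -> norm1 (s *: v) <= norm1 v.
Proof.
by move=> /andP[s0 s1]; rewrite norm1Z ger0_norm// ler_piMl ?norm1_ge0.
Qed.

(** The increment is the average of the directional derivative up to the error [e k], which is of
    order [2^-k] and vanishes off a cube independent of [k]. The factor 2 is the price of splitting
    the square; the error disappears as [k] grows. *)
Lemma I3_translate A v f : Cc A f ->
  I3 (fun x => (f x - f (x - v)) ^+ 2) <= 2 * norm1 v ^+ 2 * dirichlet f.
Proof.
move=> hf; have [B B0 hB] := Cc_taylor hf; have [r hr] := Cc_support hf.
have bf := Cc_BM hf; have bs := BM_shift (- v) bf.
have hd := BM_dirD v hf; have bd := Cc_BM hd.
have [r' hr'] := Cc_support hd.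
set s := `|r| + `|r'| + norm1 v; have n0 := norm1_ge0 v.
have s0 : 0 <= s by rewrite /s !addr_ge0.
pose e k x := f x - f (x - v) - avg k v (dirD v f) x.
have he k : BM (e k) by apply: BMB; [exact: BMB|exact: BM_avg].
have es k x : ~ cube s x -> e k x = 0.
  move=> hx; have far (t : R) (w : P) : `|t| <= `|r| + `|r'| -> norm1 w <= norm1 v ->
    ~ cube t (x - w).
    move=> tr wv; rewrite addrC; apply: (@cube_grow t (norm1 v)); first by rewrite norm1N.
    move=> h; apply: hx; apply: cube_mono h; rewrite /s lerD2r (le_trans (ler_norm _))//.
  have f1 : f x = 0.
    apply: hr; rewrite -(subr0 x); apply: far; first by rewrite lerDl.
    by rewrite -(scale0r v); apply: le_norm1_half; rewrite lexx ler01.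
  have f2 : f (x - v) = 0 by apply: hr; apply: far; rewrite ?lexx// lerDl.
  rewrite /e f1 f2 !sub0r oppr0 add0r; apply/eqP; rewrite oppr_eq0; apply/eqP.
  apply/eqP; apply/negPn/negP => /avg_support[t t01]; rewrite hr' ?eqxx//.
  by apply: far; [rewrite lerDr|exact: le_norm1_half].
have key k : I3 (fun x => (f x - f (x - v)) ^+ 2) <= 2 * (norm1 v ^+ 2 * dirichlet f) +
    2 * ((B * norm1 v ^+ 2) ^+ 2 * (2 * s) ^+ 3) * 2^-1 ^+ k.
  apply: (@le_trans _ _ (2 * I3 (fun x => avg k v (dirD v f) x ^+ 2) + 2 * I3 (fun x =>
    e k x ^+ 2))).
    have b1 := BMX2 (BM_avg k v bd); have b2 := BMX2 (he k).
    rewrite -!I3Z// -I3D; [|exact: BMZ|exact: BMZ].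
    apply: le_I3; [by apply: BMX2; exact: BMB|by apply: BMD; exact: BMZ|] => x.
    rewrite /e; move: (f x - f (x - v)) (avg k v _ x) => p q.
    by rewrite -subr_ge0 (_ : _ - _ = (p - 2 * q) ^+ 2) ?sqr_ge0//; ring.
  apply: lerD.
    by rewrite ler_pM2l// (le_trans (I3_avg_sqr k v bd))//; exact: I3_dirD_sqr hf.
  rewrite -mulrA ler_pM2l// (le_trans (ler_norm _))//.
  have := @le_I3_cube R (fun x => e k x ^+ 2) ((B * norm1 v ^+ 2) ^+ 2 * 2^-1 ^+ k) s.
  rewrite [_ * (2 * s) ^+ 3 * _]mulrAC => h; apply: h => //;
    [exact: BMX2| |by move=> x /(es k) ->; rewrite expr0n].
  move=> x; rewrite normrX; have := avg_taylor k v hB x; rewrite -/(e k x) => h.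
  rewrite (@le_trans _ _ ((B * norm1 v ^+ 2 * 2^-1 ^+ k) ^+ 2))//.
    apply: lerXn2r h => //; rewrite nnegrE// !mulr_ge0// ?exprn_ge0// invr_ge0//.
  rewrite exprMn ler_wpM2l ?sqr_ge0// expr2 ler_piMl ?exprn_ge0 ?invr_ge0//.
  by rewrite exprn_ile1 ?invr_ge0// invf_le1// ler1n.
rewrite -subr_le0; apply: (@pow2_bound _ (2 * ((B * norm1 v ^+ 2) ^+ 2 * (2 * s) ^+ 3))) => k.
by rewrite lerBlDl -mulrA.
Qed.

(** A shift by [2 r + 1] is wider than the cube, so [f] and its translate have disjoint supports and
    the left-hand side of [I3_translate] is twice the integral of [f^2]. *)
Lemma poincare A f r : 0 <= r -> A `<=` cube r -> Cc A f ->
  I3 (fun x => f x ^+ 2) <= (2 * r + 1) ^+ 2 * dirichlet f.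
Proof.
move=> r0 Ar hf; pose v := (2 * r + 1) *: u 0 : P.
have bf := Cc_BM hf; have bs := BM_shift (- v) bf.
have supp x : f x != 0 -> cube r x.
  by case: hf => _ [Kc _ [KA hK]] /hK/KA/Ar.
have vE : norm1 v = 2 * r + 1 by rewrite norm1_unit ger0_norm// addr_ge0// mulr_ge0.
have := I3_translate v hf; rewrite vE.
have -> : (fun x => (f x - f (x - v)) ^+ 2) = fun x => f x ^+ 2 + f (x - v) ^+ 2.
  apply/funext => x; have [->|/supp/cubeE[h1 _ _]] := eqVneq (f x) 0.
    by rewrite sub0r sqrrN expr0n add0r.
  have [->|/supp/cubeE[h2 _ _]] := eqVneq (f (x - v)) 0; first by rewrite subr0 expr0n addr0.
  exfalso; move: h1 h2 => /=; rewrite /GRing.scale /= mulr1 => h1 h2.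
  move: h1 h2; rewrite !ler_norml => /andP[_ h1] /andP[h2 _]; lra.
rewrite I3D ?(I3_shift (- v) (BMX2 bf)); [|exact: BMX2|exact: (BM_shift (- v) (BMX2 bf))].
by move: (I3 _) (dirichlet f) => p q; rewrite -mulrA -mulr2n -[p *+ 2]mulr_natl ler_pM2l.
Qed.

(** The constant is [72 = 4 * 2 * 3^2]: the factor of [rellich_cells], that of [I3_translate], and
    [norm1 h <= 3 * mesh a N] for [h] in the cube of differences. *)
Lemma rellich A f (a : R) (N : nat) : 0 < a -> (0 < N)%N -> (forall x, A x -> [/\ `|x.1.1| < a,
  `|x.1.2| < a & `|x.2| < a]) ->
  Cc A f ->
  I3 (fun x => f x ^+ 2) <= 72 * mesh a N ^+ 2 * dirichlet f +
    (mesh a N ^+ 3)^-1 * \sum_t I3 (fun x => \1_(@cell R a N t) x * f x) ^+ 2.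
Proof.
move=> a0 N0 Aa hf; have d0 : 0 <= dirichlet f.
  by apply: sumr_ge0 => i _; apply: I3_ge0 => x; exact: sqr_ge0.
have -> : 72 * mesh a N ^+ 2 * dirichlet f = 4 * (2 * (3 * mesh a N) ^+ 2 * dirichlet f) by ring.
apply: rellich_cells => //; first exact: Cc_BM hf.
  by move=> x; case: hf => _ [Kc _ [KA hK]] /hK/KA/Aa.
move=> h /cubeE[h1 h2 h3]; have := I3_translate (- h) hf; rewrite norm1N.
rewrite (_ : (fun x => (f x - f (x - - h)) ^+ 2) = (fun x => (f x - f (h + x)) ^+ 2)).
  move=> /le_trans; apply; rewrite ler_wpM2r// ler_wpM2l//.
  apply: lerXn2r; rewrite ?nnegrE ?norm1_ge0//.
    by rewrite mulr_ge0// (le_trans (normr_ge0 _) h1).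
  by rewrite /norm1; lra.
by apply/funext => x; rewrite opprK [x + h]addrC.
Qed.

End integral_calculus.

(** * Bump functions and boundary patches *)

Section bumps.
Variable R : realType.
Local Notation P := (R3 R).
Local Notation u := (unitv R).

(* The derivatives of exp (-1/t) on t > 0 are combinations of the [flat n]. *)
Definition flat (n : nat) (t : R) : R := if 0 < t then t^-1 ^+ n * expR (- t^-1) else 0.

Lemma flat_le0 n t : t <= 0 -> flat n t = 0.
Proof. by rewrite /flat ltNge => ->. Qed.

Lemma flat_ge0 n t : 0 <= flat n t.
Proof.
by rewrite /flat; case: ifP => // t0; rewrite mulr_ge0 ?expR_ge0// exprn_ge0// invr_ge0 ltW.
Qed.

Lemma flatS n t : t != 0 -> flat n.+1 t = t^-1 * flat n t.
Proof. by move=> t0; rewrite /flat; case: ifP => _; rewrite ?mulr0// exprS mulrA. Qed.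

(** The exponential at [t^-1] dominates its Taylor term of degree [n + 1]. Applied to [flat n.+1],
    the difference quotient of [flat n] at 0 for nonzero increments, it gives derivative 0 there. *)
Lemma flat_bound n t : flat n t <= n.+1`!%:R * `|t|.
Proof.
rewrite /flat; case: ifP => t0; last by rewrite mulr_ge0.
rewrite (gtr0_norm t0) expRN ler_pdivrMr ?expR_gt0//.
have ti : 0 <= t^-1 by rewrite invr_ge0 ltW.
have h := expR_ge1Dxn n ti; have h0 : 0 < n.+1`!%:R :> R by rewrite ltr0n fact_gt0.
have {}h : t^-1 ^+ n.+1 <= n.+1`!%:R * expR t^-1.
  rewrite -ler_pdivrMl// mulrC (le_trans _ h)//; lra.
move: h; rewrite exprS mulrC -ler_pdivlMr ?invr_gt0// invrK mulrAC; exact.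
Qed.

Lemma is_derive_flat n (t : R) :
  is_derive t 1 (flat n) (flat n.+2 t - n%:R * flat n.+1 t).
Proof.
have [t0|t0|->] := ltgtP t 0.
- rewrite !flat_le0 ?ltW// mulr0 subr0.
  apply: (near_eq_is_derive _ (is_derive_cst (0 : R) t (1 : R))).
  by near=> s; rewrite flat_le0// ltW//; near: s; exact: lt_nbhsl.
- have tn0 : t != 0 by rewrite gt_eqF.
  apply: (@near_eq_is_derive R R R (fun s : R => s^-1 ^+ n * expR (- s^-1) : R)).
    by near=> s; rewrite /flat ifT//; near: s; exact: lt_nbhsr.
  have h1 : is_derive t 1 (fun y : R => y^-1) (- t ^- 2).
    by apply: is_derive_eq; [exact: (@is_deriveV _ id)|rewrite /GRing.scale /= mulr1].
  have h2 : is_derive t 1 (fun y : R => expR (- y^-1)) (expR (- t^-1) * t ^- 2).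
    have := @is_derive1_comp _ expR (fun y : R => - y^-1) t _ _ (is_derive_expR _) (is_deriveN h1).
    by rewrite opprK.
  have hX : is_derive t 1 (fun y : R => y^-1 ^+ n) ((n%:R * t^-1 ^+ n.-1) *: - t ^- 2).
    have := is_deriveX n h1; congr (is_derive _ _ _ _); apply/funext => y.
    by elim: n => [|n IH]; rewrite ?expr0// !exprS -IH.
  apply: (is_derive_eq (is_deriveM hX h2)).
  rewrite /flat t0 /GRing.scale /=.
  case: n {hX} => [|n]; first by rewrite !mul0r mulr0 addr0 subr0 expr0 mul1r exprVn mulrC.
  rewrite -pred_Sn !exprS; move: (n.+1%:R) (_ ^+ n) (expR _) => a b c; field; exact: tn0.
rewrite !flat_le0// mulr0 subr0.
have e h : h != 0 -> h^-1 *: ((flat n \o shift 0) (h *: (1 : R)) - flat n 0) = flat n.+1 h.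
  by move=> h0; rewrite /= addr0 [h *: (1 : R)]mulr1 (flat_le0 _ (lexx 0)) subr0 flatS.
have c : (fun h : R => h^-1 *: ((flat n \o shift 0) (h *: (1 : R)) - flat n 0)) @ 0^' --> (0 : R).
  apply: (@cvg_trans _ (flat n.+1 @ 0^')).
    by apply: near_eq_cvg; near=> h; rewrite e//; near: h; exact: nbhs_dnbhs_neq.
  apply: (@squeeze_cvgr _ _ _ _ (fun=> 0) (fun h => n.+2`!%:R * `|h|)).
  - by apply: nearW => h; rewrite flat_ge0 flat_bound.
  - exact: cvg_cst.
  rewrite -[X in _ --> X](mulr0 (n.+2`!%:R : R)); apply: cvgM; first exact: cvg_cst.
  rewrite -[X in _ --> X](@normr0 _ R); apply: cvg_norm.
  by apply: cvg_within_filter; exact: cvg_id.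
constructor; first by apply/cvg_ex; exists 0.
exact: cvg_lim c.
Unshelve. all: by end_near.
Qed.

(** Restriction to a line, where the one-variable chain rule applies. *)
Lemma is_derive_line (f : P -> R) (x v : P) (d : R) :
  is_derive x v f d <-> is_derive (0 : R) 1 (fun s : R => f (s *: v + x)) d.
Proof.
have e : (fun h : R => h^-1 *: (((fun s : R => f (s *: v + x)) \o shift 0) (h *: (1 : R)) - f (0
  *: v + x))) =
   (fun h => h^-1 *: ((f \o shift x) (h *: v) - f x)).
  by apply/funext => h; rewrite /= addr0 [h *: (1 : R)]mulr1 scale0r add0r.
split=> -[h1 h2]; constructor.
- by rewrite /derivable e.
- by rewrite /derive e.
- by rewrite /derivable -e.
- by rewrite /derive -e.
Qed.

Lemma is_derive_flat_comp n (q : P -> R) (x v : P) : derivable q x v ->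
  is_derive x v (flat n \o q) ((flat n.+2 (q x) - n%:R * flat n.+1 (q x)) * 'D_v q x).
Proof.
move=> dq; apply/is_derive_line.
have /is_derive_line h : is_derive x v q ('D_v q x) by constructor.
have e : q (0 *: v + x) = q x by rewrite scale0r add0r.
have h' := is_derive_flat n (q x).
by rewrite -e in h' *; exact: (is_derive1_comp h' h).
Qed.

Lemma continuous_flat n : continuous (flat n).
Proof.
move=> t; apply: differentiable_continuous; apply/derivable1_diffP.
by case: (is_derive_flat n t).
Qed.

(** The derivative brings in [flat n.+1] and [flat n.+2], so the induction on the order of
    differentiability is over all [n] simultaneously. *)
Lemma smooth_flat n (q : P -> R) : smooth q -> smooth (flat n \o q).
Proof.
move=> sq m; elim: m n => [|m IH] n.
  by split=> // x; apply: continuous_comp; [exact: smooth_continuous|exact: continuous_flat].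
split=> [x|i].
  by apply: continuous_comp; [exact: smooth_continuous|exact: continuous_flat].
have h x := is_derive_flat_comp n (@smooth_derivable _ q i x sq).
split=> [x|]; first by case: (h x).
rewrite (_ : 'D_(u i) _ = fun x => ((flat n.+2 \o q) x - n%:R * (flat n.+1 \o q) x) * 'D_(u i) q x).
  apply: CkM; last exact: (smooth_derive i sq).
  apply: CkD; first exact: IH.
  rewrite (_ : (fun x => - _) = fun x => - n%:R * (flat n.+1 \o q) x).
    by apply: CkM; [exact: Ck_cst|exact: IH].
  by apply/funext => x; rewrite mulNr.
by apply/funext => x; case: (h x).
Qed.

Lemma affine_smooth (a : P) (c : R) : smooth (fun x => dot3 a x + c).
Proof.
have dl x v : is_derive x v (fun x => dot3 a x + c) (dot3 a v).
  apply/is_derive_line; rewrite (_ : (fun s => _) = fun s : R => s * dot3 a v + (dot3 a x +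
    c)); last first.
    by apply/funext => s; rewrite /dot3 /= /GRing.scale /=; ring.
  have h := is_deriveD (is_deriveM (is_derive_id (0 : R) (1 : R)) (is_derive_cst (dot3 a v) _ _))
    (is_derive_cst (dot3 a x + c) _ _).
  apply: (is_derive_eq h).
  by rewrite /GRing.scale /= mulr0 addr0 mulr1 add0r.
have cl : continuous (fun x : P => dot3 a x + c).
  move=> x; apply: cvgD; last exact: cvg_cst.
  have d1 : y.1 @[y --> x] --> x.1 by exact: cvg_fst.
  have d2 : y.2 @[y --> x] --> x.2 by exact: cvg_snd.
  have d3 : y.1.1 @[y --> x] --> x.1.1 by apply: cvg_comp d1 _; exact: cvg_fst.
  have d4 : y.1.2 @[y --> x] --> x.1.2 by apply: cvg_comp d1 _; exact: cvg_snd.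
  by apply: cvgD; [apply: cvgD|]; (apply: cvgM; first exact: cvg_cst).
case=> [|m]; first by split.
split=> // i; split=> [x|]; first by case: (dl x (u i)).
rewrite (_ : 'D_(u i) _ = fun=> dot3 a (u i)); first exact: Ck_cst.
by apply/funext => x; case: (dl x (u i)).
Qed.

Definition nsq (x : P) : R := x.1.1 ^+ 2 + x.1.2 ^+ 2 + x.2 ^+ 2.

Lemma nsqE x : nsq x = dot3 x x. Proof. by rewrite /nsq !expr2. Qed.

Lemma nsq_ge0 x : 0 <= nsq x. Proof. by rewrite !addr_ge0// sqr_ge0. Qed.

Lemma smooth_nsq (p : P) : smooth (fun x => nsq (x - p)).
Proof.
have c i := affine_smooth (u i) (- dot3 (u i) p).
rewrite (_ : (fun x => _) = fun x => (dot3 (u 0) x + - dot3 (u 0) p) * (dot3 (u 0) x +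
  - dot3 (u 0) p) +
  (dot3 (u 1) x + - dot3 (u 1) p) * (dot3 (u 1) x + - dot3 (u 1) p) +
  (dot3 (u (1 + 1)) x + - dot3 (u (1 + 1)) p) * (dot3 (u (1 + 1)) x + - dot3 (u (1 + 1)) p)).
  by apply: smoothD; [apply: smoothD|]; apply: smoothM.
by apply/funext => x; rewrite /nsq /dot3 /=; ring.
Qed.

Lemma compact_nsq (p : P) (r : R) : compact [set x | nsq (x - p) <= r].
Proof.
have cN : continuous (fun x : P => nsq (x - p)) := smooth_continuous (smooth_nsq p).
pose s := `|r| + 1 + norm1 p.
have c1 : compact (cube s : set P).
  by apply: compact_setX; [apply: compact_setX|]; exact: segment_compact.
apply: (subclosed_compact _ c1).
  apply: (@preimage_closed _ _ (fun x : P => nsq (x - p)) [set y | y <= r]) => [x _|].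
    exact: cN.
  exact: closed_le.
move=> x /= h; apply/cubeE; move: h; rewrite /nsq /s /norm1.
case: x p {cN s c1} => [[x y] z] [[a b] c] /= h.
have k (w d : R) : (w - d) ^+ 2 <= r -> `|w| <= `|r| + 1 + `|d|.
  move=> h1; have h2 : `|w - d| <= `|r| + 1.
    have [l|l] := leP `|w - d| 1; first by rewrite (le_trans l)// lerDr.
    have : `|w - d| <= (w - d) ^+ 2.
      by rewrite -[_ ^+ 2]real_normK ?num_real// expr2 ler_peMr// ltW.
    by move=> h2; have := ler_norm r; lra.
  by have := ler_normD (w - d) d; rewrite subrK; lra.
have [h0 h1 h2] : [/\ (x - a) ^+ 2 <= r, (y - b) ^+ 2 <= r & (z - c) ^+ 2 <= r].
  by have := sqr_ge0 (x - a); have := sqr_ge0 (y - b); have := sqr_ge0 (z - c); split; lra.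
have := k _ _ h0; have := k _ _ h1; have := k _ _ h2.
have := normr_ge0 a; have := normr_ge0 b; have := normr_ge0 c.
by split; lra.
Qed.

(** With the value 2 at [p], the open set where [1 < eta] contains [p]; these are the sets of the
    finite cover in [patches]. *)
Lemma bump_exists (p : P) (r : R) : 0 < r -> exists eta : P -> R,
  [/\ smooth eta, forall x, 0 <= eta x, eta p = 2 &
      forall x, eta x != 0 -> nsq (x - p) <= r].
Proof.
move=> r0; have f0 : 0 < flat 0 r by rewrite /flat r0 expr0 mul1r expR_gt0.
exists (fun x => 2 / flat 0 r * (flat 0 \o (fun y => r - nsq (y - p))) x); split.
- apply: smoothZ; apply: smooth_flat; apply: smoothB; first exact: smooth_cst.
  exact: smooth_nsq.
- by move=> x; rewrite mulr_ge0 ?flat_ge0// divr_ge0// ltW.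
- by rewrite /= subrr nsqE /dot3 /= !mul0r !addr0 subr0 divfK// gt_eqF.
move=> x; apply: contraR; rewrite -ltNge => h.
have l : r - nsq (x - p) <= 0 by rewrite subr_le0 ltW.
by rewrite /= (flat_le0 0 l) mulr0.
Qed.

End bumps.

(** * Entering directions and a finite cover of the closure *)

Section patches.
Variable R : realType.
Local Notation P := (R3 R).
Local Notation u := (unitv R).

Lemma sum3 (V : nmodType) (F : 'I_3 -> V) : \sum_i F i = F 0 + F 1 + F (1 + 1).
Proof.
rewrite 3!big_ord_recl big_ord0 addr0 addrA.
by congr (_ + _ + _); congr F; exact/val_inj.
Qed.

Lemma dot3C (x y : P) : dot3 x y = dot3 y x.
Proof. by rewrite /dot3; congr (_ + _ + _); exact: mulrC. Qed.

Lemma dot3_lin (a : P) (c : R) (x y : P) : dot3 a (c *: x + y) = c * dot3 a x + dot3 a y.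
Proof. by rewrite /dot3 /= /GRing.scale /=; ring. Qed.

Lemma dot3D (a x y : P) : dot3 a (x + y) = dot3 a x + dot3 a y.
Proof. by rewrite -[x]scale1r dot3_lin mul1r scale1r. Qed.

Lemma dot3Z (a : P) (c : R) (x : P) : dot3 a (c *: x) = c * dot3 a x.
Proof. by rewrite /dot3 /= /GRing.scale /=; ring. Qed.

Lemma dot3_sum (a : P) (c : 'I_3 -> R) (e : 'I_3 -> P) :
  dot3 a (\sum_i c i *: e i) = \sum_i c i * dot3 a (e i).
Proof. by rewrite !sum3 !dot3D !dot3Z. Qed.

Lemma nsq_frame (e : 'I_3 -> P) (y : 'I_3 -> R) : orthonormal3 e ->
  nsq (\sum_i y i *: e i) = \sum_i y i ^+ 2.
Proof.
move=> he; rewrite nsqE dot3_sum; apply: eq_bigr => i _; rewrite dot3C dot3_sum (bigD1 i)//=.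
rewrite he eqxx mulr1 big1 ?addr0 ?expr2// => j ji; rewrite he eq_sym (negbTE ji) mulr0 //.
Qed.

(** Orthonormality is [E *m E^T = 1]; for a square matrix it implies [E^T *m E = 1], which is the
    expansion. *)
Lemma frame_expand (e : 'I_3 -> P) (x : P) : orthonormal3 e ->
  x = \sum_i dot3 (e i) x *: e i.
Proof.
move=> he; pose E : 'M[R]_3 := \matrix_(i, j) dot3 (u j) (e i).
pose X : 'cV[R]_3 := \col_j dot3 (u j) x.
have dE (a b : P) : dot3 a b = \sum_j dot3 (u j) a * dot3 (u j) b.
  by rewrite sum3 /dot3 /unitv /=; ring.
have h : E *m E^T = 1%:M.
  apply/matrixP => i j; rewrite !mxE; under eq_bigr => k _ do rewrite !mxE.
  by rewrite -dE he.
have h' : E^T *m (E *m X) = X by rewrite mulmxA (mulmx1C h) mul1mx.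
have key j : dot3 (u j) x = dot3 (u j) (\sum_i dot3 (e i) x *: e i).
  have /matrixP/(_ j 0) := h'; rewrite !mxE => <-; rewrite dot3_sum; apply: eq_bigr => i _.
  rewrite !mxE mulrC; congr (_ * _); rewrite dE; apply: eq_bigr => k _.
  by rewrite !mxE.
move: (\sum_i _) key => z key.
have := key 0; have := key 1; have := key (1 + 1); rewrite /dot3 /unitv /=.
rewrite !mul0r !mul1r !add0r !addr0.
by case: x z {key X h'} => [[x y] z] [[x' y'] z'] /= -> -> ->.
Qed.

Lemma nsq_coord (x : P) (r : R) : 0 <= r -> nsq x <= r ^+ 2 ->
  [/\ `|x.1.1| <= r, `|x.1.2| <= r & `|x.2| <= r].
Proof.
move=> r0; rewrite /nsq => h.
have k (z : R) : z ^+ 2 <= r ^+ 2 -> `|z| <= r.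
  by rewrite -(real_normK (num_real z)) ler_pXn2r// nnegrE.
have := sqr_ge0 x.1.1; have := sqr_ge0 x.1.2; have := sqr_ge0 x.2.
by split; apply: k; lra.
Qed.

Lemma nbhs_nsq (p : P) (A : set P) : nbhs p A ->
  exists2 r : R, 0 < r & forall x, nsq (x - p) <= r ^+ 2 -> A x.
Proof.
move=> /nbhs_ballP[e /= e0 eA]; exists (e / 2); first by rewrite divr_gt0.
move=> x /nsq_coord h; apply: eA.
have [h1 h2 h3] := h (divr_ge0 (ltW e0) (ler0n _ _)).
have l : e / 2 < e by lra.
case: x p {h} h1 h2 h3 => [[x y] z] [[a b] c] /= h1 h2 h3.
by split; [split|]; rewrite /ball/= distrC (le_lt_trans _ l).
Qed.

(** At an interior point any vector longer than the surrounding cube works. At a boundary point [v]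
    points upwards in the local epigraph: adding a multiple of it keeps a point above the graph,
    while a Lipschitz bound shows that subtracting all of it ends below. *)
Lemma entering_direction (Om : set P) (p : P) (r : R) : open Om -> Om `<=` cube r ->
  lipschitz_boundary Om -> closure Om p ->
  exists v r, 0 < r /\ forall x, nsq (x - p) <= r ->
    ~ Om (x - v) /\ forall s, 0 <= s <= 1 -> Om (x - s *: v) -> Om x.
Proof.
move=> oOm Or lip cp; have [ip|nip] := pselect ((interior Om) p).
  have [rho rho0 hr] := nbhs_nsq ip.
  exists ((2 * `|r| + 1) *: u 0), (rho ^+ 2); split; first by rewrite exprn_gt0.
  move=> x /hr Ox; split=> // /Or/cubeE[+ _ _] => /=.
  have /cubeE[+ _ _] := Or _ Ox.
  rewrite /GRing.scale /= mulr1 !ler_norml => /andP[h1 h2] /andP[h3 h4].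
  by have := ler_norm r; lra.
have [e [rad [gam [he rad0 hgam hOm]]]] := lip p (conj cp nip).
have nOp : ~ Om p by move=> Op; apply: nip; rewrite /interior; exact: open_nbhs_nbhs.
have [L L0 hL] := pinfty_ex_gt0 hgam.
(* A boundary point is not in the open set [Om], so the origin of the chart is not strictly above
   the graph. *)
have g0 : 0 <= gam (0, 0).
  rewrite leNgt; apply/negP => g0; apply: nOp.
  have h0 : \sum_(i < 3) (0 : R) ^+ 2 < rad ^+ 2 by rewrite sum3 expr0n !addr0 exprn_gt0.
  by have := (hOm (fun=> 0) h0).2 g0; rewrite !sum3 !scale0r !addr0.
(* The points [x - s v] have frame coordinates of norm at most [rho + h = (2 + L) rho], which stays
   below [rad]. *)
pose rho := rad / (4 + L); have r0 : 0 < rho by rewrite divr_gt0// addr_gt0.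
have radE : rad = (4 + L) * rho by rewrite mulrC divfK// gt_eqF// addr_gt0.
(* On the small ball the height is at most [rho] and [gam] at least [- L rho]; descending by [h]
   therefore reaches the graph or passes below it. *)
pose h := (1 + L) * rho; have h0 : 0 < h by rewrite mulr_gt0// addr_gt0.
exists (h *: e (1 + 1)), (rho ^+ 2); split; first by rewrite exprn_gt0.
move=> x hx; pose y i := dot3 (e i) (x - p).
have xE : x = p + \sum_i y i *: e i by rewrite -frame_expand// addrC subrK.
have ny : \sum_i y i ^+ 2 <= rho ^+ 2 by rewrite -(nsq_frame y he) -(frame_expand (x - p) he).
pose ys s i := y i - (i == 1 + 1)%:R * (s * h).
have xs s : x - s *: (h *: e (1 + 1)) = p + \sum_i ys s i *: e i.
  rewrite {1}xE -addrA; congr (_ + _); rewrite !sum3 /ys /= !mul0r !subr0 mul1r scalerBl.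
  by rewrite addrA scalerA.
have yb i : `|y i| <= rho.
  have : y i ^+ 2 <= rho ^+ 2.
    by rewrite (le_trans _ ny)// (bigD1 i)//= lerDl sumr_ge0// => j _; exact: sqr_ge0.
  by rewrite -(real_normK (num_real (y i))) ler_pXn2r// nnegrE// ltW.
have nys s : 0 <= s <= 1 -> \sum_i ys s i ^+ 2 < rad ^+ 2.
  move=> /andP[s0 s1]; apply: (@le_lt_trans _ _ ((rho + h) ^+ 2)).
    rewrite sum3 /ys /= !mul0r !subr0 mul1r.
    have sh : 0 <= s * h <= h by rewrite mulr_ge0 ?(ltW h0)//= ler_piMl// ltW.
    move: ny (yb (1 + 1)); rewrite sum3; move: (y 0) (y 1) (y (1 + 1)) (s * h) sh => a b c t.
    move=> /andP[t0 t1] n1 n2.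
    have n3 : - (c * t) <= rho * h.
      rewrite -mulNr (le_trans (ler_wpM2r t0 (_ : - c <= rho)))//; last by rewrite ler_pM2l.
      by move: n2; rewrite ler_norml; lra.
    have n4 : t ^+ 2 <= h ^+ 2 by rewrite ler_pXn2r// nnegrE// ltW.
    have -> : a ^+ 2 + b ^+ 2 + (c - t) ^+ 2 = (a ^+ 2 + b ^+ 2 + c ^+ 2) + 2 * - (c * t) +
      t ^+ 2 by ring.
    have -> : (rho + h) ^+ 2 = rho ^+ 2 + 2 * (rho * h) + h ^+ 2 by ring.
    by lra.
  rewrite ltr_pXn2r// ?nnegrE ?addr_ge0// ?ltW// radE /h.
  have -> : rho + (1 + L) * rho = (2 + L) * rho by ring.
  by rewrite ltr_pM2r//; lra.
split.
  rewrite -[h *: _]scale1r xs => /(hOm _ (nys 1 _)).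
  rewrite lexx ler01 => /(_ isT); rewrite /ys /= !mul0r !subr0 !mul1r => hg.
  have := hL ((y 0, y 1), (0, 0)) (conj I I) => /=.
  have ny01 : `|(y 0, y 1) - (0, 0)| <= rho.
    by rewrite prod_normE /= !subr0 ge_max !yb.
  have := yb (1 + 1); rewrite ler_norml => /andP[_ y2] hh.
  have {}hh := le_trans hh (ler_wpM2l (ltW L0) ny01); move: hh; rewrite ler_norml => /andP[hh _].
  by move: hg; rewrite /h mulrDl mul1r; lra.
move=> s s01; rewrite xs => /(hOm _ (nys s s01)); rewrite /ys /= !mul0r !subr0 mul1r => hg.
rewrite xE; apply/(hOm y).
  rewrite (le_lt_trans ny)// ltr_pXn2r// ?nnegrE ?ltW// radE -[X in X < _]mul1r ltr_pM2r//; lra.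
rewrite (lt_le_trans hg)// lerBlDr lerDl mulr_ge0// ?(ltW h0)//.
by case/andP: s01.
Qed.

Lemma compact_finite_cover (A : set P) : compact A -> cover_compact A.
Proof.
move=> cA.
pose T : ptopologicalType := HB.pack_for ptopologicalType (R3 R) (isPointed.Build (R3 R) 0).
by have -> : @cover_compact (R3 R) A = @cover_compact T A by []; rewrite -(@compact_cover T).
Qed.

(** The bumps are not normalised to sum 1: the lower bound is what makes the scalar product of a
    field with its product by the sum dominate the squared norm of the field. *)
Lemma patches (Om : set P) : open Om -> bounded_set Om -> lipschitz_boundary Om ->
  exists (J : seq P) (eta : P -> P -> R) (v : P -> P) (Kc : P -> set P),
  [/\ forall j, smooth (eta j) /\ compact (Kc j),
      forall j x, 0 <= eta j x /\ (eta j x != 0 -> Kc j x),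
      forall j x, Kc j x -> ~ Om (x - v j) /\ forall s, 0 <= s <= 1 -> Om (x - s *: v j) -> Om x &
      forall x, Om x -> 1 <= \sum_(j <- J) eta j x].
Proof.
move=> oOm [M [_ hM]] lip.
pose r := `|M| + 1.
have Or : Om `<=` cube r.
  move=> x Ox; have /hM/(_ _ Ox) : M < r by rewrite (le_lt_trans (ler_norm _))// ltrDl.
  rewrite /= prod_normE ge_max prod_normE ge_max => /andP[/andP[h1 h2] h3].
  by apply/cubeE.
have c1 : compact (cube r : set P).
  by apply: compact_setX; [apply: compact_setX|]; exact: segment_compact.
have cOm : compact (closure Om).
  apply: (subclosed_compact _ c1); first exact: closed_closure.
  rewrite (closure_id (cube r)).1; last exact: compact_closedP.
  exact: closure_subset.
have /choice[F hF] (p : P) : exists F : (P -> R) * P * R,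
   [/\ smooth F.1.1, forall x, 0 <= F.1.1 x, closure Om p -> 1 < F.1.1 p,
     forall x, F.1.1 x != 0 -> nsq (x - p) <= F.2 &
     forall x, nsq (x - p) <= F.2 -> ~ Om (x - F.1.2) /\
       forall s, 0 <= s <= 1 -> Om (x - s *: F.1.2) -> Om x].
  have [cp|ncp] := pselect (closure Om p).
    have [v [rho [r0 hv]]] := entering_direction oOm Or lip cp.
    have [eta [se e0 ep he]] := bump_exists p r0.
    by exists (eta, v, rho); split => //= _; rewrite ep; lra.
  (* Off the closure of [Om] a zero bump and an empty ball make all conditions vacuous. *)
  exists (fun=> 0, 0, -1); split => //=; first exact: smooth_cst.
    by move=> x; rewrite eqxx.
  by move=> x /(le_trans (nsq_ge0 _)); rewrite oppr_ge0 ler10.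
have [] := compact_finite_cover cOm (I := P) (D := closure Om) (f := fun p =>
  [set x | 1 < (F p).1.1 x]).
- move=> p _; have [sF _ _ _ _] := hF p.
  apply: (@open_comp _ _ (F p).1.1 [set y | 1 < y]); last exact: open_gt.
  by move=> x _; exact: smooth_continuous.
- by move=> p cp; exists p => //=; have [_ _ h _ _] := hF p; exact: h.
move=> J JO Jc; exists (finmap.enum_fset J), (fun j => (F j).1.1), (fun j => (F j).1.2),
  (fun j => [set x | nsq (x - j) <= (F j).2]); split.
- by move=> j; split; [case: (hF j)|exact: compact_nsq].
- by move=> j x; have [_ h1 _ h2 _] := hF j; split => //; exact: h2.
- by move=> j x; have [_ _ _ _ h] := hF j; exact: h.
move=> x Ox; have [j /= jJ hj] := Jc x (subset_closure Ox).
rewrite (big_rem j)//= (le_trans (ltW hj))// lerDl sumr_ge0// => i _.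
by have [_ h1 _ _ _] := hF i.
Qed.

End patches.

(** * Gradients close to test fields *)

Section test_field_gradients.
Variable R : realType.
Local Notation P := (R3 R).
Local Notation u := (unitv R).
Local Notation D i f := ('D_(u i) f).
Local Notation field := ('I_3 -> P -> R).
Implicit Types (w : field) (v : P).

Definition curlR w : field := fun a x => D (a + 1) (w (a + 2)) x - D (a + 2) (w (a + 1)) x.

Definition N2 w : R := \sum_a I3 (fun x => w a x ^+ 2).

Definition coordv (v : P) : 'I_3 -> R := fun i => dot3 (u i) v.

Definition vdot v w : P -> R := fun x => v.1.1 * w 0 x + v.1.2 * w 1 x + v.2 * w (1 + 1) x.

Definition vcross v (c : field) : field := fun a x =>
  coordv v (a + 1) * c (a + 2) x - coordv v (a + 2) * c (a + 1) x.

Lemma coordv0 v : coordv v 0 = v.1.1.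
Proof. by rewrite /coordv /dot3 /= !mul0r mul1r !addr0. Qed.
Lemma coordv1 v : coordv v 1 = v.1.2.
Proof. by rewrite /coordv /dot3 /= !mul0r mul1r add0r addr0. Qed.
Lemma coordv2 v : coordv v (1 + 1) = v.2.
Proof. by rewrite /coordv /dot3 /= !mul0r mul1r !add0r. Qed.

Lemma ord3P (Q : 'I_3 -> Prop) : Q 0 -> Q 1 -> Q (1 + 1) -> forall i, Q i.
Proof.
move=> q0 q1 q2 [[|[|[|//]]] h].
- by rewrite (_ : Ordinal h = 0)//; exact/val_inj.
- by rewrite (_ : Ordinal h = 1)//; exact/val_inj.
- by rewrite (_ : Ordinal h = 1 + 1)//; exact/val_inj.
Qed.

Lemma ord3_calc : [/\ (0 + 1 : 'I_3) = 1, (0 + 2 : 'I_3) = 1 + 1, (1 + 2 : 'I_3) = 0,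
  (1 + 1 + 1 : 'I_3) = 0 & (1 + 1 + 2 : 'I_3) = 1].
Proof. by split; exact/val_inj. Qed.

Lemma N2_ge0 w : 0 <= N2 w.
Proof. by apply: sumr_ge0 => a _; apply: I3_ge0 => x; exact: sqr_ge0. Qed.

Lemma Cc_vdot A v w : (forall i, Cc A (w i)) -> Cc A (vdot v w).
Proof. by move=> hw; apply: CcD; [apply: CcD|]; exact: CcZ. Qed.

Lemma Cc_curlR A w : (forall i, Cc A (w i)) -> forall i, Cc A (curlR w i).
Proof. by move=> hw i; apply: CcB; exact: Cc_derive. Qed.

Lemma Cc_vcross A v w : (forall i, Cc A (w i)) -> forall i, Cc A (vcross v w i).
Proof. by move=> hw i; apply: CcB; exact: CcZ. Qed.

(* grad (v . w) = (v . grad) w + v x curl w for constant v *)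
Lemma derive_vdot A v w a : (forall i, Cc A (w i)) ->
  D a (vdot v w) = fun x => dirD v (w a) x + vcross v (curlR w) a x.
Proof.
move=> hw; have sw i : smooth (w i) := Cc_smooth (hw i).
rewrite /vdot derive_fD; last 2 first.
- by apply: smoothD; apply: smoothZ.
- exact: smoothZ.
apply/funext => x; rewrite (congr1 (@^~ x) (derive_fZ v.2 a (sw (1 + 1)))).
rewrite (congr1 (@^~ x) (derive_fD a (smoothZ v.1.1 (sw 0)) (smoothZ v.1.2 (sw 1)))).
rewrite (congr1 (@^~ x) (derive_fZ v.1.1 a (sw 0))) (congr1 (@^~ x) (derive_fZ v.1.2 a (sw 1))).
rewrite /vcross /curlR /dirD.
have [e1 e2 e3 e4 e5] := ord3_calc.
move: a; apply: ord3P; rewrite ?e1 ?e2 ?e3 ?e4 ?e5 ?coordv0 ?coordv1 ?coordv2 ?e1 ?e2 ?e3 ?e4 ?e5.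
- move: ('D_(u 0) (w 0) x) ('D_(u 0) (w 1) x) ('D_(u 0) (w (1 +
  1)) x) ('D_(u 1) (w 0) x) ('D_(u (1 + 1)) (w 0) x).
  by move=> *; ring.
- move: ('D_(u 1) (w 1) x) ('D_(u 1) (w 0) x) ('D_(u 1) (w (1 +
  1)) x) ('D_(u 0) (w 1) x) ('D_(u (1 + 1)) (w 1) x).
  by move=> *; ring.
move: ('D_(u (1 + 1)) (w (1 + 1)) x) ('D_(u (1 + 1)) (w 0) x) ('D_(u (1 +
  1)) (w 1) x) ('D_(u 0) (w (1 + 1)) x) ('D_(u 1) (w (1 + 1)) x).
by move=> *; ring.
Qed.

Lemma sqr2_le (p q : R) : (p + q) ^+ 2 <= 2 * (p ^+ 2 + q ^+ 2).
Proof.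
by rewrite -subr_ge0 (_ : _ - _ = (p - q) ^+ 2) ?sqr_ge0//; ring.
Qed.

Lemma BM_field A w : (forall i, Cc A (w i)) -> forall i, BM (fun x => w i x ^+ 2).
Proof. by move=> hw i; apply: BMX2; exact: Cc_BM (hw i). Qed.

Lemma I3_vdot A v w : (forall i, Cc A (w i)) ->
  I3 (fun x => vdot v w x ^+ 2) <= norm1 v ^+ 2 * N2 w.
Proof.
move=> hw; have b := BM_field hw; rewrite /N2 -I3_sum// -I3Z; last exact: BM_sum.
apply: le_I3 => [||x]; last exact: (lin3_sqr v (fun i => w i x)).
  by apply: BMX2; apply: Cc_BM; exact: Cc_vdot hw.
by apply: BMZ; exact: BM_sum.
Qed.

Lemma coordv_le v i : `|coordv v i| <= norm1 v.
Proof.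
move: i; apply: ord3P; rewrite ?coordv0 ?coordv1 ?coordv2 /norm1; case: v => [[a b] c] /=;
have := normr_ge0 a; have := normr_ge0 b; have := normr_ge0 c; lra.
Qed.

Lemma I3_vcross A v w a : (forall i, Cc A (w i)) ->
  I3 (fun x => vcross v w a x ^+ 2) <= 4 * norm1 v ^+ 2 * N2 w.
Proof.
move=> hw; have b := BM_field hw; rewrite /N2 -I3_sum// -I3Z; last exact: BM_sum.
apply: le_I3 => [||x].
- by apply: BMX2; apply: Cc_BM; exact: Cc_vcross hw a.
- by apply: BMZ; exact: BM_sum.
have hc i : w i x ^+ 2 <= \sum_j w j x ^+ 2.
  by rewrite (bigD1 i)//= lerDl sumr_ge0// => j _; exact: sqr_ge0.
have hv i : coordv v i ^+ 2 <= norm1 v ^+ 2.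
  by rewrite -[X in X <= _]real_normK ?num_real// ler_pXn2r ?nnegrE ?norm1_ge0// coordv_le.
have k i j : (coordv v i * w j x) ^+ 2 <= norm1 v ^+ 2 * \sum_j w j x ^+ 2.
  by rewrite exprMn ler_pM ?sqr_ge0.
rewrite (le_trans (sqr2_le _ _))// sqrrN.
have := k (a + 1) (a + 2); have := k (a + 2) (a + 1).
rewrite -mulrA; move: (norm1 v ^+ 2 * _) => z h1 h2; lra.
Qed.

Lemma I3_mul_avg k v (h f : P -> R) (M : R) : measurable_fun setT h -> (forall x,
  `|h x| <= M) -> BM f ->
  I3 (fun x => (h x * avg k v f x) ^+ 2) <= M ^+ 2 * I3 (fun x => f x ^+ 2).
Proof.
move=> mh hM hf; have bA := BM_avg k v hf.
have M0 : 0 <= M := le_trans (normr_ge0 _) (hM 0).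
apply: (@le_trans _ _ (M ^+ 2 * I3 (fun x => avg k v f x ^+ 2))); last first.
  by rewrite ler_wpM2l ?sqr_ge0// I3_avg_sqr.
rewrite -I3Z; last exact: BMX2.
apply: le_I3 => [||x].
- by apply: BMX2; apply: BMMl => //; exists M.
- by apply: BMZ; exact: BMX2.
rewrite exprMn ler_wpM2r ?sqr_ge0// -[X in X <= _]real_normK ?num_real//.
by rewrite ler_pXn2r// nnegrE.
Qed.

(** The average of [g] lives on the compact union of the segments from the support of [g] in
    direction [v]. Within [Kc] such segments end in [A], so the intersection with [Kc] is a compact
    subset of [A]. *)
Lemma Cc_patch (A Kc : set P) v (h g : P -> R) k : compact Kc -> smooth h ->
  (forall x, h x != 0 -> Kc x) ->
  (forall x, Kc x -> forall s, 0 <= s <= 1 -> A (x - s *: v) -> A x) -> Cc A g ->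
  Cc A (fun x => h x * avg k v g x).
Proof.
move=> cK sh hK KA [sg [Kg cKg [gA hg]]]; split; first by apply: smoothM => //; exact: smooth_avg.
pose T (p : P * R) : P := p.1 + p.2 *: v.
have cT : continuous T.
  move=> p; apply: cvgD; first exact: cvg_fst.
  by apply: cvgZ; [exact: cvg_snd|exact: cvg_cst].
have cI : compact (T @` (Kg `*` `[0, 1])).
  apply: continuous_compact; first exact: continuous_subspaceT.
  by apply: compact_setX => //; exact: segment_compact.
exists (Kc `&` T @` (Kg `*` `[0, 1])).
  by apply: compact_closedI => //; exact: compact_closedP.
split=> [x [Kx [[y s] /= [Ky +] e]]|x].
  rewrite in_itv/= => s01; apply: (KA x Kx s s01); rewrite -e /T/= addrK; exact: gA.
rewrite mulf_eq0 negb_or => /andP[/hK Kx /avg_support[s s01 /hg Ks]]; split=> //.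
by exists (x - s *: v, s); rewrite /= ?in_itv//= /T/= subrK.
Qed.

(** Cauchy-Schwarz on a cell, read off from the nonnegative integral of the squared distance between
    [f] and its mean [I / m]. *)
Lemma I3_cell_cs a N t f : 0 < a -> (0 < N)%N -> BM f ->
  I3 (fun x => \1_(@cell R a N t) x * f x) ^+ 2 <= mesh a N ^+ 3 * I3 (fun x => f x ^+ 2).
Proof.
move=> a0 N0 hf; set m := mesh a N ^+ 3.
have m0 : 0 < m by rewrite exprn_gt0// mesh_gt0.
set I := I3 (fun x => _ * f x).
have hc := @BM_cell R a N t.
have := @I3_ge0 R (fun y => \1_(@cell R a N t) y * (I / m - f y) ^+ 2).
rewrite I3_cell_diff// -/I -/m => /(_ (fun x => mulr_ge0 _ (sqr_ge0 _))) h.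
have {}h : I ^+ 2 / m <= I3 (fun y => \1_(@cell R a N t) y * f y ^+ 2).
  rewrite -subr_ge0; apply: (le_trans (h _)); first by move=> x; rewrite indicE.
  by rewrite le_eqVlt; apply/orP; left; apply/eqP; field; rewrite gt_eqF.
rewrite mulrC -ler_pdivrMr// (le_trans h)//; apply: le_I3.
- by apply: BMM => //; exact: BMX2.
- exact: BMX2.
- move=> x; rewrite indicE; case: (_ \in _); rewrite ?mul1r// mul0r sqr_ge0 //.
Qed.

(** Adding the geometric tail makes the sequence nonincreasing, and it stays bounded below. *)
Lemma cauchy_pow2 (x : nat -> R) (C : R) : 0 <= C ->
  (forall k, `|x k.+1 - x k| <= C * 2^-1 ^+ k.+1) -> cvgn x.
Proof.
move=> C0 hx; pose y k := x k + C * 2^-1 ^+ k.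
have yd : nonincreasing_seq y.
  apply/nonincreasing_seqP => k; rewrite /y; have := hx k.
  rewrite exprS ler_norml => /andP[_]; set e := 2^-1 ^+ k.
  have -> : C * (2^-1 * e) = C * e / 2 by rewrite mulrCA mulrC.
  by move: (C * e) => z; lra.
have e0 k : 0 <= C * 2^-1 ^+ k by rewrite mulr_ge0// exprn_ge0// invr_ge0.
have yl : has_lbound (range y).
  exists (x 0%N - C) => _ [k _ <-].
  have : x 0%N - C + C * 2^-1 ^+ k <= x k.
    elim: k => [|k IH]; first by rewrite expr0 mulr1 subrK.
    have := hx k; rewrite exprS ler_norml => /andP[+ _]; move: IH.
    have -> : C * (2^-1 * 2^-1 ^+ k) = C * 2^-1 ^+ k / 2 by rewrite mulrCA mulrC.
    by have := e0 k; move: (C * _) => z; lra.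
  by rewrite /y; have := e0 k; move: (C * _) => z; lra.
have cy := nonincreasing_is_cvgn yd yl.
have ce : cvgn (fun k => C * 2^-1 ^+ k : R).
  apply: is_cvgM; first exact: is_cvg_cst.
  by apply/cvg_ex; exists 0; apply: cvg_expr; rewrite ger0_norm ?invr_ge0//; lra.
rewrite (_ : x = y \- (fun k => C * 2^-1 ^+ k)); first exact: is_cvgB.
by apply/funext => k; rewrite /y /= addrK.
Qed.

Lemma I3_avg_cvg A v (h g c : P -> R) : Cc A g -> smooth h -> BM h -> BM c ->
  cvgn (fun k => I3 (fun x => c x * (h x * avg k v g x))).
Proof.
move=> hg sh bh bc; have bg := Cc_BM hg.
have [L L0 hL] := Cc_lipschitz hg.
have [_ [M hM] _] := bh; have [_ [M' hM'] [r hr]] := bc.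
have M0 : 0 <= M := le_trans (normr_ge0 _) (hM 0).
have M0' : 0 <= M' := le_trans (normr_ge0 _) (hM' 0).
have n0 := norm1_ge0 v.
apply: (@cauchy_pow2 _ (M' * (M * (L * norm1 v)) * (2 * `|r|) ^+ 3)).
  by rewrite !mulr_ge0// exprn_ge0// mulr_ge0.
move=> k; have b i : BM (fun x => c x * (h x * avg i v g x)).
  by apply: BMM => //; apply: BMM => //; exact: BM_avg.
rewrite -I3B// mulrAC; apply: le_I3_cube => //.
- exact: BMB.
- move=> x; rewrite -mulrBr -mulrBr normrM normrM -!mulrA.
  apply: ler_pM => //; apply: ler_pM => //.
  by rewrite mulrA; exact: avg_cauchy.
move=> x hx; rewrite hr ?mul0r ?subr0// => hx'; apply: hx; apply: cube_mono hx'.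
exact: ler_norm.
Qed.

Lemma I3_sqrD (f g : P -> R) : BM f -> BM g ->
  I3 (fun x => (f x + g x) ^+ 2) <= 2 * I3 (fun x => f x ^+ 2) + 2 * I3 (fun x => g x ^+ 2).
Proof.
move=> bf bg; have bf2 := BMX2 bf; have bg2 := BMX2 bg.
rewrite -(I3Z 2 bf2) -(I3Z 2 bg2) -I3D; [|exact: BMZ|exact: BMZ].
apply: le_I3; [by apply: BMX2; exact: BMD|by apply: BMD; exact: BMZ|].
by move=> x; rewrite -mulrDr; exact: sqr2_le.
Qed.

(** By [derive_vdot] the average of the derivative consists of averages of [(v . grad) w_a] and of
    [v x curl w]. The former is [w_a x - w_a (x - v)] up to a Taylor error of order [2^-k], and
    [w_a (x - v) = 0] because [x - v] lies outside [A] wherever [h] does not vanish. The latter is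
    paid for by the curl; [8] is [2] from splitting the square times [4] from the cross product. *)
Lemma avg_derive_defect (A Kc : set P) v (h : P -> R) (M : R) w : BM h -> (forall x, `|h x| <= M) ->
  (forall x, h x != 0 -> Kc x) -> (forall x, Kc x -> ~ A (x - v)) -> (forall i, Cc A (w i)) ->
  exists2 E, 0 <= E & forall k a,
    I3 (fun x => (h x * avg k v (D a (vdot v w)) x - h x * w a x) ^+ 2) <=
    8 * M ^+ 2 * norm1 v ^+ 2 * N2 (curlR w) + E * 2^-1 ^+ k.
Proof.
move=> bh hM hK KA hw; have M0 : 0 <= M := le_trans (normr_ge0 _) (hM 0).
have n0 := norm1_ge0 v.
have /choice[B hB] a : exists B, 0 <= B /\
    forall x z, `|w a (z + x) - w a x - dirD z (w a) x| <= B * norm1 z ^+ 2.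
  by have [B B0 hB] := Cc_taylor (hw a); exists B.
have [mh _ [r hr]] := bh.
pose F a := 2 * ((M * (B a * norm1 v ^+ 2)) ^+ 2 * (2 * `|r|) ^+ 3).
have F0 a : 0 <= F a by rewrite mulr_ge0// mulr_ge0 ?sqr_ge0// exprn_ge0// mulr_ge0.
exists (\sum_a F a); first by apply: sumr_ge0.
move=> k a; have bw := Cc_BM (hw a); have hc := Cc_vcross v (Cc_curlR hw) a.
pose e x := w a x - w a (x - v) - avg k v (dirD v (w a)) x.
have be : BM e.
  apply: BMB; last by apply: BM_avg; exact: Cc_BM (BM_dirD v (hw a)).
  by apply: BMB => //; exact: (BM_shift (- v) bw).
have eq x : h x * avg k v (D a (vdot v w)) x - h x * w a x =
    h x * avg k v (vcross v (curlR w) a) x - h x * e x.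
  have [->|/hK Kx] := eqVneq (h x) 0; first by rewrite !mul0r.
  have w0 : w a (x - v) = 0.
    apply/eqP; apply: contra_notT (KA x Kx); case: (hw a) => _ [K' _ [K'A hK']] h1.
    by apply: K'A; exact: hK'.
  rewrite (derive_vdot v a hw) avgD /e w0.
  by move: (avg k v _ x) (avg k v _ x) (w a x) (h x) => p q s t; ring.
rewrite (_ : (fun x => _) = (fun x => (h x * avg k v (vcross v (curlR w) a) x - h x * e x) ^+
  2)); last first.
  by apply/funext => x; rewrite eq.
have b1 : BM (fun x => h x * avg k v (vcross v (curlR w) a) x).
  by apply: BMM => //; apply: BM_avg; exact: Cc_BM hc.
have b2 : BM (fun x => h x * e x) by exact: BMM.
apply: (@le_trans _ _ (2 * I3 (fun x => (h x * avg k v (vcross v (curlR w) a) x) ^+ 2) +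
    2 * I3 (fun x => (h x * e x) ^+ 2))).
  have := I3_sqrD b1 (BMN b2).
  by rewrite (_ : (fun x => (- (h x * e x)) ^+ 2) = fun x => (h x * e x) ^+ 2)//;
    apply/funext => x; rewrite sqrrN.
apply: lerD.
  have -> : 8 * M ^+ 2 * norm1 v ^+ 2 * N2 (curlR w) = 2 * (M ^+ 2 * (4 * norm1 v ^+ 2 * N2
    (curlR w))) by ring.
  rewrite ler_pM2l// (le_trans (I3_mul_avg k v mh hM (Cc_BM hc)))// ler_wpM2l ?sqr_ge0//.
  exact: I3_vcross (Cc_curlR hw).
apply: (@le_trans _ _ (F a * 2^-1 ^+ k)); last first.
  rewrite ler_wpM2r ?exprn_ge0 ?invr_ge0// (bigD1 a)//= lerDl; exact: sumr_ge0.
rewrite /F -mulrA ler_pM2l// (le_trans (ler_norm _))// mulrAC.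
apply: le_I3_cube => //; first exact: BMX2.
  move=> x; rewrite normrX.
  apply: (@le_trans _ _ ((M * (B a * norm1 v ^+ 2 * 2^-1 ^+ k)) ^+ 2)).
    rewrite ler_pXn2r// ?nnegrE//.
      by rewrite normrM; apply: ler_pM => //; have [_ hBa] := hB a; exact: avg_taylor.
    by rewrite mulr_ge0// mulr_ge0 ?exprn_ge0 ?invr_ge0// mulr_ge0 ?sqr_ge0//; case: (hB a).
  rewrite mulrA exprMn ler_wpM2l ?sqr_ge0// expr2 ler_piMl ?exprn_ge0 ?invr_ge0//.
  by rewrite exprn_ile1 ?invr_ge0// invf_le1// ler1n.
move=> x hx; rewrite hr ?mul0r ?expr0n// => hx'; apply: hx; apply: cube_mono hx'.
exact: ler_norm.
Qed.

Lemma cvg_sum_seq (T : Type) (s : seq T) (f : T -> nat -> R) (l : T -> R) :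
  (forall t, f t @ \oo --> l t) -> (fun k => \sum_(t <- s) f t k) @ \oo --> \sum_(t <- s) l t.
Proof.
move=> h; elim: s => [|t s IH].
  by under eq_fun do rewrite big_nil; rewrite big_nil; exact: cvg_cst.
by under eq_fun do rewrite big_cons; rewrite big_cons; exact: cvgD.
Qed.

(** Bookkeeping for [patch_estimate]: [q] is the squared mesh, [p] the inverse volume of a cell, [r]
    and [y] the squares of [M] and of [norm1 v], and [z] the power [2^-k]. The constant is
    [432 = 3 * 2 * 72], from three components, a split square and Rellich's inequality. *)
Lemma patch_alg (e K q p r y C nw nc sl E E' z : R) :
  432 * K * q <= e -> 0 <= K -> 0 <= q -> 0 <= p -> 0 <= r -> 0 <= y -> 0 <= C ->
  0 <= nw -> 0 <= nc -> 0 <= sl ->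
  2 * (72 * q * (K * (nw + nc) + E * z) *+ 3 + p * sl) + 2 * (8 * r * y * nc + E' * z) *+ 3 <=
  e * nw + (3 * (144 * q * K + 16 * r * y) + 2 * p + C) * (nc + sl) + 3 * (144 * q * E +
    2 * E') * z.
Proof.
move=> h K0 q0 p0 r0 y0 C0 nw0 nc0 sl0; rewrite -subr_ge0.
have -> : e * nw + (3 * (144 * q * K + 16 * r * y) + 2 * p + C) * (nc + sl) +
  3 * (144 * q * E + 2 * E') * z -
  (2 * (72 * q * (K * (nw + nc) + E * z) *+ 3 + p * sl) + 2 * (8 * r * y * nc + E' * z) *+ 3) =
  (e - 432 * K * q) * nw + (2 * p + C) * nc + (432 * (q * K) + 48 * (r * y) + C) * sl by ring.
have h0 : 0 <= e - 432 * K * q by lra.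
have := mulr_ge0 h0 nw0; have := mulr_ge0 p0 nc0; have := mulr_ge0 C0 nc0; have := mulr_ge0 C0 sl0.
have := mulr_ge0 (mulr_ge0 q0 K0) sl0; have := mulr_ge0 (mulr_ge0 r0 y0) sl0.
have -> : (2 * p + C) * nc = 2 * (p * nc) + C * nc by ring.
have -> : (432 * (q * K) + 48 * (r * y) + C) * sl = 432 * (q * K * sl) + 48 * (r * y * sl) +
  C * sl by ring.
move: (q * K * sl) (r * y * sl) (C * sl) (C * nc) (p * nc) (_ * nw) => *; lra.
Qed.

Lemma patch_eps (e K q : R) : 0 < e -> 0 <= K -> 0 <= q -> q <= e / (432 * K + 1) ->
  432 * K * q <= e.
Proof.
move=> e0 K0 q0; rewrite ler_pdivlMr; last lra.
rewrite mulrDr mulr1 => h; rewrite mulrC; lra.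
Qed.

Section patch.
Variables (A Kc : set P) (v : P) (eta : P -> R) (M : R).
Hypotheses (cK : compact Kc) (se : smooth eta) (eK : forall x, eta x != 0 -> Kc x).
Hypothesis KA : forall x, Kc x -> ~ A (x - v) /\ forall s, 0 <= s <= 1 -> A (x - s *: v) -> A x.
Hypothesis hM : forall a b x, [/\ `|eta x| <= M, `|D a eta x| <= M & `|D b (D a eta) x| <= M].

Let eCc : Cc setT eta. Proof. by split => //; exists Kc. Qed.

(** The term of the product rule for [eta * avg k v (v . w)] in which the derivative falls on [eta]:
    the error that Rellich's inequality has to absorb. *)
Definition psi k w a : P -> R := fun x => D a eta x * avg k v (vdot v w) x.

Lemma Cc_psi k w a : (forall i, Cc A (w i)) -> Cc A (psi k w a).
Proof.
move=> hw; apply: (Cc_patch (Kc := Kc)) => //; first exact: smooth_derive.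
- by move=> x; apply: derive_support eK; exact: compact_closedP.
- by move=> x /KA[].
exact: Cc_vdot.
Qed.

(** A derivative falling on the average is replaced, through [avg_derive_defect], by the field [w]
    itself and its curl. The gradient of [psi] is thus controlled without the full gradient of [w],
    which is what makes Rellich's inequality usable. *)
Lemma dirichlet_psi w : (forall i, Cc A (w i)) -> exists2 E, 0 <= E & forall k a,
  dirichlet (psi k w a) <= (4 * M ^+ 2 + 96 * M ^+ 2 * norm1 v ^+ 2) * (N2 w + N2 (curlR w)) +
    E * 2^-1 ^+ k.
Proof.
move=> hw; have hg := Cc_vdot v hw; have bg := Cc_BM hg.
have /choice[E hE] a : exists E, 0 <= E /\ forall k b,
    I3 (fun x => (D a eta x * avg k v (D b (vdot v w)) x - D a eta x * w b x) ^+ 2) <=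
    8 * M ^+ 2 * norm1 v ^+ 2 * N2 (curlR w) + E * 2^-1 ^+ k.
  have [||||E E0 h] := avg_derive_defect (A := A) (Kc := Kc) (v := v) (h := D a eta) (M := M) _ _
    _ _ hw.
  - exact: Cc_BM (Cc_derive a eCc).
  - by move=> x; case: (hM a a x).
  - by move=> x; apply: derive_support eK; exact: compact_closedP.
  - by move=> x /KA[].
  by exists E.
exists (12 * \sum_a E a); first by rewrite mulr_ge0// sumr_ge0// => a _; case: (hE a).
move=> k a.
have bd b := Cc_BM (Cc_derive b (Cc_derive a eCc)).
have bda := Cc_BM (Cc_derive a eCc).
have key b : I3 (fun x => D b (psi k w a) x ^+ 2) <=
   2 * (M ^+ 2 * (norm1 v ^+ 2 * N2 w)) + 2 * (2 * (8 * M ^+ 2 * norm1 v ^+ 2 * N2 (curlR w) +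
     E a * 2^-1 ^+ k)
      + 2 * (M ^+ 2 * I3 (fun x => w b x ^+ 2))).
  have -> : (fun x => D b (psi k w a) x ^+ 2) = fun x => ((D b (D a eta) x * avg k v (vdot v w) x) +
      (D a eta x * avg k v (D b (vdot v w)) x)) ^+ 2.
    apply/funext => x; congr (_ ^+ 2).
    rewrite (congr1 (@^~ x) (derive_fM b (smooth_derive a se) (smooth_avg k v (Cc_smooth hg)))).
    rewrite (congr1 (@^~ x) (derive_avg k v b (Cc_smooth hg))) addrC.
    by congr (_ + _); exact: mulrC.
  have b1 : BM (fun x => D b (D a eta) x * avg k v (vdot v w) x) by apply: BMM => //; exact: BM_avg.
  have b2 : BM (fun x => D a eta x * avg k v (D b (vdot v w)) x).
    by apply: BMM => //; apply: BM_avg; exact: Cc_BM (Cc_derive b hg).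
  have b3 : BM (fun x => D a eta x * w b x) by apply: BMM => //; exact: Cc_BM (hw b).
  apply: (le_trans (I3_sqrD b1 b2)); apply: lerD; rewrite ler_pM2l//.
    apply: (le_trans (I3_mul_avg k v _ (M := M) _ bg)).
    - by case: (bd b).
    - by move=> x; case: (hM a b x).
    by rewrite ler_wpM2l ?sqr_ge0// (I3_vdot v hw).
  rewrite (_ : (fun x => _) = (fun x => (D a eta x * avg k v (D b (vdot v w)) x - D a eta x * w b
    x +
     D a eta x * w b x) ^+ 2)); last by apply/funext => x; rewrite subrK.
  apply: (le_trans (I3_sqrD (BMB b2 b3) b3)); apply: lerD; rewrite ler_pM2l//.
    by case: (hE a) => _; exact.
  apply: (I3_mul_avg 0 v _ _ (Cc_BM (hw b))); first by case: bda.
  by move=> x; case: (hM a b x).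
rewrite /dirichlet; apply: (le_trans (ler_sum _ (fun b _ => key b))).
have -> : \sum_(i < 3) (2 * (M ^+ 2 * (norm1 v ^+ 2 * N2 w)) +
    2 * (2 * (8 * M ^+ 2 * norm1 v ^+ 2 * N2 (curlR w) + E a * 2^-1 ^+ k) +
         2 * (M ^+ 2 * I3 (fun x => w i x ^+ 2)))) =
    6 * M ^+ 2 * norm1 v ^+ 2 * N2 w + 96 * M ^+ 2 * norm1 v ^+ 2 * N2 (curlR w) +
      12 * E a * 2^-1 ^+ k +
    4 * M ^+ 2 * N2 w.
  have NE : N2 w = I3 (fun x => w 0 x ^+ 2) + I3 (fun x => w 1 x ^+ 2) + I3 (fun x => w (1 +
    1) x ^+ 2).
    by rewrite /N2 sum3.
  rewrite sum3 NE; move: (I3 _) (I3 _) (I3 _) (N2 _) (2^-1 ^+ k) (E a) => p q r s t z.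
  by ring.
have E1 : 12 * E a * 2^-1 ^+ k <= 12 * (\sum_b E b) * 2^-1 ^+ k.
  rewrite ler_wpM2r ?exprn_ge0 ?invr_ge0// ler_pM2l// (bigD1 a)//= lerDl sumr_ge0// => b _.
  by case: (hE b).
have w0 := N2_ge0 w; have c0 := N2_ge0 (curlR w).
have q0 : 0 <= M ^+ 2 * norm1 v ^+ 2 * N2 w by rewrite mulr_ge0// mulr_ge0 ?sqr_ge0.
have q1 : 0 <= M ^+ 2 * N2 (curlR w) by rewrite mulr_ge0// sqr_ge0.
move: E1 q0 q1; move: (12 * E a * 2^-1 ^+ k) (12 * (\sum_b E b) * 2^-1 ^+ k) (N2 w) (N2 (curlR
  w)) (M ^+ 2) (norm1 v ^+ 2) => p q r s t z E1 q0 q1.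
rewrite -subr_ge0.
have -> : (4 * t + 96 * t * z) * (r + s) + q - (6 * t * z * r + 96 * t * z * s + p + 4 * t * r) =
  4 * (t * s) + 90 * (t * z * r) + (q - p) by ring.
by lra.
Qed.

Lemma small_mesh (a t : R) : 0 < a -> 0 < t -> exists2 N, (0 < N)%N & mesh a N ^+ 2 <= t.
Proof.
move=> a0 t0; pose s := Num.min t 1; have s0 : 0 < s by rewrite lt_min t0 ltr01.
exists (Num.truncn (2 * a / s)).+1 => //; rewrite /mesh.
have h : 2 * a / s < (Num.truncn (2 * a / s)).+1%:R by exact: truncnS_gt.
have {}h : 2 * a / (Num.truncn (2 * a / s)).+1%:R <= s.
  by rewrite ler_pdivrMr ?ltr0n// [s * _]mulrC -ler_pdivrMr// ltW.
have m0 : 0 <= 2 * a / (Num.truncn (2 * a / s)).+1%:R by rewrite divr_ge0// mulr_ge0// ltW.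
have [h1 h2] : s <= t /\ s <= 1 by rewrite !ge_min !lexx orbT.
by rewrite expr2 (le_trans (ler_piMr m0 (le_trans h h2)))// (le_trans h).
Qed.

(* Up to [e], the curl of [w] and finitely many functionals of [w], the field [S w] is
   the gradient of a test function on [A]. *)
Definition near_gradient (S : P -> R) := forall e, 0 < e ->
  exists (T : finType) (l : T -> field -> R) (C : R), [/\ 0 <= C,
    forall t (c : R) w w', (forall i, Cc A (w i)) -> (forall i, Cc A (w' i)) ->
      l t (fun i x => c * w i x + w' i x) = c * l t w + l t w',
    forall t w, (forall i, Cc A (w i)) -> l t w ^+ 2 <= C * N2 w &
    forall w d, (forall i, Cc A (w i)) -> 0 < d -> exists2 U, Cc A U &
      \sum_a I3 (fun x => (S x * w a x - D a U x) ^+ 2) <=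
        e * N2 w + C * (N2 (curlR w) + \sum_t l t w ^+ 2) + d].

(** Rellich's inequality for [psi k w b] on a mesh so fine that its gradient term costs at most [e]
    times the squared norm of [w]; what remains are integrals over finitely many cells. *)
Lemma patch_estimate a (Aa : forall x, A x -> [/\ `|x.1.1| < a, `|x.1.2| < a & `|x.2| < a]) :
  0 < a -> near_gradient eta.
Proof.
move=> a0 e e0; have M0 : 0 <= M by have [h _ _] := hM 0 0 0; exact: le_trans h.
have n0 := norm1_ge0 v; have M2 := sqr_ge0 M; have n2 := sqr_ge0 (norm1 v).
have [K1 [K10 hD]] : exists K1, 0 <= K1 /\ forall w, (forall i, Cc A (w i)) ->
    exists2 E, 0 <= E & forall k b, dirichlet (psi k w b) <= K1 * (N2 w + N2 (curlR w)) +
      E * 2^-1 ^+ k.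
  exists (4 * M ^+ 2 + 96 * M ^+ 2 * norm1 v ^+ 2); split; last by move=> w; exact: dirichlet_psi.
  exact: (addr_ge0 (mulr_ge0 (ler0n _ _) M2) (mulr_ge0 (mulr_ge0 (ler0n _ _) M2) n2)).
have e1 : 0 < e / (432 * K1 + 1) by apply: divr_gt0; [exact: e0|lra].
have [N [N0 [m [m0 mE hN]]]] : exists N, (0 < N)%N /\ exists m, [/\ 0 < m,
  mesh a N = m & 432 * K1 * m ^+ 2 <= e].
  have [N N0 hN] := small_mesh a0 e1; exists N; split=> //; exists (mesh a N).
  by split=> //; [exact: mesh_gt0|apply: patch_eps => //; exact: sqr_ge0].
pose c (t : 'I_3 * ('I_N * 'I_N * 'I_N)) : P -> R := \1_(@cell R a N t.2).
pose L k (t : 'I_3 * ('I_N * 'I_N * 'I_N)) w := I3 (fun x => c t x * psi k w t.1 x).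
have bc t : BM (c t) by exact: BM_cell.
have cL t w : (forall i, Cc A (w i)) -> cvgn (fun k => L k t w).
  by move=> hw; exact: (@I3_avg_cvg A v (D t.1 eta) (vdot v w) (c t) (Cc_vdot v hw)
    (smooth_derive _ se)
     (Cc_BM (Cc_derive _ eCc)) (bc t)).
have bpsi k w b : (forall i, Cc A (w i)) -> BM (psi k w b).
  by move=> hw; exact: Cc_BM (Cc_psi k b hw).
pose C := 3 * (144 * m ^+ 2 * K1 + 16 * M ^+ 2 * norm1 v ^+ 2) + 2 * (m ^+ 3)^-1 +
  m ^+ 3 * (M ^+ 2 * norm1 v ^+ 2).
have m3 : 0 < m ^+ 3 by rewrite exprn_gt0.
have q0 : 0 <= m ^+ 2 := sqr_ge0 m.
have My : 0 <= M ^+ 2 * norm1 v ^+ 2 := mulr_ge0 M2 n2.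
have C1 : 0 <= 3 * (144 * m ^+ 2 * K1 + 16 * M ^+ 2 * norm1 v ^+ 2).
  by rewrite (mulr_ge0 _ (addr_ge0 (mulr_ge0 (mulr_ge0 _ q0) K10) (mulr_ge0 (mulr_ge0 _ M2) n2))).
have p0 : 0 <= (m ^+ 3)^-1 by rewrite invr_ge0 ltW.
have C2 : 0 <= 2 * (m ^+ 3)^-1 by rewrite (mulr_ge0 _ p0).
have C3 : 0 <= m ^+ 3 * (M ^+ 2 * norm1 v ^+ 2) := mulr_ge0 (ltW m3) My.
have CE : m ^+ 3 * (M ^+ 2 * norm1 v ^+ 2) <= C by rewrite /C lerDr addr_ge0.
have C0 : 0 <= C := le_trans C3 CE.
(* The functionals must be fixed before [w] and [d], while the number [k] of halvings depends on
   both; hence the limits in [k] of the cell integrals. *)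
exists ('I_3 * ('I_N * 'I_N * 'I_N))%type, (fun t w => limn (fun k => L k t w)), C; split => //.
- move=> t s w w' hw hw'; apply: cvg_lim => //.
  rewrite (_ : (fun k => _) = (fun k => s * L k t w + L k t w')).
    by apply: cvgD; [apply: cvgM; [exact: cvg_cst|exact: cL]|exact: cL].
  apply/funext => k; rewrite /L -I3Z; last by apply: BMM => //; exact: bpsi.
  rewrite -I3D; last 2 first.
  - by apply: BMZ; apply: BMM => //; exact: bpsi.
  - by apply: BMM => //; exact: bpsi.
  congr I3; apply/funext => x; rewrite /psi.
  have -> : vdot v (fun i y => s * w i y + w' i y) = fun y => s * vdot v w y + vdot v w' y.
    by apply/funext => y; rewrite /vdot; ring.
  rewrite avgD avgZ; move: (c t x) ('D_(u t.1) eta x) (avg k v _ x) (avg k v _ x) => p q r z.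
  by ring.
- move=> t w hw; have hc := cL t w hw.
  have h2 : (fun k => L k t w ^+ 2) @ \oo --> limn (fun k => L k t w) ^+ 2.
    by rewrite expr2; under eq_fun do rewrite expr2; apply: cvgM.
  rewrite -(cvg_lim _ h2)//; apply: limr_le; first by apply/cvg_ex; eexists; exact: h2.
  apply: nearW => k; rewrite (le_trans (I3_cell_cs _ _ N0 (bpsi k w t.1 hw)))//.
  rewrite mE; apply: (@le_trans _ _ (m ^+ 3 * (M ^+ 2 * norm1 v ^+ 2) * N2 w)); last first.
    by rewrite ler_wpM2r ?N2_ge0.
  rewrite -mulrA ler_pM2l// -mulrA.
  apply: (le_trans (I3_mul_avg k v (h := D t.1 eta) (M := M) _ _ (Cc_BM (Cc_vdot v hw)))).
  - by case: (Cc_BM (Cc_derive t.1 eCc)).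
  - by move=> x; case: (hM t.1 0 x).
  by rewrite ler_wpM2l ?sqr_ge0// (I3_vdot v hw).
move=> w d hw d0.
have [E E0 hE] := hD w hw.
have [||||E' E0' hE'] := avg_derive_defect (A := A) (Kc := Kc) (v := v) (h := eta) (M := M) _ _ _
  _ hw.
- exact: Cc_BM eCc.
- by move=> x; case: (hM 0 0 x).
- exact: eK.
- by move=> x /KA[].
pose U k x := eta x * avg k v (vdot v w) x.
have CU k : Cc A (U k).
  by apply: (Cc_patch (Kc := Kc)) => //; [move=> x /KA[]|exact: Cc_vdot].
pose Z k := e * N2 w + C * (N2 (curlR w) + \sum_t L k t w ^+ 2) +
  (3 * (144 * m ^+ 2 * E + 2 * E')) * 2^-1 ^+ k.
have hZ k : \sum_b I3 (fun x => (eta x * w b x - D b (U k) x) ^+ 2) <= Z k.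
  have key b : I3 (fun x => (eta x * w b x - D b (U k) x) ^+ 2) <=
      2 * (72 * m ^+ 2 * (K1 * (N2 w + N2 (curlR w)) + E * 2^-1 ^+ k) +
           (m ^+ 3)^-1 * \sum_t L k (b, t) w ^+ 2) +
      2 * (8 * M ^+ 2 * norm1 v ^+ 2 * N2 (curlR w) + E' * 2^-1 ^+ k).
    have b2 : BM (fun x => eta x * avg k v (D b (vdot v w)) x - eta x * w b x).
      have be := Cc_BM eCc.
      apply: BMB; apply: BMM => //; last exact: Cc_BM (hw b).
      by apply: BM_avg; exact: Cc_BM (Cc_derive b (Cc_vdot v hw)).
    have -> : (fun x => (eta x * w b x - D b (U k) x) ^+ 2) =
       fun x => (psi k w b x + (eta x * avg k v (D b (vdot v w)) x - eta x * w b x)) ^+ 2.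
      apply/funext => x; rewrite -sqrrN; congr (_ ^+ 2).
      rewrite (congr1 (@^~ x) (derive_fM b se (smooth_avg k v (Cc_smooth (Cc_vdot v hw))))).
      rewrite (congr1 (@^~ x) (derive_avg k v b (Cc_smooth (Cc_vdot v hw)))) /psi.
      move: (avg k v _ x) (avg k v _ x) ('D_(u b) eta x) (w b x) (eta x) => p q r z y.
      by ring.
    rewrite (le_trans (I3_sqrD (bpsi k w b hw) b2))//; apply: lerD; rewrite ler_pM2l//.
    rewrite (le_trans (rellich a0 N0 Aa (Cc_psi k b hw)))// lerD//; last by rewrite mE.
    by rewrite mE ler_wpM2l ?(mulr_ge0 _ q0)//; exact: hE.
  apply: (le_trans (ler_sum _ (fun b _ => key b))).
  have sE : \sum_t L k t w ^+ 2 = \sum_(b < 3) \sum_t L k (b, t) w ^+ 2.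
    by rewrite pair_bigA/=; apply: eq_bigr => -[].
  have s0 : 0 <= \sum_t L k t w ^+ 2 by apply: sumr_ge0 => t _; exact: sqr_ge0.
  rewrite big_split/= sumr_const -mulr_sumr big_split /= sumr_const -mulr_sumr -sE card_ord.
  have w0 := N2_ge0 w; have c0 := N2_ge0 (curlR w).
  exact: patch_alg.
have cZ : Z @ \oo --> e * N2 w + C * (N2 (curlR w) + \sum_t limn (fun k => L k t w) ^+ 2).
  rewrite -[X in _ --> X]addr0; apply: cvgD.
    apply: cvgD; first exact: cvg_cst.
    apply: cvgM; first exact: cvg_cst.
    apply: cvgD; first exact: cvg_cst.
    apply: cvg_sum_seq => t; rewrite expr2; under eq_fun do rewrite expr2.
    by apply: cvgM; exact: cL.
  rewrite -[X in _ --> X](mulr0 (3 * (144 * m ^+ 2 * E + 2 * E'))).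
  by apply: cvgM; [exact: cvg_cst|apply: cvg_expr; rewrite ger0_norm ?invr_ge0//; lra].
(* Here [d] pays for choosing a finite [k]: both the errors of order [2^-k] and the distance of the
   cell integrals from their limits. *)
have : \forall k \near \oo, Z k < e * N2 w + C * (N2 (curlR w) + \sum_t limn (fun k =>
  L k t w) ^+ 2) + d.
  by apply: cvgr_lt cZ _ _; rewrite ltrDl.
move=> [k0 _ /(_ k0 (leqnn _)) /ltW h]; exists (U k0); first exact: CU.
exact: le_trans h.
Qed.

End patch.

Lemma near_gradient0 (A : set P) : near_gradient A (fun=> 0).
Proof.
move=> e e0; exists 'I_0, (fun _ _ => 0), 0; split => //; try by case.
move=> w d hw d0; exists (fun=> 0); first exact: Cc0.
rewrite big1; last first.
  move=> a _; rewrite (_ : (fun x => _) = fun=> 0) ?I30//.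
  by apply/funext => x; rewrite (congr1 (@^~ x) (derive_fcst 0 a)) mul0r subr0 expr0n.
by rewrite mul0r addr0 addr_ge0 ?(ltW d0)// mulr_ge0 ?N2_ge0// ltW.
Qed.

Lemma sum_le2 (F X Y : 'I_3 -> R) : (forall a, F a <= 2 * X a + 2 * Y a) ->
  \sum_a F a <= 2 * (\sum_a X a) + 2 * (\sum_a Y a).
Proof.
by move=> h; rewrite (le_trans (ler_sum _ (fun a _ => h a)))// big_split/= -!mulr_sumr.
Qed.

Lemma near_gradientD_alg (x y e C C' nw nc p q d : R) :
  x <= e / 4 * nw + C * (nc + p) + d / 4 -> y <= e / 4 * nw + C' * (nc + q) + d / 4 ->
  0 <= C * q -> 0 <= C' * p -> 0 <= C * nc -> 0 <= C' * nc ->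
  2 * x + 2 * y <= e * nw + 2 * (C + C') * (nc + (p + q)) + d.
Proof.
move=> h1 h2; have -> : 2 * (C + C') * (nc + (p + q)) = 2 * (C * (nc + p)) + 2 * (C' * (nc + q)) +
  2 * (C * q) + 2 * (C' * p) by ring.
have -> : e * nw = 4 * (e / 4 * nw) by field.
move: h1 h2; move: (e / 4 * nw) (C * (nc + p)) (C' * (nc + q)) (C * q) (C' * p) => *; lra.
Qed.

(** The potentials add up and the families of functionals are joined. Each summand is asked for
    [e / 4] and [d / 4], as each squared error is doubled and two of them are added. *)
Lemma near_gradientD (A : set P) (S S' : P -> R) : smooth S -> smooth S' ->
  near_gradient A S -> near_gradient A S' ->
  near_gradient A (fun x => S x + S' x).
Proof.
move=> sS sS' gS gS' e e0; have e4 : 0 < e / 4 by lra.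
have [T [l [C [C0 l1 l2 h]]]] := gS _ e4.
have [T' [l' [C' [C0' l1' l2' h']]]] := gS' _ e4.
exists (T + T')%type, (fun t => match t with inl t => l t | inr t => l' t end), (2 * (C + C')).
split=> [|[t|t]|[t|t] w hw|w d hw d0]; [lra|exact: l1|exact: l1'| | |].
- rewrite (le_trans (l2 t w hw))// ler_wpM2r ?N2_ge0//; lra.
- rewrite (le_trans (l2' t w hw))// ler_wpM2r ?N2_ge0//; lra.
have d4 : 0 < d / 4 by lra.
have [U cU hU] := h w _ hw d4; have [U' cU' hU'] := h' w _ hw d4.
exists (fun x => U x + U' x); first exact: CcD.
have key := @sum_le2 (fun a => I3 (fun x => ((S x + S' x) * w a x - D a (fun y => U y +
  U' y) x) ^+ 2))
   (fun a => I3 (fun x => (S x * w a x - D a U x) ^+ 2)) (fun a => I3 (fun x =>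
     (S' x * w a x - D a U' x) ^+ 2)).
apply: le_trans (key _) _ => [a|].
  have b1 : BM (fun x => S x * w a x - D a U x).
    by apply: (@Cc_BM _ A); apply: CcB; [exact: CcMl|exact: Cc_derive].
  have b2 : BM (fun x => S' x * w a x - D a U' x).
    by apply: (@Cc_BM _ A); apply: CcB; [exact: CcMl|exact: Cc_derive].
  have := I3_sqrD b1 b2; congr (I3 _ <= _); apply/funext => x.
  rewrite (congr1 (@^~ x) (derive_fD a (Cc_smooth cU) (Cc_smooth cU'))).
  move: ('D_(u a) U x) ('D_(u a) U' x) (S x) (S' x) (w a x) => p q r s t.
  by congr (_ ^+ 2); ring.
rewrite big_sumType/=.
have s0 : 0 <= \sum_t l t w ^+ 2 by apply: sumr_ge0 => t _; exact: sqr_ge0.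
have s0' : 0 <= \sum_t l' t w ^+ 2 by apply: sumr_ge0 => t _; exact: sqr_ge0.
have c0 := N2_ge0 (curlR w).
exact: (near_gradientD_alg hU hU' (mulr_ge0 C0 s0') (mulr_ge0 C0' s0) (mulr_ge0 C0 c0)
  (mulr_ge0 C0' c0)).
Qed.

Lemma near_gradient_sum (A : set P) (J : seq P) (eta : P -> P -> R) : (forall j, smooth (eta j)) ->
  (forall j, near_gradient A (eta j)) -> near_gradient A (fun x => \sum_(j <- J) eta j x).
Proof.
move=> sE gE; elim: J => [|j J IH]; first by under eq_fun do rewrite big_nil; exact: near_gradient0.
under eq_fun do rewrite big_cons.
by apply: near_gradientD => //; exact: smooth_sum.
Qed.

Lemma partition_near_gradient (Om : set P) : open Om -> bounded_set Om -> lipschitz_boundary Om ->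
  exists S : P -> R, [/\ smooth S, exists M, forall x, `|S x| <= M, forall x, Om x ->
    1 <= S x & near_gradient Om S].
Proof.
move=> oOm bOm lip; have [J [eta [v [Kc [h1 h2 h3 h4]]]]] := patches oOm bOm lip.
have cE j : Cc setT (eta j).
  by split; [case: (h1 j)|exists (Kc j); [case: (h1 j)|split => // x; case: (h2 j x)]].
exists (fun x => \sum_(j <- J) eta j x); split => //.
- by apply: smooth_sum => j; case: (h1 j).
- by have [M _ hM] := Cc_bounded (Cc_sum J cE); exists M.
have [M [_ hM]] := bOm.
apply: near_gradient_sum => j; first by case: (h1 j).
have [M0 M00 hM0] := Cc_bounded (cE j).
have /choice[M1 hM1] a : exists m, 0 <= m /\ forall x, `|D a (eta j) x| <= m.
  by have [m m0 hm] := Cc_bounded (Cc_derive a (cE j)); exists m.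
have /choice[M2 hM2] (p : 'I_3 * 'I_3) : exists m, 0 <= m /\ forall x,
  `|D p.2 (D p.1 (eta j)) x| <= m.
  by have [m m0 hm] := Cc_bounded (Cc_derive p.2 (Cc_derive p.1 (cE j))); exists m.
have s1 : 0 <= \sum_a M1 a by apply: sumr_ge0 => a _; case: (hM1 a).
have s2 : 0 <= \sum_p M2 p by apply: sumr_ge0 => a _; case: (hM2 a).
apply: (@patch_estimate Om (Kc j) (v j) (eta j) (M0 + \sum_a M1 a +
  \sum_p M2 p) _ _ _ _ _ (`|M| + 2)).
- by case: (h1 j).
- by case: (h1 j).
- by move=> x; case: (h2 j x).
- exact: h3.
- move=> a b x; split.
  + by rewrite (le_trans (hM0 x))// -addrA lerDl addr_ge0.
  + have [m0 hm] := hM1 a; rewrite (le_trans (hm x))// (le_trans (_ : _ <= \sum_a M1 a))//.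
      by rewrite (bigD1 a)//= lerDl sumr_ge0// => c _; case: (hM1 c).
    by rewrite addrAC lerDr addr_ge0.
  have [m0 hm] := hM2 (a, b); rewrite (le_trans (hm x))// (le_trans (_ : _ <= \sum_a M2 a))//.
    by rewrite (bigD1 (a, b))//= lerDl sumr_ge0// => c _; case: (hM2 c).
  by rewrite lerDr addr_ge0.
- move=> x Ox; have /hM/(_ _ Ox) : M < `|M| + 1 by rewrite (le_lt_trans (ler_norm _))// ltrDl.
  rewrite /= prod_normE ge_max prod_normE ge_max => /andP[/andP[k1 k2] k3].
  by split; lra.
by have := normr_ge0 M; lra.
Qed.

End test_field_gradients.

(** * The operators grad, div and curl *)

Section representation.
Variables (R : realType) (k : scalars) (Om : set (R3 R)) (oOm : open Om).
Local Notation K := (scal R k).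
Local Notation P := (R3 R).
Local Notation u := (unitv R).
Local Notation D i f := ('D_(u i) f).
Local Notation leb := (leb_Om oOm).
Local Notation Ls := (L2s k oOm).
Local Notation Lv := (L2v k oOm).
Local Notation re f := (fun x => reK (f x)).
Local Notation im f := (fun x => imK (f x)).
Local Notation nms := (hnrm (@ips R k Om oOm)).
Local Notation nmv := (hnrm (@ip R k Om oOm)).
Implicit Types (phi psi : P -> K).

Lemma leb_Om_integral (f : P -> \bar R) : (forall x, ~ Om x -> f x = 0%E) ->
  (\int[leb]_x f x = \int[@vol3 R]_x f x)%E.
Proof.
move=> h; have e : f \_ Om = f.
  by apply/funext => x; rewrite patchE; case: ifPn => //; rewrite notin_setE => /h.
rewrite -e -!integral_mkcond; apply: eq_measure_integral => A _ AO.
have {1}<- : A `&` Om = A by exact/setIidPl.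
have -> : leb (A `&` Om) = vol3 R (A `&` Om `&` Om) by [].
by have -> : A `&` Om `&` Om = A by rewrite -setIA setIid; exact/setIidPl.
Qed.

(** For such functions integrals over [Om] are integrals over the whole space, where translations
    act. *)
Definition nice (f : P -> R) := BM f /\ forall x, ~ Om x -> f x = 0.

Lemma Cc_nice (f : P -> R) : Cc Om f -> nice f.
Proof.
move=> hf; split; first exact: Cc_BM hf.
by case: hf => _ [Kc _ [KA hK]] x; move=> nO; apply/eqP; apply: contra_notT nO => /hK/KA.
Qed.

Lemma niceM f g : BM f -> nice g -> nice (fun x => f x * g x).
Proof. by move=> bf [bg h]; split; [exact: BMM|move=> x /h ->; rewrite mulr0]. Qed.

Lemma nice_integrable f : nice f -> leb.-integrable setT (EFin \o f).
Proof.
move=> [bf h0]; have /integrableP[mf hf] := BM_integrable bf.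
apply/integrableP; split; first exact: mf.
by rewrite leb_Om_integral; [exact: hf|move=> x /h0 /= ->; rewrite normr0].
Qed.

Lemma nice_Lfun2 f : nice f -> f \in Lfun leb 2%:E.
Proof.
move=> hf; have [[mf bf rf] h0] := hf; apply/Lfun2P; split => //.
rewrite leb_Om_integral; last by move=> x /h0 ->; rewrite expr0n.
by rewrite -EFin_I3 ?ltry//; apply: BMX2.
Qed.

Lemma nice_integral f : nice f -> \int[leb]_x f x = I3 f.
Proof. by move=> [bf h0]; rewrite /I3 /Rintegral leb_Om_integral// => x /h0 ->. Qed.

Definition nicek phi := nice (re phi) /\ nice (im phi).

Lemma nicek_class phi : nicek phi -> exists v : Ls, represents v phi.
Proof.
move=> [h1 h2].
have h : phi \in @sqint _ _ _ leb k by apply/andP; split; exact: nice_Lfun2.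
by exists (\pi_(L2 leb k)%qT (SqintFun h)); exact: repr_pi_ae.
Qed.

Lemma represents_lin (c : K) (v w : Ls) phi psi : represents v phi -> represents w psi ->
  represents (c *: v + w) (fun x => c * phi x + psi x).
Proof.
move=> h1 h2; apply: filterS3 h1 h2 (repr_lin_ae c v w) => x h1 h2 ->.
by rewrite h1 h2.
Qed.

Lemma represents_eq (v : Ls) phi psi : represents v phi -> (forall x, phi x = psi x) ->
  represents v psi.
Proof. by move=> h e; apply: filterS h => x ->. Qed.

Lemma represents0 : represents (0 : Ls) (fun=> 0).
Proof.
have h : nicek (fun=> 0 : K).
  have n0 : nice (fun=> 0) by split; [exact: BM_cst0|].
  have e1 : (fun _ : P => reK (0 : K)) = fun=> 0 by apply/funext => x; exact: reK0.
  have e2 : (fun _ : P => imK (0 : K)) = fun=> 0 by apply/funext => x; exact: imK0.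
  by rewrite /nicek e1 e2.
have [v hv] := nicek_class h.
have := represents_lin (-1) hv hv; rewrite scaleN1r addNr => h0.
by apply: represents_eq h0 _ => x; rewrite mulr0 addr0.
Qed.

Lemma reK_ips_rep (v w : Ls) phi psi : represents v phi -> represents w psi -> nicek phi ->
  nicek psi ->
  reK (ips v w) = I3 (fun x => reK (phi x) * reK (psi x)) + I3 (fun x => imK (phi x) * imK (psi x)).
Proof.
move=> hv hw [n1 n2] [n3 n4].
have m1 : nice (fun x => reK (phi x) * reK (psi x)) by apply: niceM n3; case: n1.
have m2 : nice (fun x => imK (phi x) * imK (psi x)) by apply: niceM n4; case: n2.
have [b1 _] := m1; have [b2 _] := m2.
have n : nice (fun x => reK (phi x) * reK (psi x) + imK (phi x) * imK (psi x)).
  split; first exact: BMD.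
  by move=> x nO; case: m1 => _ ->//; case: m2 => _ ->//; rewrite addr0.
have -> : reK (ips v w) = \int[leb]_x reK (conjK (repr v x) * repr w x) by exact: reK_ipL.
rewrite -I3D; [|exact: b1|exact: b2].
rewrite -(nice_integral n); apply: ae_eq_Rintegral.
- exact: integrable_re_conjM.
- exact: nice_integrable.
apply: filterS2 hv hw => x -> ->.
by rewrite !(reKE, imKE) mulNr opprK.
Qed.

Definition sq1 phi : R := I3 (fun x => reK (phi x) ^+ 2) + I3 (fun x => imK (phi x) ^+ 2).

Lemma sqr_nms (v : Ls) phi : represents v phi -> nicek phi -> nms v ^+ 2 = sq1 phi.
Proof.
move=> hv hphi; rewrite (sqr_nm (hilbert_ips k oOm)) (reK_ips_rep hv hv hphi hphi).
by congr (I3 _ + I3 _); apply/funext => x; rewrite expr2.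
Qed.

Lemma Cc_inftyE phi : Cc_infty Om phi <-> Cc Om (re phi) /\ Cc Om (im phi).
Proof.
split=> [[s1 s2 cK KO]|[[s1 [K1 cK1 [KO1 h1]]] [s2 [K2 cK2 [KO2 h2]]]]].
  split; split => //; exists (closure [set x | phi x != 0]) => //; split => // x h;
  by apply: subset_closure => /=; apply: contra_neq h => ->; rewrite ?reK0 ?imK0.
have cK : compact (K1 `|` K2) by exact: compactU.
have sub : closure [set x | phi x != 0] `<=` K1 `|` K2.
  rewrite [X in _ `<=` X](closure_id _).1; last exact: compact_closedP.
  apply: closure_subset => x /= h.
  have [r0|/h1] := eqVneq (reK (phi x)) 0; last by left.
  have [i0|/h2] := eqVneq (imK (phi x)) 0; last by right.
  by move: h; rewrite (_ : phi x = 0) ?eqxx//; apply: eqK; rewrite ?reK0 ?imK0.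
split => //.
  by apply: subclosed_compact cK sub; exact: closed_closure.
by move=> x /sub [/KO1|/KO2].
Qed.

Lemma Cc_infty_nicek phi : Cc_infty Om phi -> nicek phi.
Proof. by move=> /Cc_inftyE[h1 h2]; split; exact: Cc_nice. Qed.

Lemma re_mk (f g : P -> R) : re (fun x => mkK k (f x) (g x)) = f.
Proof. by apply/funext => x; rewrite reK_mk. Qed.

Lemma Cc_infty_mk (f g : P -> R) : Cc Om f -> Cc Om g -> Cc_infty Om (fun x => mkK k (f x) (g x)).
Proof.
move=> hf hg; apply/Cc_inftyE; rewrite re_mk; split => //.
by case: (k) => //=; exact: Cc0.
Qed.

Lemma re_lin (c : K) phi psi : re (fun x => c * phi x + psi x) =
  fun x => reK c * reK (phi x) + (- imK c * imK (phi x) + reK (psi x)).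
Proof. by apply/funext => x; rewrite !(reKE, imKE); ring. Qed.

Lemma im_lin (c : K) phi psi : im (fun x => c * phi x + psi x) =
  fun x => reK c * imK (phi x) + (imK c * reK (phi x) + imK (psi x)).
Proof. by apply/funext => x; rewrite !(reKE, imKE); ring. Qed.

Lemma Cc_infty_lin (c : K) phi psi : Cc_infty Om phi -> Cc_infty Om psi ->
  Cc_infty Om (fun x => c * phi x + psi x).
Proof.
move=> /Cc_inftyE[h1 h2] /Cc_inftyE[h3 h4]; apply/Cc_inftyE; rewrite re_lin im_lin.
by split; apply: CcD; [exact: CcZ|apply: CcD => //; exact: CcZ|exact: CcZ|apply: CcD => //;
  exact: CcZ].
Qed.

Lemma Cc_infty0 : Cc_infty Om (fun=> 0 : K).
Proof.
apply/Cc_inftyE; split; [rewrite (_ : re _ = fun=> 0)|rewrite (_ : im _ = fun=> 0)];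
by [exact: Cc0|apply/funext => x; rewrite ?reK0 ?imK0].
Qed.

Lemma re_partial i phi : re (partial i phi) = D i (re phi).
Proof. by apply/funext => x; rewrite reK_mk. Qed.

Lemma im_partial i phi : im (partial i phi) = D i (im phi).
Proof.
apply/funext => x; rewrite /partial; case: (k) phi => phi //=.
by rewrite (congr1 (@^~ x) (derive_fcst 0 i)).
Qed.

Lemma Cc_infty_partial i phi : Cc_infty Om phi -> Cc_infty Om (partial i phi).
Proof.
move=> /Cc_inftyE[h1 h2]; apply/Cc_inftyE; rewrite re_partial im_partial.
by split; exact: Cc_derive.
Qed.

Lemma partial_lin i (c : K) phi psi x : Cc_infty Om phi -> Cc_infty Om psi ->
  partial i (fun x => c * phi x + psi x) x = c * partial i phi x + partial i psi x.
Proof.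
move=> /Cc_inftyE[h1 h2] /Cc_inftyE[h3 h4].
have s1 := Cc_smooth h1; have s2 := Cc_smooth h2; have s3 := Cc_smooth h3; have s4 := Cc_smooth h4.
have lin (a b : R) (f g h : P -> R) : smooth f -> smooth g -> smooth h ->
    D i (fun x => a * f x + (b * g x + h x)) x = a * D i f x + (b * D i g x + D i h x).
  move=> sf sg sh.
  rewrite (congr1 (@^~ x) (derive_fD i (smoothZ a sf) (smoothD (smoothZ b sg) sh))).
  rewrite (congr1 (@^~ x) (derive_fD i (smoothZ b sg) sh)).
  by rewrite (congr1 (@^~ x) (derive_fZ a i sf)) (congr1 (@^~ x) (derive_fZ b i sg)).
have rp (p : P -> K) : reK (partial i p x) = D i (re p) x by exact: (congr1 (@^~ x) (re_partial i
  p)).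
have ip (p : P -> K) : imK (partial i p x) = D i (im p) x by exact: (congr1 (@^~ x) (im_partial i
  p)).
apply: eqK.
  by rewrite rp re_lin lin// reKD reKM !rp !ip; ring.
by rewrite ip im_lin lin// imKD imKM !rp !ip; ring.
Qed.

Lemma represents_test phi : Cc_infty Om phi -> exists v : Ls, represents v phi.
Proof. by move=> /Cc_infty_nicek; exact: nicek_class. Qed.

Lemma representsv_test (phi : 'I_3 -> P -> K) : (forall i, nicek (phi i)) ->
  exists v : Lv, representsv v phi.
Proof.
move=> h; have /choice[F hF] i := nicek_class (h i).
by exists [ffun i => F i] => i; rewrite ffunE.
Qed.

Lemma representsv_lin (c : K) (v w : Lv) (phi psi : 'I_3 -> P -> K) : representsv v phi ->
  representsv w psi ->
  representsv (c *: v + w) (fun i x => c * phi i x + psi i x).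
Proof. by move=> h1 h2 i; rewrite !ffunE; exact: represents_lin. Qed.

Lemma representsv_eq (v : Lv) (phi psi : 'I_3 -> P -> K) : representsv v phi -> (forall i x,
  phi i x = psi i x) ->
  representsv v psi.
Proof. by move=> h e i; exact: represents_eq (h i) (e i). Qed.

Lemma sqr_nmv (v : Lv) (phi : 'I_3 -> P -> K) : representsv v phi -> (forall i, nicek (phi i)) ->
  nmv v ^+ 2 = N2 (fun i => re (phi i)) + N2 (fun i => im (phi i)).
Proof.
move=> hv h; have -> : nmv v ^+ 2 = \sum_i nms (v i) ^+ 2 by exact: (sqr_hnrmF (hilbert_ips k oOm)).
by rewrite -big_split; apply: eq_bigr => i _; exact: sqr_nms.
Qed.

End representation.

Section operators.
Variables (R : realType) (k : scalars) (Om : set (R3 R)) (oOm : open Om).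
Local Notation K := (scal R k).
Local Notation P := (R3 R).
Local Notation u := (unitv R).
Local Notation D i f := ('D_(u i) f).
Local Notation Ls := (L2s k oOm).
Local Notation Lv := (L2v k oOm).
Local Notation re f := (fun x => reK (f x)).
Local Notation im f := (fun x => imK (f x)).
Local Notation ips := (@ips R k Om oOm).
Local Notation ip := (@ip R k Om oOm).
Local Notation nms := (hnrm ips).
Local Notation nmv := (hnrm ip).
Local Notation hS := (hilbert_ips k oOm).
Local Notation hV := (hilbert_ip k oOm).
Local Notation gradc := (@grad_c R k Om oOm).
Local Notation curlc := (@curl_c R k Om oOm).
Local Notation div := (@div R k Om oOm).
Local Notation curl := (@curl R k Om oOm).
Local Notation curl0 := (@curl0 R k Om oOm).
Local Notation G := (ran (@grad0 R k Om oOm)).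
Local Notation C := (ran curl).

Lemma lim_eqK (a b : nat -> K) (la lb : K) : a @ \oo --> la -> b @ \oo --> lb ->
  (forall n, a n = b n) -> la = lb.
Proof.
move=> /cvgK[a1 a2] /cvgK[b1 b2] h.
have e : a = b by apply/funext.
rewrite e in a1 a2.
by apply: eqK; [rewrite -(cvg_lim _ a1)// -(cvg_lim _ b1)|rewrite -(cvg_lim _ a2)// -(cvg_lim _
  b2)].
Qed.

Lemma partial0 i x : partial i (fun _ : P => 0 : K) x = 0.
Proof.
rewrite /partial (_ : @reK R k \o _ = fun=> 0); last by apply/funext => y; exact: reK0.
rewrite (_ : @imK R k \o _ = fun=> 0); last by apply/funext => y; exact: imK0.
by rewrite (congr1 (@^~ x) (derive_fcst 0 i)) -/(ofR k 0) ofR0.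
Qed.

Lemma grad_c0 : gradc 0.
Proof.
exists (fun=> 0); split; [exact: Cc_infty0|exact: represents0|] => i.
rewrite ffunE; apply: represents_eq (represents0 k oOm) _ => x.
by rewrite partial0.
Qed.

Lemma grad_c_lin c p q : gradc p -> gradc q -> gradc (c *: p + q).
Proof.
move=> [phi [h1 h2 h3]] [psi [g1 g2 g3]]; exists (fun x => c * phi x + psi x); split.
- exact: Cc_infty_lin.
- exact: represents_lin.
by apply: representsv_eq (representsv_lin c h3 g3) _ => i x; rewrite (@partial_lin R k Om).
Qed.

Lemma grad_cZ c p : gradc p -> gradc (c *: p).
Proof. by move=> h; rewrite -[_ *: _]addr0; apply: grad_c_lin => //; exact: grad_c0. Qed.

Lemma curl_c0 : curlc 0.
Proof.
exists (fun _ => fun=> 0); split=> [i|i|i]; first exact: Cc_infty0.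
  by rewrite ffunE; exact: represents0.
by rewrite ffunE; apply: represents_eq (represents0 k oOm) _ => x; rewrite /partial subrr.
Qed.

Lemma curl_c_lin c p q : curlc p -> curlc q -> curlc (c *: p + q).
Proof.
move=> [phi [h1 h2 h3]] [psi [g1 g2 g3]]; exists (fun i x => c * phi i x + psi i x); split.
- by move=> i; exact: Cc_infty_lin.
- exact: representsv_lin.
apply: representsv_eq (representsv_lin c h3 g3) _ => i x; rewrite !(@partial_lin R k Om)//; ring.
Qed.

Lemma reK_ip_rep (v w : Lv) (phi psi : 'I_3 -> P -> K) : representsv v phi -> representsv w psi ->
  (forall i, nicek Om (phi i)) -> (forall i, nicek Om (psi i)) ->
  reK (ip v w) = \sum_i (I3 (fun x => reK (phi i x) * reK (psi i x)) +
                         I3 (fun x => imK (phi i x) * imK (psi i x))).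
Proof.
move=> hv hw h1 h2; rewrite /Defs.ip reK_sum; apply: eq_bigr => i _.
exact: reK_ips_rep.
Qed.

Lemma grad_div_ibp phi d psi e : gradc (phi, d) -> div_c (psi, e) ->
  reK (ips e phi) = - reK (ip psi d).
Proof.
move=> [f [cf /= f1 f2]] [g [cg /= g1 g2]].
have /Cc_inftyE[cf1 cf2] := cf.
have cg1 i : Cc Om (re (g i)) by have /Cc_inftyE[] := cg i.
have cg2 i : Cc Om (im (g i)) by have /Cc_inftyE[] := cg i.
have e1 : re (fun x => \sum_i partial i (g i) x) = fun x => \sum_i D i (re (g i)) x.
  by apply/funext => x; rewrite reK_sum; apply: eq_bigr => i _;
    exact: (congr1 (@^~ x) (re_partial i (g i))).
have e2 : im (fun x => \sum_i partial i (g i) x) = fun x => \sum_i D i (im (g i)) x.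
  apply/funext => x; rewrite (big_morph _ (@imKD R k) (@imK0 R k)).
  by apply: eq_bigr => i _; exact: (congr1 (@^~ x) (im_partial i (g i))).
have ng : nicek Om (fun x => \sum_i partial i (g i) x).
  by split; [rewrite e1|rewrite e2]; apply: Cc_nice; apply: Cc_sum => i; exact: Cc_derive.
have nf i : nicek Om (partial i f) by apply: Cc_infty_nicek; exact: Cc_infty_partial.
rewrite (reK_ips_rep g2 f1 ng (Cc_infty_nicek cf)).
rewrite (reK_ip_rep g1 f2 (fun i => Cc_infty_nicek (cg i)) nf).
have key (a : 'I_3 -> P -> R) b : (forall i, Cc Om (a i)) -> Cc Om b ->
    I3 (fun x => (\sum_i D i (a i) x) * b x) = - \sum_i I3 (fun x => a i x * D i b x).
  move=> ha hb; rewrite -sumrN.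
  rewrite (_ : (fun x => _) = fun x => \sum_i D i (a i) x * b x); last first.
    by apply/funext => x; rewrite mulr_suml.
  rewrite I3_sum; last first.
    by move=> i; apply: Cc_BM; apply: (CcMr (Cc_derive i (ha i))); exact: Cc_smooth hb.
  by apply: eq_bigr => i _; apply: I3_ibp (ha i) (Cc_smooth hb).
have -> : (fun x => reK (\sum_i partial i (g i) x) * reK (f x)) = (fun x =>
  (\sum_i D i (re (g i)) x) * reK (f x)).
  by apply/funext => x; rewrite (congr1 (@^~ x) e1).
have -> : (fun x => imK (\sum_i partial i (g i) x) * imK (f x)) = (fun x =>
  (\sum_i D i (im (g i)) x) * imK (f x)).
  by apply/funext => x; rewrite (congr1 (@^~ x) e2).
rewrite (key _ _ cg1 cf1) (key _ _ cg2 cf2) -opprD -big_split; congr (- _).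
apply: eq_bigr => i _; congr (I3 _ + I3 _); apply/funext => x; congr (_ * _).
  exact: (congr1 (@^~ x) (esym (re_partial i f))).
exact: (congr1 (@^~ x) (esym (im_partial i f))).
Qed.

(** Integration by parts was shown on real parts; rescaling the test function recovers the full
    identity. *)
Lemma grad_c_grad p : gradc p -> grad p.
Proof.
case: p => phi d h psi e hd /=; apply: eqK_reM => c.
rewrite mulrN reKN -(ipZr hS) -(ipZr hV).
exact: (grad_div_ibp (grad_cZ c h) hd).
Qed.

Lemma grad_c_grad0 p : gradc p -> grad0 p.
Proof.
move=> h; split; first exact: grad_c_grad.
move=> e e0; exists p.1, p.2; split; first by case: (p) h.
  by rewrite /nrms subrr (ip0r hS) reK0 sqrtr0.
by rewrite /nrm subrr (ip0r hV) reK0 sqrtr0.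
Qed.

Lemma grad0P p : grad0 p <-> exists2 p_ : nat -> Ls * Lv, (forall n, gradc (p_ n)) &
  hcvg ips (fun n => (p_ n).1) p.1 /\ hcvg ip (fun n => (p_ n).2) p.2.
Proof.
split=> [[hp h]|[p_ hp_ [h1 h2]]].
  have /choice[p_ hp_] n : exists q, [/\ gradc q, nms (p.1 - q.1) < harmonic n & nmv (p.2 - q.2)
    < harmonic n].
    by have [phi [d [h1 h2 h3]]] := h (harmonic n) (harmonic_gt0 _); exists (phi, d).
  exists p_ => [n|]; first by case: (hp_ n).
  split; apply: squeeze0 (@cvg_harmonic R) => n; rewrite sqrtr_ge0 /=.
    by rewrite (nmB hS) ltW//; case: (hp_ n).
  by rewrite (nmB hV) ltW//; case: (hp_ n).
split=> [psi d hd|e e0].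
  have hb : (fun n => - ip psi (p_ n).2) @ \oo --> - ip psi p.2.
    by apply: cvgN; exact: (hcvg_ipr hV (phi := psi) h2).
  apply: (lim_eqK (hcvg_ipr hS (phi := d) h1) hb).
  by move=> n; have := grad_c_grad (hp_ n) hd.
have /hcvgP/(_ e e0)[N1 hN1] := h1; have /hcvgP/(_ e e0)[N2 hN2] := h2.
exists (p_ (maxn N1 N2)).1, (p_ (maxn N1 N2)).2; split; first by case: (p_ _) (hp_ (maxn N1 N2)).
  by rewrite /nrms -/(hnrm ips _) (nmB hS); apply: hN1; exact: leq_maxl.
by rewrite /nrm -/(hnrm ip _) (nmB hV); apply: hN2; exact: leq_maxr.
Qed.

Hypothesis bOm : bounded_set Om.

Lemma grad_poincare : exists2 B, 0 <= B & forall phi d, gradc (phi, d) -> nms phi <= B * nmv d.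
Proof.
have [M [_ hM]] := bOm; pose r := `|M| + 1; have r0 : 0 <= r by rewrite addr_ge0.
have Or : Om `<=` cube r.
  move=> x Ox; have /hM/(_ _ Ox) : M < r by rewrite (le_lt_trans (ler_norm _))// ltrDl.
  rewrite /= prod_normE ge_max prod_normE ge_max => /andP[/andP[h1 h2] h3].
  by apply/cubeE.
have B0 : 0 <= 2 * r + 1 by rewrite addr_ge0// mulr_ge0.
exists (2 * r + 1) => // phi d [f [cf f1 f2]].
have /Cc_inftyE[c1 c2] := cf.
have nf i : nicek Om (partial i f) by apply: Cc_infty_nicek; exact: Cc_infty_partial.
rewrite -(ler_pXn2r (n := 2)) ?nnegrE ?mulr_ge0 ?(nm_ge0 hV) ?sqrtr_ge0//.
rewrite exprMn (sqr_nms f1 (Cc_infty_nicek cf)) (sqr_nmv f2 nf) mulrDr /sq1.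
apply: lerD.
  apply: (le_trans (poincare r0 Or c1)); rewrite ler_wpM2l ?sqr_ge0//.
  rewrite le_eqVlt; apply/orP; left; apply/eqP; apply: eq_bigr => i _; congr I3; apply/funext => x.
  by rewrite (congr1 (@^~ x) (re_partial i f)).
apply: (le_trans (poincare r0 Or c2)); rewrite ler_wpM2l ?sqr_ge0//.
rewrite le_eqVlt; apply/orP; left; apply/eqP; apply: eq_bigr => i _; congr I3; apply/funext => x.
  by rewrite (congr1 (@^~ x) (im_partial i f)).
Qed.

(** Poincare's inequality turns convergence of gradients of test functions into convergence of the
    test functions themselves. *)
Lemma ran_grad0_closed : hclosed ip G.
Proof.
split=> [|c v w [f hf] [g hg]|w_ l hw hl].
- by exists 0; apply: grad_c_grad0; exact: grad_c0.
- have /grad0P[p_ hp [p1 p2]] := hf; have /grad0P[q_ hq [q1 q2]] := hg.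
  exists (c *: f + g); apply/grad0P; exists (fun n => c *: p_ n + q_ n).
    by move=> n; exact: grad_c_lin.
  split.
    exact: (hcvgD hS (hcvgZ hS c p1) q1).
  exact: (hcvgD hV (hcvgZ hV c p2) q2).
have /choice[q_ hq] n : exists q, gradc q /\ nmv (w_ n - q.2) <= harmonic n.
  have [f [_ /(_ (harmonic n) (harmonic_gt0 _))[phi [d [h1 _ h2]]]]] := hw n.
  by exists (phi, d); split => //; exact: ltW.
have q2 : hcvg ip (fun n => (q_ n).2) l.
  apply: squeeze0 (cvg0D (@cvg_harmonic R) hl) => n; rewrite sqrtr_ge0 /=.
  rewrite (le_trans (nm_tri hV (w_ n) _ _))// lerD// (nmB hV).
  by case: (hq n).
have [B B0 hB] := grad_poincare.
have [f hf] : exists f, hcvg ips (fun n => (q_ n).1) f.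
  apply: (hcvg_cauchy hS (d := fun n => B * nmv ((q_ n).2 - l))).
    by rewrite -[X in _ --> X](mulr0 B); apply: cvgM; [exact: cvg_cst|exact: q2].
  move=> m n; rewrite -mulrDr.
  have h : gradc ((q_ m).1 - (q_ n).1, (q_ m).2 - (q_ n).2).
    have := grad_c_lin (-1) (proj1 (hq n)) (proj1 (hq m)).
    by rewrite scaleN1r addrC.
  apply: (le_trans (hB _ _ h)); apply: ler_wpM2l; first exact: B0.
  rewrite [nmv ((q_ n).2 - l)](nmB hV); exact: (nm_tri hV l).
by exists f; apply/grad0P; exists q_ => // n; case: (hq n).
Qed.

Lemma ker_divE p : ker div p <-> orth ip G p.
Proof.
split=> [h w [f /grad0P[q_ hq [_ q2]]]|h phi d hd].
  apply: (ip_eq0C hV); apply: (hcvg_ip0 hV q2) => n.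
  have := hq n; rewrite (surjective_pairing (q_ n)) => /h /=.
  by rewrite (ip0r hS) oppr0 => /(ip_eq0C hV).
rewrite /= (ip0r hS) oppr0; apply: h; exists phi; exact: grad_c_grad0.
Qed.

Lemma ker_curl0E p : ker curl0 p <-> orth ip C p.
Proof.
split=> [h w [v hv]|h v w hv]; first by have := h v w hv; rewrite /= (ip0r hV).
by rewrite /= (ip0r hV); apply: h; exists v.
Qed.

Lemma curl_c_curl0 p : curlc p -> curl0 p.
Proof.
move=> h v w /= hv; case: p h => phi d /hv /= e.
by rewrite (ip_conj hV phi) -e -(ip_conj hV).
Qed.

Lemma curl0_closed : hclosed (ip2 ip) curl0.
Proof.
split; [move=> v w _|move=> c p q hp hq v w hv|move=> p_ l hp /(hcvg2 hV)[h1 h2] v w hv].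
- by rewrite /= !(ip0r hV).
- by rewrite /= !(ipDr hV) !(ipZr hV) (hp _ _ hv) (hq _ _ hv).
apply: (lim_eqK (hcvg_ipr hV (phi := w) h1) (hcvg_ipr hV (phi := v) h2)) => n.
exact: hp hv.
Qed.

(** [curl] is the adjoint of [curl_c] and [curl0] that of [curl], so the double adjoint theorem
    applies; estimates for [curl0] reduce to test fields. *)
Lemma curl0_approx w c : curl0 (w, c) -> exists2 p_ : nat -> Lv * Lv, (forall n, curlc (p_ n)) &
  hcvg (ip2 ip) p_ (w, c).
Proof.
move=> h; apply: (double_adjoint hV) => [|s p q|x y hxy]; first exact: curl_c0.
  exact: curl_c_lin.
by apply: (h x y) => phi d /hxy.
Qed.

Lemma ker_curl_closed : hclosed ip (ker curl).
Proof.
rewrite (_ : ker _ = orth ip (ran curlc)); first exact: (hclosed_orth hV).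
apply/seteqP; split=> [x h d [phi hd]|x h phi d hd].
  by have := h _ _ hd; rewrite /= (ip0r hV).
by rewrite /= (ip0r hV); apply: h; exists phi.
Qed.

Lemma curlB p q : curl p -> curl q -> curl (p - q :> Lv * Lv).
Proof. by move=> hp hq phi d h; rewrite /= !(ipBr hV) (hp _ _ h) (hq _ _ h). Qed.

(** Removing the component in [ker curl] does not change the curl, so testing with [curl_red]
    reaches all of [ran curl]. *)
Lemma ran_curl_red w : C w -> exists v, curl_red (v, w) :> Prop.
Proof.
move=> [v hv]; set W := ker curl.
exists (v - pr ip W v); split.
  have e : (v, w) - (pr ip W v, 0) = (v - pr ip W v, w) :> Lv * Lv by congr pair; rewrite subr0.
  by rewrite /= -e; apply: curlB hv _; exact: (pr_in hV ker_curl_closed v).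
by move=> z hz; exact: (pr_orth hV ker_curl_closed).
Qed.

End operators.

(** * The Maxwell estimate *)

Section curl_estimate.
Variables (R : realType) (k : scalars) (Om : set (R3 R)) (oOm : open Om).
Hypotheses (bOm : bounded_set Om) (lipOm : lipschitz_boundary Om).
Local Notation K := (scal R k).
Local Notation P := (R3 R).
Local Notation u := (unitv R).
Local Notation D i f := ('D_(u i) f).
Local Notation Lv := (L2v k oOm).
Local Notation re f := (fun x => reK (f x)).
Local Notation im f := (fun x => imK (f x)).
Local Notation ip := (@ip R k Om oOm).
Local Notation nmv := (hnrm ip).
Local Notation hV := (hilbert_ip k oOm).
Local Notation curlc := (@curl_c R k Om oOm).
Local Notation curl := (@curl R k Om oOm).
Local Notation curl0 := (@curl0 R k Om oOm).
Local Notation G := (ran (@grad0 R k Om oOm)).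
Local Notation C := (ran curl).
Local Notation test phi := (forall i, Cc_infty Om (phi i)).
Local Notation rev phi := (fun i x => reK (phi i x)).
Local Notation imv phi := (fun i x => imK (phi i x)).
Implicit Types phi psi : 'I_3 -> P -> K.

Lemma mkK_lin (c : K) (a b a' b' : R) :
  mkK k (reK c * a + (- imK c * b + a')) (reK c * b + (imK c * a + b')) = c * mkK k a b +
    mkK k a' b'.
Proof.
case: (k) c => [c|[c1 c2]] /=; first by rewrite oppr0 mul0r add0r.
by apply/eqP; rewrite eq_complex /=; apply/andP; split; apply/eqP; ring.
Qed.

Lemma imK_mk (a b : R) : (k = RealScalars -> b = 0) -> imK (mkK k a b) = b.
Proof. by case: (k) => //= ->. Qed.

Lemma imK_real (z : K) : k = RealScalars -> imK z = 0.
Proof. by case: (k) z. Qed.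

Lemma test_re phi : test phi -> forall i, Cc Om (rev phi i).
Proof. by move=> h i; have /Cc_inftyE[] := h i. Qed.

Lemma test_im phi : test phi -> forall i, Cc Om (imv phi i).
Proof. by move=> h i; have /Cc_inftyE[] := h i. Qed.

Lemma sqr_nmv_test v phi : test phi -> representsv v phi -> nmv v ^+ 2 = N2 (rev phi) +
  N2 (imv phi).
Proof. by move=> h hv; apply: sqr_nmv => // i; exact: Cc_infty_nicek. Qed.

(** The functional acts on real fields; applied to real and imaginary parts it becomes linear over
    the scalar field ([mkK_lin]), and Riesz represents it by an L_2 field. *)
Lemma test_functional (l : ('I_3 -> P -> R) -> R) (B : R) : 0 <= B ->
  (forall (c : R) w w', (forall i, Cc Om (w i)) -> (forall i, Cc Om (w' i)) ->
      l (fun i x => c * w i x + w' i x) = c * l w + l w') ->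
  (forall w, (forall i, Cc Om (w i)) -> l w ^+ 2 <= B * N2 w) ->
  exists b : Lv, forall phi v, test phi -> representsv v phi ->
    ip b v = mkK k (l (rev phi)) (l (imv phi)).
Proof.
move=> B0 llin lB.
pose L (v : Lv) (s : K) := exists phi, [/\ test phi, representsv v phi &
  s = mkK k (l (rev phi)) (l (imv phi))].
have le_sq (x y : R) : 0 <= y -> x ^+ 2 <= y ^+ 2 -> x <= y.
  move=> y0 h; have [//|yx] := leP x y.
  by move: h; rewrite leNgt ltr_pXn2r ?nnegrE// ?yx// (le_trans y0 (ltW yx)).
have lbound phi v : test phi -> representsv v phi -> l (rev phi) <= Num.sqrt B * nmv v.
  move=> h hv; apply: le_sq; first by rewrite mulr_ge0 ?sqrtr_ge0.
  rewrite exprMn sqr_sqrtr// (sqr_nmv_test h hv) (le_trans (lB _ (test_re h)))//.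
  by rewrite ler_wpM2l// lerDl N2_ge0.
have [|c v s v' s' [phi [h1 h2 ->]] [psi [g1 g2 ->]]|v s [phi [h1 h2 ->]]|b [_ hb]] :=
  @riesz _ _ _ _ hV L (Num.sqrt B).
- exists (fun _ => fun=> 0); split=> [i|i|]; first exact: Cc_infty0.
    by rewrite ffunE; exact: represents0.
  have z : N2 (fun (_ : 'I_3) (_ : P) => 0 : R) = 0.
    by rewrite /N2 big1// => i _; under eq_fun do rewrite expr0n; exact: I30.
  have l0 : l (fun (_ : 'I_3) (_ : P) => 0 : R) = 0.
    have := lB (fun (_ : 'I_3) (_ : P) => 0 : R) (fun _ => Cc0 Om); rewrite z mulr0 => h.
    by apply/eqP; rewrite -sqrf_eq0 eq_le h sqr_ge0.
  have -> : (fun (_ : 'I_3) (_ : P) => reK (0 : K)) = fun _ _ => 0.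
    by apply/funext => i; apply/funext => x; exact: reK0.
  have -> : (fun (_ : 'I_3) (_ : P) => imK (0 : K)) = fun _ _ => 0.
    by apply/funext => i; apply/funext => x; exact: imK0.
  by rewrite l0 -/(ofR k 0) ofR0.
- exists (fun i x => c * phi i x + psi i x); split.
  + by move=> i; exact: Cc_infty_lin.
  + exact: representsv_lin.
  have -> : (fun i x => reK (c * phi i x + psi i x)) = fun i x =>
     reK c * rev phi i x + (- imK c * imv phi i x + rev psi i x).
    by apply/funext => i; exact: re_lin.
  have -> : (fun i x => imK (c * phi i x + psi i x)) = fun i x =>
     reK c * imv phi i x + (imK c * rev phi i x + imv psi i x).
    by apply/funext => i; exact: im_lin.
  have r1 := test_re h1; have i1 := test_im h1; have r2 := test_re g1; have i2 := test_im g1.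
  rewrite !llin ?mkK_lin// => i.
    by apply: CcD => //; exact: CcZ.
  by apply: CcD => //; exact: CcZ.
- by rewrite reK_mk; exact: lbound h2.
exists b => phi v h hv; rewrite (hb v (mkK k (l (rev phi)) (l (imv phi))))//.
by exists phi.
Qed.

(** The field [sw] is [w] multiplied by the sum [S] of the bumps, and [g] the gradient close to it.
    Since [S >= 1] on the support of [w], the scalar product with [sw] dominates the squared norm.
    Real and imaginary parts are treated separately and recombined in one potential. *)
Lemma curl_estimate_test : exists (T : finType) (b : T -> Lv) (B M : R), [/\ 0 <= B, 0 <= M &
  forall w c d, curlc (w, c) -> 0 < d -> exists sw g, [/\ G g, nmv sw <= M * nmv w,
    nmv w ^+ 2 <= reK (ip w sw) &
    nmv (sw - g) ^+ 2 <= 4^-1 * nmv w ^+ 2 + B * (nmv c ^+ 2 + \sum_t sqK (ip (b t) w)) + d]].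
Proof.
have [S [sS [M hM] S1 gS]] := partition_near_gradient oOm bOm lipOm.
(* Any value small enough to be absorbed by the left-hand side would do; with this one [limit_bound]
   ends in the factor [4 / 3]. *)
have e4 : 0 < (4^-1 : R) by rewrite invr_gt0.
have [T [l [B [B0 llin lB hl]]]] := gS _ e4.
have /choice[b hb] t := test_functional B0 (llin t) (lB t).
have M0 : 0 <= M := le_trans (normr_ge0 _) (hM 0).
exists T, b, B, M; split => // w c d [phi [tphi /= hw hc]] d0.
have r1 := test_re tphi; have i1 := test_im tphi.
have im0 : k = RealScalars -> imv phi = fun _ _ => 0.
  by move=> kr; apply/funext => i; apply/funext => x; exact: imK_real.
have d2 : 0 < d / 2 by lra.
have [U1 cU1 hU1] := hl _ _ r1 d2; have [U2 cU2 hU2] := hl _ _ i1 d2.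
pose U x := mkK k (U1 x) (U2 x); have cU : Cc_infty Om U := Cc_infty_mk k cU1 cU2.
have [Uv hUv] := represents_test oOm cU.
have nU i : nicek Om (partial i U) by apply: Cc_infty_nicek; exact: Cc_infty_partial.
have [g hg] := representsv_test oOm nU.
pose Sphi i x := ofR k (S x) * phi i x.
have reS i : re (Sphi i) = fun x => S x * reK (phi i x).
  by apply/funext => x; rewrite /Sphi !(reKE, imKE) mul0r subr0.
have imS i : im (Sphi i) = fun x => S x * imK (phi i x).
  by apply/funext => x; rewrite /Sphi !(reKE, imKE) mul0r addr0.
have tS i : Cc_infty Om (Sphi i).
  by apply/Cc_inftyE; rewrite reS imS; split; exact: CcMl.
have nS i := Cc_infty_nicek (tS i); have nphi i := Cc_infty_nicek (tphi i).
have [sw hsw] := representsv_test oOm nS.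
have SM (f : P -> R) : BM f -> I3 (fun x => (S x * f x) ^+ 2) <= M ^+ 2 * I3 (fun x => f x ^+ 2).
  move=> bf; apply: (I3_mul_avg 0 0 (h := S) (M := M)) => //.
  exact: continuous_measurable3 (smooth_continuous sS).
exists sw, g; split.
- by exists Uv; apply: grad_c_grad0; exists U.
- rewrite -(ler_pXn2r (n := 2)) ?nnegrE ?mulr_ge0 ?sqrtr_ge0// exprMn.
  rewrite (sqr_nmv hsw nS) (sqr_nmv hw nphi) mulrDr /N2 !mulr_sumr.
  apply: lerD; apply: ler_sum => i _.
    by rewrite (_ : (fun x => _) = fun x => (S x * reK (phi i x)) ^+ 2) ?SM//;
      [exact: Cc_BM (r1 i)|apply/funext => x; rewrite (congr1 (@^~ x) (reS i))].
  by rewrite (_ : (fun x => _) = fun x => (S x * imK (phi i x)) ^+ 2) ?SM//;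
    [exact: Cc_BM (i1 i)|apply/funext => x; rewrite (congr1 (@^~ x) (imS i))].
- rewrite (reK_ip_rep hw hsw nphi nS) (sqr_nmv hw nphi) /N2 -big_split/=.
  apply: ler_sum => i _.
  have key (f : P -> R) : Cc Om f -> I3 (fun x => f x ^+ 2) <= I3 (fun x => f x * (S x * f x)).
    move=> cf; have bf := Cc_BM cf; apply: le_I3; first exact: BMX2.
      by apply: BMM => //; apply: (@Cc_BM _ Om); exact: CcMl.
    move=> x; rewrite mulrCA -expr2; have [->|fx] := eqVneq (f x) 0; first by rewrite expr0n mulr0.
    rewrite ler_peMl ?sqr_ge0// S1//.
    by case: cf => _ [Kc _ [KO hK]]; exact/KO/hK.
  apply: lerD.
    apply: (le_trans (key _ (r1 i))); rewrite le_eqVlt; apply/orP; left; apply/eqP.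
    by congr I3; apply/funext => x; rewrite (congr1 (@^~ x) (reS i)).
  apply: (le_trans (key _ (i1 i))); rewrite le_eqVlt; apply/orP; left; apply/eqP.
  by congr I3; apply/funext => x; rewrite (congr1 (@^~ x) (imS i)).
have nSU i : Cc_infty Om (fun x => -1 * partial i U x + Sphi i x).
  by apply: Cc_infty_lin => //; exact: Cc_infty_partial.
have hsg : representsv (sw - g) (fun i x => -1 * partial i U x + Sphi i x).
  by have := representsv_lin (-1) hg hsw; rewrite scaleN1r addrC.
rewrite (sqr_nmv_test nSU hsg).
have q1 : N2 (rev (fun i x => -1 * partial i U x + Sphi i x)) =
    \sum_a I3 (fun x => (S x * rev phi a x - D a U1 x) ^+ 2).
  apply: eq_bigr => i _; congr I3; apply/funext => x; congr (_ ^+ 2).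
  rewrite mulN1r reKD reKN (congr1 (@^~ x) (reS i)) (congr1 (@^~ x) (re_partial i U)).
  by rewrite /U re_mk addrC.
have q2 : N2 (imv (fun i x => -1 * partial i U x + Sphi i x)) <=
    4^-1 * N2 (imv phi) + B * (N2 (curlR (imv phi)) + \sum_t l t (imv phi) ^+ 2) + d / 2.
  (* Over the reals [mkK] has dropped [U2], and the imaginary part of the difference is simply 0. *)
  have [kr|kc] : k = RealScalars \/ k = ComplexScalars by case: (k); [left|right].
    rewrite (_ : N2 _ = 0); last first.
      rewrite /N2 big1// => i _; rewrite (_ : (fun x => _) = fun=> 0) ?I30//.
      by apply/funext => x; rewrite imK_real// expr0n.
    rewrite addr_ge0 ?(ltW d2)// addr_ge0 ?mulr_ge0 ?(ltW e4) ?N2_ge0//.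
    by rewrite addr_ge0 ?N2_ge0// sumr_ge0// => t _; exact: sqr_ge0.
  apply: (le_trans _ hU2); rewrite le_eqVlt; apply/orP; left; apply/eqP.
  apply: eq_bigr => i _; congr I3; apply/funext => x; congr (_ ^+ 2).
  rewrite mulN1r imKD imKN (congr1 (@^~ x) (imS i)) (congr1 (@^~ x) (im_partial i U)).
  rewrite (_ : im U = U2) 1?addrC//; apply/funext => y; rewrite /U imK_mk//.
  by rewrite kc.
rewrite q1; apply: (le_trans (lerD hU1 q2)).
have cE : nmv c ^+ 2 = N2 (curlR (rev phi)) + N2 (curlR (imv phi)).
  have tc i : Cc_infty Om (fun x => partial (i + 1) (phi (i + 2)) x - partial (i +
    2) (phi (i + 1)) x).
    have := Cc_infty_lin (-1) (Cc_infty_partial (i + 2) (tphi (i + 1))) (Cc_infty_partial (i +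
      1) (tphi (i + 2))).
    by congr Cc_infty; apply/funext => x; rewrite mulN1r addrC.
  rewrite (sqr_nmv_test tc hc); congr (_ + _); apply: eq_bigr => i _; congr I3;
    apply/funext => x; congr (_ ^+ 2).
    by rewrite reKB /curlR (congr1 (@^~ x) (re_partial _ _)) (congr1 (@^~ x) (re_partial (i +
      2) _)).
  by rewrite imKB /curlR (congr1 (@^~ x) (im_partial _ _)) (congr1 (@^~ x) (im_partial (i + 2) _)).
have sE : \sum_t sqK (ip (b t) w) = \sum_t l t (rev phi) ^+ 2 + \sum_t l t (imv phi) ^+ 2.
  rewrite -big_split; apply: eq_bigr => t _ /=; rewrite (hb t _ _ tphi hw) /sqK reK_mk imK_mk//.
  move=> kr; rewrite (im0 kr).
  have := lB t (fun (_ : 'I_3) (_ : P) => 0 : R) (fun _ => Cc0 Om).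
  rewrite (_ : N2 _ = 0) ?mulr0 => [h|]; first by apply/eqP; rewrite -sqrf_eq0 eq_le h sqr_ge0.
  by rewrite /N2 big1// => i _; under eq_fun do rewrite expr0n; exact: I30.
rewrite cE sE (sqr_nmv hw nphi).
move: (N2 (rev phi)) (N2 (imv phi)) (N2 (curlR _)) (N2 (curlR _)) (\sum_t _) (\sum_t _) =>
  a1 a2 a3 a4 a5 a6.
rewrite le_eqVlt; apply/orP; left; apply/eqP; by field.
Qed.

Lemma sum_sqr_le (I : Type) (s : seq I) (y : I -> R) : (forall i, 0 <= y i) ->
  \sum_(i <- s) y i ^+ 2 <= (\sum_(i <- s) y i) ^+ 2.
Proof.
move=> y0; elim: s => [|i s IH]; first by rewrite !big_nil expr0n.
rewrite !big_cons; have s0 : 0 <= \sum_(j <- s) y j by apply: sumr_ge0.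
have := mulr_ge0 (y0 i) s0; rewrite sqrrD mulr2n; move: IH.
move: (y i ^+ 2) (y i * _) (\sum_(_ <- _) _ ^+ 2) (_ ^+ 2) => *; lra.
Qed.

Lemma cvg_sqK (a : nat -> K) (l : K) : a @ \oo --> l -> (fun n => sqK (a n)) @ \oo --> sqK l.
Proof.
move=> /cvgK[h1 h2]; rewrite /sqK !expr2; under eq_fun do rewrite !expr2.
by apply: cvgD; apply: cvgM.
Qed.

(** In the limit [1 - 1/2 - 1/8 = 3/8] of the squared norm remains on the left, against half of [B]
    times [lX]: hence [4 / 3]. *)
Lemma limit_bound (a X e : nat -> R) (la lX M B : R) : a @ \oo --> la -> X @ \oo --> lX ->
  e @ \oo --> (0 : R) ->
  (forall n, a n ^+ 2 <= 2^-1 * la ^+ 2 + 8^-1 * a n ^+ 2 + 2^-1 * (B * X n) + 2^-1 * harmonic n +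
     M * (e n * a n)) ->
  la ^+ 2 <= 4 / 3 * B * lX.
Proof.
move=> ha hX he key.
have ha2 : (fun n => a n ^+ 2) @ \oo --> la ^+ 2.
  by rewrite expr2; under eq_fun do rewrite expr2; apply: cvgM.
have lim : (fun n => 2^-1 * la ^+ 2 + 8^-1 * a n ^+ 2 + 2^-1 * (B * X n) + 2^-1 * harmonic n +
     M * (e n * a n)) @ \oo --> 2^-1 * la ^+ 2 + 8^-1 * la ^+ 2 + 2^-1 * (B * lX) + 2^-1 * 0 +
       M * (0 * la).
  apply: cvgD; [apply: cvgD; [apply: cvgD; [apply: cvgD|]|]|].
  - exact: cvg_cst.
  - by apply: cvgM; [exact: cvg_cst|].
  - by apply: cvgM; [exact: cvg_cst|apply: cvgM; [exact: cvg_cst|]].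
  - by apply: cvgM; [exact: cvg_cst|exact: cvg_harmonic].
  by apply: cvgM; [exact: cvg_cst|apply: cvgM].
have h : la ^+ 2 <= 2^-1 * la ^+ 2 + 8^-1 * la ^+ 2 + 2^-1 * (B * lX) + 2^-1 * 0 + M * (0 * la).
  by apply: (ler_cvg_to ha2 lim); exact: nearW.
by move: h; rewrite mul0r !mulr0 !addr0 -mulrA; move: (la ^+ 2) (B * lX) => s t; lra.
Qed.

(** Gradients are orthogonal to [w], not to the test fields approximating it. Pairing the limit [w]
    with [sw - g] removes the gradient, and exchanging [w] for its approximation costs a term that
    vanishes in the limit. *)
Lemma curl_estimate : exists (bs : seq Lv) (B : R), 0 <= B /\
  forall w c, curl0 (w, c) -> orth ip G w ->
    nmv w <= B * (nmv c + \sum_(b <- bs) Num.sqrt (sqK (ip b w))).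
Proof.
have [T [b [B [M [B0 M0 h]]]]] := curl_estimate_test.
have B43 : 0 <= 4 / 3 * B by rewrite mulr_ge0// divr_ge0.
exists [seq b t | t <- enum T], (Num.sqrt (4 / 3 * B)); split; first exact: sqrtr_ge0.
move=> w c hwc wG.
have [p_ hp /(hcvg2 hV)[/= p1 p2]] := curl0_approx hwc.
pose X w c := nmv c ^+ 2 + \sum_t sqK (ip (b t) w).
have key n : nmv (p_ n).1 ^+ 2 <= 2^-1 * nmv w ^+ 2 + 8^-1 * nmv (p_ n).1 ^+ 2 +
    2^-1 * (B * X (p_ n).1 (p_ n).2) + 2^-1 * harmonic n + M * (nmv ((p_ n).1 - w) * nmv (p_ n).1).
  have hpn : curlc ((p_ n).1, (p_ n).2) by case: (p_ n) (hp n).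
  have [sw [g [Gg h1 h2 h3]]] := h _ _ _ hpn (harmonic_gt0 n).
  apply: (le_trans h2).
  (* The middle term is zero by orthogonality of [w] to gradients; the last one tends to 0 because
     [sw] is bounded by [M] times the convergent test fields. *)
  have -> : ip (p_ n).1 sw = ip w (sw - g) + ip w g + ip ((p_ n).1 - w) sw.
    by rewrite -(ipDr hV) subrK (ipBl hV) addrC subrK.
  rewrite !reKD (ip_eq0C hV (wG g Gg)) reK0 addr0; apply: lerD; last first.
    apply: (le_trans (rip_le hV _ _)); rewrite mulrCA ler_wpM2l ?sqrtr_ge0//.
  apply: (le_trans (rip_le hV _ _)).
  have := sqr_ge0 (nmv w - nmv (sw - g)); rewrite sqrrB mulr2n.
  move: h3; rewrite -[B * _]/(B * X (p_ n).1 (p_ n).2).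
  move: (nmv w * _) (nmv w ^+ 2) (nmv (sw - g) ^+ 2) (B * _) (nmv (p_ n).1 ^+ 2) (harmonic n).
  by move=> *; lra.
have c1 := hcvg_nm hV p1; have c2 := hcvg_nm hV p2.
have cX : (fun n => X (p_ n).1 (p_ n).2) @ \oo --> X w c.
  apply: cvgD; first by rewrite expr2; under eq_fun do rewrite expr2; exact: (cvgM c2 c2).
  by apply: cvg_sum_seq => t; apply: cvg_sqK; exact: (hcvg_ipr hV p1).
have fin : nmv w ^+ 2 <= 4 / 3 * B * X w c := limit_bound c1 cX p1 key.
rewrite -(ler_pXn2r (n := 2)) ?nnegrE ?mulr_ge0 ?sqrtr_ge0//; last first.
  by rewrite addr_ge0 ?sqrtr_ge0// sumr_ge0// => i _; exact: sqrtr_ge0.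
rewrite exprMn (sqr_sqrtr B43) (le_trans fin)// ler_wpM2l//.
rewrite /X big_map big_enum /=.
have -> : \sum_t sqK (ip (b t) w) = \sum_t Num.sqrt (sqK (ip (b t) w)) ^+ 2.
  by apply: eq_bigr => t _; rewrite sqr_sqrtr// sqK_ge0.
have := @sum_sqr_le _ (index_enum T) (fun t => Num.sqrt (sqK (ip (b t) w))) (fun t => sqrtr_ge0 _).
have s0 : 0 <= \sum_t Num.sqrt (sqK (ip (b t) w)) by apply: sumr_ge0 => t _; exact: sqrtr_ge0.
have := mulr_ge0 (sqrtr_ge0 _ : 0 <= nmv c) s0; rewrite sqrrD mulr2n.
move: (nmv c * _) (nmv c ^+ 2) (\sum_t _ ^+ 2) (_ ^+ 2) => *; lra.
Qed.

(** Finite dimension in the form in which it is used: with vanishing curl only the finitely many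
    functionals remain to bound the norm. *)
Lemma HD_estimate : exists (bs : seq Lv) (B : R), 0 <= B /\
  forall w, HD k oOm w -> nmv w <= B * \sum_(b <- bs) Num.sqrt (sqK (ip b w)).
Proof.
have [bs [B [B0 h]]] := curl_estimate; exists bs, B; split => // w [w1 w2].
have := h w 0 w2 ((ker_divE w).1 w1).
by rewrite (nm0 hV) add0r.
Qed.

(** A closed range argument. Orthogonally to [ker curl0], hence to gradients, [curl_estimate] and
    [bounded_below] bound [w] by its curl alone. For [y] orthogonal to [ker curl0] the scalar
    product with [w] is therefore a bounded functional of the curl of [w], and its Riesz vector is a
    field whose curl is [y]. *)
Lemma ran_curlE : G `<=` ker curl0 -> C = orth ip (ker curl0).
Proof.
move=> GN; apply/seteqP; split=> [w [v hv] z hz|y hy].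
  by apply: (ip_eq0C hV); have := hz v w hv; rewrite /= (ip0r hV) => ->.
have cN : hclosed ip (ker curl0).
  rewrite (_ : ker curl0 = orth ip C); first exact: (hclosed_orth hV).
  by apply/seteqP; split => z /ker_curl0E.
pose E : set (Lv * Lv) := [set p | curl0 p /\ orth ip (ker curl0) p.1].
have [z0 zl zc] := curl0_closed k oOm.
have cE : hclosed (ip2 ip) E.
  have [k0 kl kc] := hclosed_orth hV (ker curl0).
  split; first by split.
    by move=> s p q [p1 p2] [q1 q2]; split; [exact: zl|exact: kl].
  move=> p_ l hp hl; split; first by apply: zc hl => n; case: (hp n).
  by have [hl1 _] := (hcvg2 hV _ _).1 hl; apply: kc hl1 => n; case: (hp n).
have [bs [B [B0 hB]]] := curl_estimate.
have [||B' B0' hB'] := bounded_below hV (bs := bs) (D := E) (C := B) cE B0.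
- by move=> w c [hw ow]; apply: hB hw _ => g /GN Ng; exact: ow.
- by move=> w [hw ow]; exact: (orth_self hV hw ow).
have curl0B w c z : curl0 (w, c) -> ker curl0 z -> curl0 (w - z, c).
  move=> h1 h2; have := zl (-1) _ _ h2 h1; rewrite scaleN1r => h.
  by have -> : (w - z, c) = - (z, 0) + (w, c) by congr pair; rewrite /= ?oppr0 ?add0r// addrC.
have [|c v s v' s' [w [hw ->]] [w' [hw' ->]]|v s [w [hw ->]]|b [_ hb]] :=
  @riesz _ _ _ _ hV (fun v s => exists w, curl0 (w, v) /\ s = ip y w) (nmv y * B').
- by exists 0; split => //; rewrite (ip0r hV).
- exists (c *: w + w'); split; first exact: (zl c _ _ hw hw').
  by rewrite (ipDr hV) (ipZr hV).
(* Passing to the component of [w] orthogonal to [ker curl0] changes neither its curl nor its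
   product with [y]. *)
- have e : ip y w = ip y (w - pr ip (ker curl0) w).
    by rewrite (ipBr hV) (ip_eq0C hV (hy _ (pr_in hV cN w))) subr0.
  rewrite e (le_trans (rip_le hV _ _))// -mulrA ler_wpM2l ?sqrtr_ge0//.
  apply: hB'; split; first exact: curl0B hw (pr_in hV cN w).
  exact: (pr_orth hV cN).
exists b => phi d hd /=.
have hd0 := curl_c_curl0 hd.
have e : ip y phi = ip b d by apply: hb; exists phi.
by rewrite (ip_conj hV b d) -e -(ip_conj hV).
Qed.

End curl_estimate.

(** * Block operators *)

Section block_operators.
Variables (R : realType) (k : scalars).
Local Notation K := (scal R k).
Variables (V : lmodType K) (ip : V -> V -> K) (hV : hilbert ip).
Local Notation nm := (hnrm ip).
Local Notation pr := (pr ip).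
Implicit Types (a b : V -> V) (x y z E : V).

Definition lin a := forall (c : K) x y, a (c *: x + y) = c *: a x + a y.

(* The existence of an adjoint replaces boundedness. *)
Definition coercive a (c : R) := (exists a' : V -> V, forall x y, ip (a' x) y = ip x (a y)) /\
  forall x, c * nm x ^+ 2 <= reK (ip x (a x)).

Lemma linD a x y : lin a -> a (x + y) = a x + a y.
Proof. by move=> h; have := h 1 x y; rewrite !scale1r. Qed.

Lemma lin0 a : lin a -> a 0 = 0.
Proof. by move=> h; have := linD 0 0 h; rewrite addr0 -{1}[a 0]addr0 => /addrI. Qed.

Lemma linN a x : lin a -> a (- x) = - a x.
Proof. by move=> h; apply/eqP; rewrite -addr_eq0 -linD// addNr lin0. Qed.

Lemma linB a x y : lin a -> a (x - y) = a x - a y.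
Proof. by move=> h; rewrite linD// linN. Qed.

Lemma coercive_inj a c x : 0 < c -> coercive a c -> ip x (a x) = 0 -> x = 0.
Proof.
move=> c0 [_ h] e; have := h x; rewrite e reK0 => h0; apply/(nm_eq0 hV)/eqP.
by rewrite -sqrf_eq0 eq_le sqr_ge0 andbT -(pmulr_rle0 _ c0).
Qed.

Lemma coercive_solve a c (W : set V) p : 0 < c -> hclosed ip W -> coercive a c ->
  exists2 y, W y & forall w, W w -> ip w (a y) = ip w p.
Proof.
move=> c0 cW [[a' h] hc]; have [|y Wy hy] := laxmilgram hV cW p c0 h; last by exists y.
by move=> w _; exact: hc.
Qed.

Variables (al be : R) (al0 : 0 < al) (be0 : 0 < be).

Definition mop a b := [/\ lin a /\ lin b, cancel a b, cancel b a, coercive a al & coercive b be^-1].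

Variables (H0 : set V) (cH0 : hclosed ip H0).
Local Notation H1 := (orth ip H0).
Local Notation P0 := (pr H0).
Local Notation P1 := (pr H1).

Lemma pr_orthE x : P1 x = x - P0 x.
Proof.
apply: (pr_uniq hV (hclosed_orth hV H0)); first exact: (pr_orth hV cH0).
by move=> w hw; rewrite opprB addrC subrK (ip_eq0C hV (hw _ (pr_in hV cH0 x))).
Qed.

Lemma pr_split x : x = P0 x + P1 x.
Proof. by rewrite pr_orthE addrC subrK. Qed.

Lemma H1_ip x y : H0 x -> H1 y -> ip x y = 0.
Proof. by move=> hx; apply. Qed.

Lemma H0_ip x y : H1 x -> H0 y -> ip x y = 0.
Proof. by move=> hx hy; apply: (ip_eq0C hV); exact: hx. Qed.

Lemma P0_H1 x : H1 x -> P0 x = 0.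
Proof. exact: (pr_of_orth hV cH0). Qed.

Lemma P1_H0 x : H0 x -> P1 x = 0.
Proof. by move=> hx; rewrite pr_orthE (pr_id hV cH0 hx) subrr. Qed.

Let in0 x : H0 (P0 x) := pr_in hV cH0 x.
Let in1 x : H1 (P1 x) := pr_in hV (hclosed_orth hV H0) x.

(** The inverse of the block [a_00]; for the form of L_2 it is convertible to [inv00]. *)
Definition cinv a x : V := xget 0 [set y | H0 y /\ P0 (a y) = x].

Lemma P0_eqP x y : H0 y -> (P0 x = y <-> forall w, H0 w -> ip w x = ip w y).
Proof.
move=> hy; split=> [<- w hw|h]; first by rewrite (ip_prr hV cH0).
apply: (pr_uniq hV cH0) => // w hw.
by rewrite (ipBr hV) h// subrr.
Qed.

Lemma cinvP a x : lin a -> coercive a al -> H0 x ->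
  [/\ H0 (cinv a x), P0 (a (cinv a x)) = x & forall y, H0 y -> P0 (a y) = x -> y = cinv a x].
Proof.
move=> la ca hx; have [y Hy hy] := coercive_solve x al0 cH0 ca.
have [h1 h2] : [set y | H0 y /\ P0 (a y) = x] (cinv a x).
  by apply: xgetPex; exists y; split => //; apply/P0_eqP.
split => // z hz ez; apply/subr0_eq/(coercive_inj al0 ca).
have hd : H0 (z - cinv a x) by exact: (hclosedB cH0).
rewrite -(ip_prr hV cH0 _ hd) (linB _ _ la) (prB hV cH0) ez h2 subrr; exact: (ip0r hV).
Qed.

Definition Phi a E := P0 (a E) + P1 E.
Definition Psi a E := P0 E + P1 (a E).
(* The four blocks are the maps that define the nonlocal H-topology. *)
Definition Bop a y := (cinv a (P0 y) - cinv a (P0 (a (P1 y)))) +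
  (P1 (a (cinv a (P0 y))) + (P1 (a (P1 y)) - P1 (a (cinv a (P0 (a (P1 y))))))).

Let c1 := hclosed_orth hV H0.

Lemma P0_sum x y : H0 x -> H1 y -> P0 (x + y) = x.
Proof. by move=> hx hy; rewrite (prD hV cH0) (pr_id hV cH0 hx) P0_H1 ?addr0. Qed.

Lemma P1_sum x y : H0 x -> H1 y -> P1 (x + y) = y.
Proof. by move=> hx hy; rewrite (prD hV c1) (pr_id hV c1 hy) P1_H0 ?add0r. Qed.

Lemma P0_Phi a E : P0 (Phi a E) = P0 (a E). Proof. exact: P0_sum. Qed.
Lemma P1_Phi a E : P1 (Phi a E) = P1 E. Proof. exact: P1_sum. Qed.
Lemma P0_Psi a E : P0 (Psi a E) = P0 E. Proof. exact: P0_sum. Qed.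
Lemma P1_Psi a E : P1 (Psi a E) = P1 (a E). Proof. exact: P1_sum. Qed.

Lemma PhiB a x y : lin a -> Phi a (x - y) = Phi a x - Phi a y.
Proof. by move=> la; rewrite /Phi (linB _ _ la) (prB hV cH0) (prB hV c1) opprD addrACA. Qed.
Lemma PsiB a x y : lin a -> Psi a (x - y) = Psi a x - Psi a y.
Proof. by move=> la; rewrite /Psi (linB _ _ la) (prB hV cH0) (prB hV c1) opprD addrACA. Qed.
Lemma PhiD a x y : lin a -> Phi a (x + y) = Phi a x + Phi a y.
Proof. by move=> la; rewrite /Phi (linD _ _ la) (prD hV cH0) (prD hV c1) addrACA. Qed.
Lemma PsiD a x y : lin a -> Psi a (x + y) = Psi a x + Psi a y.
Proof. by move=> la; rewrite /Psi (linD _ _ la) (prD hV cH0) (prD hV c1) addrACA. Qed.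

(** Block elimination: the first row is solved for [P0 E] in terms of [P0 (a E)] and [P1 E], and the
    result is inserted into the second row. *)
Lemma Psi_Bop a E : lin a -> coercive a al -> Psi a E = Bop a (Phi a E).
Proof.
move=> la ca; rewrite /Bop P0_Phi P1_Phi.
have [h1 e1 _] := cinvP la ca (in0 (a E)).
have [h2 e2 _] := cinvP la ca (in0 (a (P1 E))).
set y1 := cinv a (P0 (a E)) in h1 e1 *; set y2 := cinv a _ in h2 e2 *.
have e : P0 E = y1 - y2.
  apply/subr0_eq/(coercive_inj al0 ca).
  have hd : H0 (P0 E - (y1 - y2)) by apply: (hclosedB cH0) => //; exact: (hclosedB cH0).
  rewrite -(ip_prr hV cH0 _ hd) !(linB _ _ la) !(prB hV cH0) e1 e2.
  have eE : P0 (a E) = P0 (a (P0 E)) + P0 (a (P1 E)) by rewrite -(prD hV cH0) -(linD _ _ la)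
    -pr_split.
  by rewrite eE addrK subrr; exact: (ip0r hV).
rewrite /Psi e; congr (_ + _).
by rewrite {1}(pr_split E) e (linD _ _ la) (linB _ _ la) (prD hV c1) (prB hV c1) addrAC addrA.
Qed.

Lemma Phi_surj a y : lin a -> coercive a al -> exists E, Phi a E = y.
Proof.
move=> la ca.
have [h1 e1 _] := cinvP la ca (in0 y).
have [h2 e2 _] := cinvP la ca (in0 (a (P1 y))).
exists (cinv a (P0 y) - cinv a (P0 (a (P1 y))) + P1 y).
rewrite /Phi P1_sum//; last exact: (hclosedB cH0).
rewrite (linD _ _ la) (linB _ _ la) (prD hV cH0) (prB hV cH0) e1 e2 subrK.
by rewrite -pr_split.
Qed.

(** Both [Phi] and [Psi] have squared norm at most that of [E] plus that of [a E]. The two summands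
    are controlled by the coercivity of [a] and of its inverse, whence the minimum and the factor
    2. *)
Let c := Num.min al be^-1 / 2.

Lemma c_gt0 : 0 < c.
Proof. by rewrite divr_gt0// lt_min al0 invr_gt0. Qed.

Lemma ip_Phi_Psi a E : reK (ip (Phi a E) (Psi a E)) = reK (ip E (a E)).
Proof.
rewrite /Phi /Psi (ipDl hV) !(ipDr hV) (H1_ip (in0 _) (in1 _)) (H0_ip (in1 _) (in0 _)) addr0 add0r.
rewrite {5}(pr_split E) {3}(pr_split (a E)) (ipDl hV) !(ipDr hV) (H1_ip (in0 _) (in1 _)) (H0_ip
  (in1 _) (in0 _)).
by rewrite addr0 add0r !reKD (ripC hV).
Qed.

Lemma Phi_Psi_coercive a b E : mop a b -> c * nm (Phi a E) ^+ 2 <= reK (ip (Phi a E) (Psi a E)) /\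
  c * nm (Psi a E) ^+ 2 <= reK (ip (Phi a E) (Psi a E)).
Proof.
move=> [[la lb] ab ba [_ ca] [_ cb]]; rewrite ip_Phi_Psi.
have h1 := ca E; have h2 := cb (a E); rewrite ab (ripC hV) in h2.
have pyth x y : nm (P0 x + P1 y) ^+ 2 = nm (P0 x) ^+ 2 + nm (P1 y) ^+ 2.
  by rewrite (sqr_nmD hV) (H1_ip (in0 _) (in1 _)) reK0 mulr0 addr0.
have n0 x : nm (P0 x) ^+ 2 <= nm x ^+ 2.
  by rewrite ler_pXn2r ?nnegrE ?sqrtr_ge0// (nm_pr hV cH0).
have n1 x : nm (P1 x) ^+ 2 <= nm x ^+ 2.
  by rewrite ler_pXn2r ?nnegrE ?sqrtr_ge0// (nm_pr hV c1).
have m0 : 0 <= Num.min al be^-1 by rewrite ltW// lt_min al0 invr_gt0.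
have m1 : Num.min al be^-1 * nm E ^+ 2 <= reK (ip E (a E)).
  by rewrite (le_trans _ h1)// ler_wpM2r ?sqr_ge0// ge_min lexx.
have m2 : Num.min al be^-1 * nm (a E) ^+ 2 <= reK (ip E (a E)).
  by rewrite (le_trans _ h2)// ler_wpM2r ?sqr_ge0// ge_min lexx orbT.
have key r : r <= nm E ^+ 2 + nm (a E) ^+ 2 -> c * r <= reK (ip E (a E)).
  move=> hr; rewrite /c mulrAC ler_pdivrMr// (le_trans (ler_wpM2l m0 hr))//.
  by rewrite mulrDr; move: m1 m2; move: (_ * _) (_ * _) (reK _) => *; lra.
split; apply: key; rewrite pyth; [rewrite addrC|]; exact: lerD.
Qed.

Lemma Psi_le a b E : mop a b -> nm (Psi a E) <= c^-1 * nm (Phi a E).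
Proof.
move=> h; have [_ h2] := Phi_Psi_coercive E h.
have := le_trans h2 (rip_le hV _ _); rewrite expr2 mulrA mulrC.
have [->|p0] := eqVneq (nm (Psi a E)) 0.
  by move=> _; rewrite mulr_ge0 ?sqrtr_ge0// invr_ge0 ltW// c_gt0.
rewrite [nm (Phi a E) * _]mulrC ler_pM2l; last by rewrite lt_def p0 sqrtr_ge0.
by move=> l; rewrite mulrC ler_pdivlMr ?c_gt0// mulrC.
Qed.

Definition wcvg (x_ : nat -> V) x := forall phi, (fun n => ip phi (x_ n)) @ \oo --> ip phi x.

Variables (H : set V) (cH : hclosed ip H) (bs : seq V) (Bd : R) (Bd0 : 0 <= Bd).
Hypothesis H_finite : forall w, H w -> nm w <= Bd * \sum_(b <- bs) Num.sqrt (sqK (ip b w)).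

(** On [H] finitely many functionals bound the norm, and the self-adjoint projection moves onto
    them; so weak convergence becomes strong. *)
Lemma pr_H_cvg (r_ : nat -> V) : wcvg r_ 0 -> (fun n => nm (pr H (r_ n))) @ \oo --> (0 : R).
Proof.
move=> hr; apply: (@squeeze0 _ _ (fun n => Bd * \sum_(b <- bs) Num.sqrt (sqK (ip (pr H b) (r_
  n))))).
  move=> n; rewrite sqrtr_ge0 /=; have := H_finite (pr_in hV cH (r_ n)).
  rewrite (eq_bigr (fun e : V => Num.sqrt (sqK (ip (pr H e) (r_ n)))))// => e _.
  by rewrite -(ip_pr hV cH).
rewrite -[X in _ --> X](mulr0 Bd); apply: cvgM; first exact: cvg_cst.
suff h : (fun n => \sum_(b <- bs) Num.sqrt (sqK (ip (pr H b) (r_ n)))) @ \oo -->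
  \sum_(b <- bs) (0 : R).
  by rewrite big1 in h.
apply: cvg_sum_seq => b; have /cvgK[] := hr (pr H b).
rewrite (ip0r hV) reK0 imK0 => h1 h2.
have g : (fun n => `|reK (ip (pr H b) (r_ n))| + `|imK (ip (pr H b) (r_ n))|) @ \oo --> (0 : R).
  by apply: cvg0D; [rewrite -(@normr0 _ R); exact: cvg_norm h1|rewrite -(@normr0 _ R);
    exact: cvg_norm h2].
by apply: squeeze0 g => n; rewrite sqrtr_ge0 /= sqK_le.
Qed.

Variables (G C : set V) (cG : hclosed ip G) (cC : hclosed ip C).
Hypotheses (GH0 : G `<=` H0) (CH1 : C `<=` H1) (HE : H = orth ip G `&` orth ip C).

Lemma GC w z : G w -> C z -> ip w z = 0.
Proof. by move=> /GH0 hw /CH1; apply. Qed.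

Lemma CG w z : C z -> G w -> ip z w = 0.
Proof. by move=> hz hw; apply: (ip_eq0C hV); exact: GC. Qed.

Lemma H_G w z : H z -> G w -> ip w z = 0.
Proof. by rewrite HE => -[h _] /h. Qed.

Lemma H_C w z : H z -> C w -> ip w z = 0.
Proof. by rewrite HE => -[_ h] /h. Qed.

(** The decomposition of the space into [G], [C] and [H]: what projection onto [G] leaves of [y] is
    orthogonal to [G] and [C], hence in [H], but also orthogonal to [H]. *)
Lemma inG y : orth ip C y -> orth ip H y -> G y.
Proof.
move=> yC yH; have Gy := pr_in hV cG y.
have hH : H (y - pr G y).
  rewrite HE; split=> [|w hw]; first exact: (pr_orth hV cG).
  by rewrite (ipBr hV) yC// (CG hw Gy) subrr.
rewrite (_ : y = pr G y)//; apply/subr0_eq/(ip_def hV).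
by rewrite (ipBr hV) yH// (ip_eq0C hV (H_G hH Gy)) subrr reK0.
Qed.

Lemma invr_pos (r : R) : 0 < r -> 0 < r^-1.
Proof. by rewrite invr_gt0. Qed.

(** A first Lax-Milgram problem makes [a (E - w)] orthogonal to [G], a second one makes
    [E - w - b z] orthogonal to [C]. The second correction does not spoil the first, because
    [a (b z) = z] is orthogonal to [G]. *)
Lemma decomp_exists a b E : mop a b -> exists w z h,
  [/\ G w, C z, orth ip G (a h), orth ip C h & E = w + b z + h].
Proof.
move=> [[la lb] ab ba ca cb].
have [w Gw hw] := coercive_solve (a E) al0 cG ca.
have [z Cz hz] := coercive_solve (E - w) (invr_pos be0) cC cb.
exists w, z, (E - w - b z); split => //.
- move=> y Gy; rewrite !(linB _ _ la) ba !(ipBr hV) hw// subrr sub0r (GC Gy Cz); exact: oppr0.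
- by move=> y Cy; rewrite (ipBr hV) hz// subrr.
by rewrite -[E - w - b z]addrA -opprD [RHS]addrC subrK.
Qed.

(** After applying [a], testing with [w] and then with [h] leaves one coercive term each time. *)
Lemma decomp_uniq a b w z h : mop a b -> G w -> C z -> orth ip G (a h) -> orth ip C h ->
  w + b z + h = 0 -> h = 0.
Proof.
move=> [[la lb] ab ba ca cb] Gw Cz hG hC e0.
have ea : a w + z + a h = 0 by rewrite -{1}(ba z) -!linD// e0 lin0.
have w0 : w = 0.
  apply: (coercive_inj al0 ca); have := ip0r hV w.
  by rewrite -ea !(ipDr hV) (GC Gw Cz) (hG _ Gw) !addr0.
apply: (coercive_inj al0 ca); have := ip0r hV h.
by rewrite -ea w0 lin0// add0r (ipDr hV) (ip_eq0C hV (hC _ Cz)) add0r.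
Qed.

(* The normalisation pi_D pi_a E = x, with [b] the inverse of [a]. *)
Definition spans a b E x := exists w z h,
  [/\ G w, C z, orth ip G (a h) /\ orth ip C h, E = w + b z + h & pr H h = x].

(* [(x + w) + b z] is the field E with data [p], [q] and [x]. *)
Definition sol a b p q x w z :=
  [/\ G w, C z, forall y, G y -> ip y (a (x + w)) = ip y p & forall y, C y -> ip y (b z) = ip y q].

(** The component [h] and its projection [x] are both orthogonal to [C], and their difference is
    orthogonal to [H], hence lies in [G]. Moving it into [w] replaces [h], which depends on [a], by
    the fixed vector [x]. *)
Lemma spans_sol a b E p q x : mop a b -> H x -> (forall y, G y -> ip y (a E) = ip y p) ->
  (forall y, C y -> ip y E = ip y q) -> spans a b E x ->
  exists w z, sol a b p q x w z /\ E = (x + w) + b z.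
Proof.
move=> [[la lb] ab ba ca cb] Hx hp hq [w [z [h [Gw Cz [hG hC] eE hx]]]].
have hxG : G (h - x).
  apply: inG; last by rewrite -hx; exact: (pr_orth hV cH).
  by move=> y Cy; rewrite (ipBr hV) hC// (H_C Hx Cy) subrr.
have e : E = (x + (w + (h - x))) + b z.
  by rewrite eE addrAC; congr (_ + _); rewrite addrCA [x + _]addrC subrK.
exists (w + (h - x)), z; split => //; split => //.
- exact: (hclosedD cG).
- by move=> y Gy; rewrite -(hp y Gy) e [in RHS](linD _ _ la) ba (ipDr hV _ _ z) (GC Gy Cz) addr0.
move=> y Cy; have Gs : G (w + (h - x)) by exact: (hclosedD cG).
by rewrite -(hq y Cy) e (ipDr hV y _ (b z)) (ipDr hV y x) (H_C Hx Cy) (CG Cy Gs) !add0r.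
Qed.

(** In the decomposition of [x + w] the [C]-component vanishes, since [x + w] is orthogonal to [C].
    The remaining [h] differs from [x] by an element of [G], which the projection onto [H] does not
    see. *)
Lemma sol_spans a b p q x w z : mop a b -> H x -> sol a b p q x w z ->
  [/\ forall y, G y -> ip y (a ((x + w) + b z)) = ip y p,
      forall y, C y -> ip y ((x + w) + b z) = ip y q & spans a b ((x + w) + b z) x].
Proof.
move=> hm Hx [Gw Cz hp hq]; have [[la lb] ab ba ca cb] := hm; split.
- by move=> y Gy; rewrite (linD _ _ la) ba (ipDr hV) (GC Gy Cz) addr0 hp.
- by move=> y Cy; rewrite !(ipDr hV) (H_C Hx Cy) (CG Cy Gw) !add0r hq.
have [w' [z' [h [Gw' Cz' hG hC e]]]] := decomp_exists (x + w) hm.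
have z0 : z' = 0.
  apply: (coercive_inj (invr_pos be0) cb).
  have : ip z' (x + w) = 0 by rewrite (ipDr hV) (H_C Hx Cz') (CG Cz' Gw) addr0.
  by rewrite e !(ipDr hV) (CG Cz' Gw') (hC _ Cz') add0r addr0.
rewrite z0 lin0// addr0 in e.
exists w', z, h; split => //; first by rewrite e addrAC.
apply: (pr_uniq hV cH) => // y Hy.
have -> : h - x = w - w'.
  by apply/eqP; rewrite subr_eq addrAC [w + x]addrC e [w' + h]addrC addrK.
by rewrite (ipBr hV) !(ip_eq0C hV (H_G Hy _))// subrr.
Qed.

Lemma sol_exists a b p q x : mop a b -> exists w z, sol a b p q x w z.
Proof.
move=> [[la lb] ab ba ca cb].
have [w Gw hw] := coercive_solve (p - a x) al0 cG ca.
have [z Cz hz] := coercive_solve q (invr_pos be0) cC cb.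
exists w, z; split => // y Gy.
by rewrite (linD _ _ la) (ipDr hV) hw// (ipBr hV) addrC subrK.
Qed.

Lemma sol_uniq a b p q x w z w' z' : mop a b -> sol a b p q x w z -> sol a b p q x w' z' ->
  w = w' /\ z = z'.
Proof.
move=> [[la lb] ab ba ca cb] [Gw Cz hp hq] [Gw' Cz' hp' hq']; split; apply/subr0_eq.
  have Gd : G (w - w') by exact: (hclosedB cG).
  apply: (coercive_inj al0 ca); have := hp _ Gd; rewrite -(hp' _ Gd) !(linD _ _ la) (linN _ la).
  rewrite !(ipDr hV) (ipNr hV) => /addrI ->; exact: subrr.
have Cd : C (z - z') by exact: (hclosedB cC).
apply: (coercive_inj (invr_pos be0) cb).
by rewrite (linB _ _ lb) (ipBr hV) hq// hq'// subrr.
Qed.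

(** On [H0] it is [a E] that sits in [Phi], on [H1] it is [E]; this exchange of arguments causes the
    conjugate. *)
Lemma ip_Phi_PsiE a E : ip (a E) E = ip (P0 (Phi a E)) (Psi a E) +
  conjK (ip (P1 (Phi a E)) (Psi a E)).
Proof.
rewrite -(ip_prr hV cH0 _ (in0 _)) -(ip_prr hV c1 _ (in1 _)) P0_Phi P1_Phi P0_Psi P1_Psi
  -(ip_conj hV).
rewrite {1}(pr_split (a E)) (ipDl hV); congr (_ + _).
  by rewrite (ip_prr hV cH0 _ (in0 _)).
by rewrite (ip_prr hV c1 _ (in1 _)).
Qed.

Variables (a_ b_ : nat -> V -> V) (a b : V -> V).
Hypotheses (mop_ : forall n, mop (a_ n) (b_ n)) (mopa : mop a b).
Hypothesis Bop_cvg : forall y, wcvg (fun n => Bop (a_ n) y) (Bop a y).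

Lemma wcvgD (x_ y_ : nat -> V) x y : wcvg x_ x -> wcvg y_ y -> wcvg (fun n => x_ n + y_ n) (x + y).
Proof. by move=> h1 h2 phi; rewrite (ipDr hV); under eq_fun do rewrite (ipDr hV); exact: cvgD. Qed.

Lemma hcvg_wcvg (x_ : nat -> V) x : hcvg ip x_ x -> wcvg x_ x.
Proof. by move=> h phi; exact: (hcvg_ipr hV). Qed.

Lemma block_cvg (E_ : nat -> V) E : (forall n, H (Phi (a_ n) (E_ n) - Phi a E)) ->
  (forall n, ip (Phi (a_ n) (E_ n) - Phi a E) (Psi (a_ n) (E_ n) - Psi a E) = 0) ->
  hcvg ip (fun n => Phi (a_ n) (E_ n)) (Phi a E) /\ wcvg (fun n => Psi (a_ n) (E_ n)) (Psi a E).
Proof.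
move=> hH h0.
(* A comparison field with the same [Phi] as the limit: its [Psi] is [Bop (a_ n)] applied to a fixed
   vector, so the hypothesis on [Bop] applies. *)
have /choice[F hF] n : exists F, Phi (a_ n) F = Phi a E.
  by have [[la _] _ _ ca _] := mop_ n; exact: Phi_surj.
have la n : lin (a_ n) by have [[]] := mop_ n.
have wF : wcvg (fun n => Psi (a_ n) (F n)) (Psi a E).
  have [[la' _] _ _ ca' _] := mopa; rewrite (Psi_Bop _ la' ca') => phi.
  under eq_fun => n do [have [_ _ _ can _] := mop_ n; rewrite (Psi_Bop _ (la n) can) hF].
  exact: Bop_cvg.
pose r n := Psi a E - Psi (a_ n) (F n).
have wr : wcvg r 0.
  move=> phi; rewrite /r (_ : ip phi 0 = ip phi (Psi a E) - ip phi (Psi a E)); last first.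
    by rewrite subrr (ip0r hV).
  under eq_fun do rewrite (ipBr hV).
  by apply: cvgB; [exact: cvg_cst|exact: wF].
pose s n := Phi (a_ n) (E_ n) - Phi a E.
have sE n : s n = Phi (a_ n) (E_ n - F n) by rewrite PhiB// hF.
(* Coercivity for [E_ n - F n]. Of [Psi (E_ n) - Psi (F n)] only [r n] contributes, by the
   orthogonality hypothesis, and only through its projection onto [H], where [s n] lies. *)
have key n : c * nm (s n) <= nm (pr H (r n)).
  have [h1 _] := Phi_Psi_coercive (E_ n - F n) (mop_ n).
  move: h1; rewrite -sE PsiB//.
  have -> : Psi (a_ n) (E_ n) - Psi (a_ n) (F n) = (Psi (a_ n) (E_ n) - Psi a E) + r n.
    by rewrite /r addrA subrK.
  rewrite (ipDr hV) h0 add0r -(ip_prr hV cH _ (hH n)) => h1.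
  have := le_trans h1 (rip_le hV _ _); rewrite expr2 mulrA [_ * nm (s n)]mulrC.
  have [->|s0] := eqVneq (nm (s n)) 0; first by rewrite mulr0 sqrtr_ge0.
  by rewrite ler_pM2l// lt_def s0 sqrtr_ge0.
have sc : (fun n => nm (s n)) @ \oo --> (0 : R).
  apply: (@squeeze0 _ _ (fun n => c^-1 * nm (pr H (r n)))) => [n|].
    by rewrite sqrtr_ge0 /= mulrC ler_pdivlMr ?c_gt0// mulrC.
  by rewrite -[X in _ --> X](mulr0 c^-1); apply: cvgM; [exact: cvg_cst|exact: pr_H_cvg].
split; first exact: sc.
(* The two fields differ by [s n] in [Phi], hence by a strongly vanishing term in [Psi]; the weak
   limit of the comparison fields carries over. *)
have d0 : hcvg ip (fun n => Psi (a_ n) (E_ n - F n)) 0.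
  apply: (@squeeze0 _ _ (fun n => c^-1 * nm (s n))) => [n|].
    by rewrite sqrtr_ge0 /= subr0 sE; exact: Psi_le (mop_ n).
  by rewrite -[X in _ --> X](mulr0 c^-1); apply: cvgM; [exact: cvg_cst|exact: sc].
have := wcvgD (hcvg_wcvg d0) wF; rewrite add0r => h phi.
have := h phi; under eq_fun => n do rewrite PsiB// subrK.
exact.
Qed.

Variables (p q x : V) (Hx : H x) (w_ z_ : nat -> V) (w z : V).
Hypotheses (sol_ : forall n, sol (a_ n) (b_ n) p q x (w_ n) (z_ n)) (sola : sol a b p q x w z).

Lemma sol_block_cvg :
  hcvg ip (fun n => Phi (a_ n) ((x + w_ n) + b_ n (z_ n))) (Phi a ((x + w) + b z)) /\
  wcvg (fun n => Psi (a_ n) ((x + w_ n) + b_ n (z_ n))) (Psi a ((x + w) + b z)).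
Proof.
have la n : lin (a_ n) by have [[]] := mop_ n.
have la' : lin a by have [[]] := mopa.
have [Gw Cz hp hq] := sola; have [_ _ ba _ _] := mopa.
(* Since [w_ n] lies in [H0], the [H1]-component of [Phi] is fixed and its [H0]-component varies
   orthogonally to [G], while the [H0]-component of [Psi] varies inside [G]. *)
have [h1 h2] : hcvg ip (fun n => Phi (a_ n) (x + w_ n)) (Phi a (x + w)) /\
  wcvg (fun n => Psi (a_ n) (x + w_ n)) (Psi a (x + w)).
  have sE n : Phi (a_ n) (x + w_ n) - Phi a (x + w) = P0 (a_ n (x + w_ n) - a (x + w)).
    have [Gn _ _ _] := sol_ n.
    rewrite /Phi !(prD hV c1) (P1_H0 (GH0 Gw)) (P1_H0 (GH0 Gn)) !addr0 (prB hV cH0).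
    by rewrite opprD addrACA subrr addr0.
  have sG n : orth ip G (P0 (a_ n (x + w_ n) - a (x + w))).
    have [Gn _ hpn _] := sol_ n.
    by move=> y Gy; rewrite (ip_prr hV cH0 _ (GH0 Gy)) (ipBr hV) hp// hpn// subrr.
  apply: block_cvg => n; rewrite sE.
    by rewrite HE; split => // y /CH1 y1; exact: H0_ip.
  have [Gn _ _ _] := sol_ n.
  have := sG n; set s := P0 (a_ n _ - _) => sGn; have Hs : H0 s := in0 _.
  rewrite -(ip_prr hV cH0 _ Hs) (prB hV cH0) !P0_Psi -(prB hV cH0) (ip_prr hV cH0 _ Hs).
  have -> : x + w_ n - (x + w) = w_ n - w by rewrite opprD addrACA subrr add0r.
  by apply: (ip_eq0C hV); apply: sGn; exact: (hclosedB cG).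
(* The mirror image with [H0] and [H1] exchanged: [a_ n] maps [b_ n (z_ n)] to [z_ n] in [C], so
   [Phi] varies only in its [H1]-component, orthogonally to [C], and the [H1]-component of [Psi]
   inside [C]. *)
have [g1 g2] : hcvg ip (fun n => Phi (a_ n) (b_ n (z_ n))) (Phi a (b z)) /\
  wcvg (fun n => Psi (a_ n) (b_ n (z_ n))) (Psi a (b z)).
  have ban n : a_ n (b_ n (z_ n)) = z_ n by have [_ _ ban _ _] := mop_ n.
  have sE n : Phi (a_ n) (b_ n (z_ n)) - Phi a (b z) = P1 (b_ n (z_ n) - b z).
    have [_ Cn _ _] := sol_ n.
    by rewrite /Phi ban ba (P0_H1 (CH1 Cn)) (P0_H1 (CH1 Cz)) !add0r (prB hV c1).
  have sC n : orth ip C (P1 (b_ n (z_ n) - b z)).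
    have [_ Cn _ hqn] := sol_ n.
    by move=> y Cy; rewrite (ip_prr hV c1 _ (CH1 Cy)) (ipBr hV) hq// hqn// subrr.
  apply: block_cvg => n; rewrite sE.
    by rewrite HE; split => // y /GH0 y0; exact: H1_ip.
  have [_ Cn _ _] := sol_ n.
  have := sC n; set s := P1 (b_ n _ - _) => sCn; have Hs : H1 s := in1 _.
  rewrite -(ip_prr hV c1 _ Hs) (prB hV c1) !P1_Psi ban ba -(prB hV c1) (ip_prr hV c1 _ Hs).
  by apply: (ip_eq0C hV); apply: sCn; exact: (hclosedB cC).
split.
  rewrite PhiD// (_ : (fun n => _) = fun n => Phi (a_ n) (x + w_ n) + Phi (a_ n) (b_ n (z_ n))).
    exact: (hcvgD hV).
  by apply/funext => n; rewrite PhiD.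
rewrite PsiD// (_ : (fun n => _) = fun n => Psi (a_ n) (x + w_ n) + Psi (a_ n) (b_ n (z_ n))).
  exact: wcvgD.
by apply/funext => n; rewrite PsiD.
Qed.

Lemma wcvg_pr (W : set V) (x_ : nat -> V) y : hclosed ip W -> wcvg x_ y ->
  wcvg (fun n => pr W (x_ n)) (pr W y).
Proof.
move=> cW h phi; rewrite -(ip_pr hV cW); under eq_fun do rewrite -(ip_pr hV cW).
exact: h.
Qed.

Lemma hcvg_pr (W : set V) (x_ : nat -> V) y : hclosed ip W -> hcvg ip x_ y ->
  hcvg ip (fun n => pr W (x_ n)) (pr W y).
Proof.
move=> cW h; apply: squeeze0 h => n; rewrite sqrtr_ge0 /= -(prB hV cW).
exact: (nm_pr hV cW).
Qed.

Lemma cvg_conjK (f : nat -> K) (l : K) : f @ \oo --> l -> (fun n => conjK (f n)) @ \oo --> conjK l.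
Proof.
move=> /cvgK[h1 h2]; apply/cvgK; split.
  by rewrite reK_conj; under eq_fun do rewrite reK_conj.
by rewrite imK_conj; under eq_fun do rewrite imK_conj; exact: cvgN.
Qed.

Lemma sol_cvg : let E_ n := (x + w_ n) + b_ n (z_ n) in let E := (x + w) + b z in
  [/\ wcvg E_ E, wcvg (fun n => a_ n (E_ n)) (a E) &
      (fun n => ip (a_ n (E_ n)) (E_ n)) @ \oo --> ip (a E) E].
Proof.
move=> E_ E; have [h1 h2] := sol_block_cvg; rewrite -/E in h1 h2.
have e1 b' E' : E' = P0 (Psi b' E') + P1 (Phi b' E') by rewrite P0_Psi P1_Phi -pr_split.
have e2 b' E' : b' E' = P0 (Phi b' E') + P1 (Psi b' E') by rewrite P0_Phi P1_Psi -pr_split.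
split.
- rewrite (e1 a E) (_ : E_ = fun n => P0 (Psi (a_ n) (E_ n)) + P1 (Phi (a_ n) (E_ n))).
    by apply: wcvgD; [exact: wcvg_pr|apply: wcvg_pr => //; exact: hcvg_wcvg].
  by apply/funext => n; exact: e1.
- rewrite (e2 a E) (_ : (fun n => a_ n (E_ n)) = fun n => P0 (Phi (a_ n) (E_ n)) +
  P1 (Psi (a_ n) (E_ n))).
    by apply: wcvgD; [apply: wcvg_pr => //; exact: hcvg_wcvg|exact: wcvg_pr].
  by apply/funext => n; exact: e2.
rewrite ip_Phi_PsiE; under eq_fun do rewrite ip_Phi_PsiE.
have [M hM] : exists M, forall n, nm (Psi (a_ n) (E_ n)) <= M.
  have /cvg_ex/cvg_seq_bounded/pinfty_ex_gt0[M M0 hM] : exists l : R, (fun n =>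
    nm (Phi (a_ n) (E_ n))) @ \oo --> l.
    by exists (nm (Phi a E)); exact: (hcvg_nm hV).
  exists (c^-1 * M) => n; rewrite (le_trans (Psi_le _ (mop_ n)))// ler_wpM2l ?invr_ge0 ?(ltW
    c_gt0)//.
  by rewrite (le_trans (ler_norm _))//; exact: hM.
apply: cvgD.
  by apply: (hcvg_ip hV (hcvg_pr cH0 h1) h2); exists M.
apply: cvg_conjK; by apply: (hcvg_ip hV (hcvg_pr c1 h1) h2); exists M.
Qed.

End block_operators.

(** * Nonlocal H-convergence *)

Section assembly.
Variables (R : realType) (k : scalars) (Om : set (R3 R)) (oOm : open Om).
Local Notation K := (scal R k).
Local Notation L2v := (L2v k oOm).
Local Notation ip := (@ip R k Om oOm).
Local Notation pr := (pr ip).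
Let hV : hilbert ip := hilbert_ip k oOm.
Implicit Types (a b : L2v -> L2v) (x y E : L2v).

Lemma wot_cvg (V W : set L2v) (t_ : nat -> wot V W) (t : wot V W) :
  t_ @ \oo --> t -> forall v w, V v -> W w ->
  (fun n => ip w ((t_ n : L2v -> L2v) v)) @ \oo --> ip w ((t : L2v -> L2v) v).
Proof.
move=> h v w hv hw.
pose F := (fun t : L2v -> L2v => (fun r => ip (val r.2) (t (val r.1))) : {ptws V * W -> K}).
pose r : (V * W)%type := (exist _ v (mem_set hv), exist _ w (mem_set hw)).
have h1 : F \o t_ @ \oo --> F t.
  by apply: cvg_comp h _; exact: (@initial_continuous _ _ F t).
exact: (cvg_comp _ _ h1 (@proj_continuous _ _ r (F t))).
Qed.

Lemma nonlocal_cvg_maps (H0 : set L2v) (al be : R) (a_ : nat -> M k oOm al be)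
    (a : M k oOm al be) : nonlocal_cvg H0 a_ a ->
  let m n := nonlocal_maps H0 (a_ n) in let m' := nonlocal_maps H0 a in
  [/\ (fun n => (m n).1.1.1) @ \oo --> m'.1.1.1, (fun n => (m n).1.1.2) @ \oo --> m'.1.1.2,
      (fun n => (m n).1.2) @ \oo --> m'.1.2 & (fun n => (m n).2) @ \oo --> m'.2].
Proof.
move=> h m m'.
have h1 : m @ \oo --> m' := cvg_comp a_ (@nonlocal_maps R k Om oOm H0 al be) h
  (@initial_continuous _ _ (@nonlocal_maps R k Om oOm H0 al be) a).
have h2 : (fun n => (m n).1) @ \oo --> m'.1 by apply: (cvg_comp _ _ h1); exact: cvg_fst.
have h3 : (fun n => (m n).1.1) @ \oo --> m'.1.1 by apply: (cvg_comp _ _ h2); exact: cvg_fst.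
split.
- by apply: (cvg_comp _ _ h3); exact: cvg_fst.
- by apply: (cvg_comp _ _ h3); exact: cvg_snd.
- by apply: (cvg_comp _ _ h2); exact: cvg_snd.
by apply: (cvg_comp _ _ h1); exact: cvg_snd.
Qed.

Lemma Re_ge_coercive a (c : R) : Re_ge a c -> coercive ip a c.
Proof.
move=> [a' [_ adj] h]; split; first by exists a'.
move=> x; have /le_reK := h x.
rewrite (ipZr hV) reK_half (ipDr hV) reKD -(adj x x) reKM imK_ofR reK_ofR mul0r subr0.
rewrite (sqr_nm hV) (ip_conj hV x (a' x)) reK_conj.
lra.
Qed.

Lemma M_mop (al be : R) (a : M k oOm al be) : exists b, mop ip al be (val a) b.
Proof.
have [[la _] ha [b [[lb _] ab ba hb]]] : M k oOm al be (val a) := set_valP a.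
by exists b; split => //; exact: Re_ge_coercive.
Qed.

Lemma inv_opE a b x : cancel a b -> cancel b a -> inv_op a x = b x.
Proof.
move=> ab ba; have h : [set y | a y = x] (inv_op a x) by apply: xgetPex; exists (b x); exact: ba.
by rewrite -{2}h ab.
Qed.

Lemma wcvgB (x_ y_ : nat -> L2v) x y : wcvg ip x_ x -> wcvg ip y_ y ->
  wcvg ip (fun n => x_ n - y_ n) (x - y).
Proof. by move=> h1 h2 phi; rewrite (ipBr hV); under eq_fun do rewrite (ipBr hV); exact: cvgB. Qed.

(** The weak operator topology tests only with vectors of the target space; for sequences inside
    that space projection of the test vector gives the rest. *)
Lemma wcvg_in (W : set L2v) (x_ : nat -> L2v) x : hclosed ip W ->
  (forall n, W (x_ n)) -> W x ->
  (forall phi, W phi -> (fun n => ip phi (x_ n)) @ \oo --> ip phi x) -> wcvg ip x_ x.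
Proof.
move=> cW W_ Wx h phi; rewrite -(ip_prl hV cW _ Wx).
under eq_fun => n do rewrite -(ip_prl hV cW _ (W_ n)).
by apply: h; exact: (pr_in hV cW).
Qed.

Lemma nonlocal_cvg_Bop (H0 : set L2v) (al be : R) (a_ : nat -> M k oOm al be)
    (a : M k oOm al be) : 0 < al -> hclosed ip H0 -> nonlocal_cvg H0 a_ a ->
  forall y, wcvg ip (fun n => Bop ip H0 (val (a_ n)) y) (Bop ip H0 (val a) y).
Proof.
move=> al0 cH0 /nonlocal_cvg_maps[h1 h2 h3 h4] y.
have cH1 := hclosed_orth hV H0.
have in0 (x : L2v) : H0 (pr H0 x) by exact: (pr_in hV cH0).
have in1 (x : L2v) : orth ip H0 (pr (orth ip H0) x) by exact: (pr_in hV cH1).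
have cin (a' : M k oOm al be) x : H0 x -> H0 (cinv ip H0 (val a') x).
  by have [b [[la _] _ _ ca _]] := M_mop a' => hx; have [] := cinvP hV al0 cH0 la ca hx.
have [q0 q1] := (in0 y, in1 y).
apply: (wcvgD hV).
  apply: wcvgB; apply: (wcvg_in cH0).
  - by move=> n; exact: (cin (a_ n) _ (in0 _)).
  - exact: (cin a _ (in0 _)).
  - by move=> phi Hphi; exact: (wot_cvg h1 q0 Hphi).
  - by move=> n; exact: (cin (a_ n) _ (in0 _)).
  - exact: (cin a _ (in0 _)).
  - by move=> phi Hphi; exact: (wot_cvg h2 q1 Hphi).
apply: (wcvgD hV).
  apply: (wcvg_in cH1).
  - by move=> n; exact: in1.
  - exact: in1.
  - by move=> phi Hphi; exact: (wot_cvg h3 q0 Hphi).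
apply: (wcvg_in cH1).
- by move=> n; exact: (hclosedB cH1 (in1 _) (in1 _)).
- exact: (hclosedB cH1 (in1 _) (in1 _)).
by move=> phi Hphi; exact: (wot_cvg h4 q1 Hphi).
Qed.

Section data.
Variables (bOm : bounded_set Om) (lipOm : lipschitz_boundary Om).
Variables (al be : R) (al0 : 0 < al) (be0 : 0 < be).
Variables (H0 : set L2v) (H0_adm : nonlocal_admissible H0).
Local Notation G := (ran (@grad0 R k Om oOm)).
Local Notation C := (ran (@curl R k Om oOm)).
Local Notation mop := (mop ip al be).

Lemma H0_closed : hclosed ip H0.
Proof. by have [/closed_subspace_hclosed] := H0_adm. Qed.

Lemma ran_grad0_H0 : G `<=` H0.
Proof. by have [] := H0_adm. Qed.

Lemma ran_curl_H1 : C `<=` orth ip H0.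
Proof. by have [] := H0_adm. Qed.

(** An admissible [H0] separates [ran grad0] from [ran curl], so gradients lie in [ker curl0], as
    [ran_curlE] requires. *)
Lemma ran_curl_closed : hclosed ip C.
Proof.
rewrite (ran_curlE bOm lipOm); first exact: (hclosed_orth hV).
move=> y Gy; apply/ker_curl0E => w /ran_curl_H1 hw; apply: (ip_eq0C hV).
exact: (hw _ (ran_grad0_H0 Gy)).
Qed.

Lemma HD_orth : HD k oOm = orth ip G `&` orth ip C.
Proof.
by apply/seteqP; split=> h [h1 h2]; split; first [exact/ker_divE|exact/ker_curl0E].
Qed.

Lemma HD_closed : hclosed ip (HD k oOm).
Proof.
rewrite HD_orth; have [a0 al' ac] := hclosed_orth hV G; have [b0 bl bc] := hclosed_orth hV C.
split=> // [c u v [u1 u2] [v1 v2]|u_ l hu hl]; first by split; [exact: al'|exact: bl].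
by split; [apply: ac hl => n; have [] := hu n|apply: bc hl => n; have [] := hu n].
Qed.

(** The default value of [pi_op] is excluded by the given decomposition, and uniqueness of the
    decomposition identifies the chosen element. *)
Lemma pi_opE a b E w z h : mop a b -> G w -> C z -> orth ip G (a h) -> orth ip C h ->
  E = w + b z + h -> pi_op a E = h.
Proof.
move=> hm Gw Cz hG hC e; have [[la lb] ab ba _ _] := hm.
set S := [set h' | Heps a h' /\ exists u w',
    [/\ G u, (inv_op a @` C) w' & E = u + w' + h']].
have [[/ker_divE hG' /ker_curl0E hC'] [w' [_ [Gw' [z' Cz' <-]]]]] : S (pi_op a E).
  apply: xgetPex; exists h; split; first by split; [exact/ker_divE|exact/ker_curl0E].
  by exists w, (b z); split => //; exists z => //; exact: inv_opE.
rewrite (inv_opE _ ab ba); move: (pi_op a E) hG' hC' => h' hG' hC' e'; apply/subr0_eq.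
have Gd := hclosedB (ran_grad0_closed k oOm bOm) Gw' Gw.
have Cd := hclosedB ran_curl_closed Cz' Cz.
apply: (decomp_uniq hV al0 ran_grad0_H0 ran_curl_H1 hm Gd Cd).
- by rewrite (linB _ _ la); exact: (hclosedB (hclosed_orth hV G) hG' hG).
- exact: (hclosedB (hclosed_orth hV C) hC' hC).
rewrite (_ : _ + _ = (w' + b z' + h') - (w + b z + h)); first by rewrite -e' -e subrr.
by rewrite !opprD [RHS]addrACA (linB _ _ lb); congr (_ + _); rewrite [RHS]addrACA.
Qed.

(** Given L_2 fields [p] and [q] with divergence [f] and curl [g] in the weak sense, the equations
    for [E] say that [a E] and [p] agree on [ran grad0], and [E] and [q] on [ran curl]. *)
Lemma solves_spans a b f g x E p q : mop a b ->
  (forall u du, grad0 (u, du) -> f u = - ip p du) ->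
  (forall phi w, curl_red (phi, w) -> g phi = ip q w) ->
  solves a f g x E <-> [/\ forall y, G y -> ip y (a E) = ip y p,
    forall y, C y -> ip y E = ip y q & spans ip (HD k oOm) G C a b E x].
Proof.
move=> hm hp hq.
have ip_swap (y u v : L2v) : ip u y = ip v y <-> ip y u = ip y v.
  by split=> h; rewrite [LHS](ip_conj hV) [RHS](ip_conj hV) h.
have h3 : Defs.proj (HD k oOm) (pi_op a E) = x <-> spans ip (HD k oOm) G C a b E x.
  have pE w z h : G w -> C z -> orth ip G (a h) -> orth ip C h -> E = w + b z + h ->
      pi_op a E = h by exact: pi_opE.
  split=> [<-|[w [z [h [Gw Cz [hG hC] e <-]]]]]; last by rewrite (pE _ _ _ Gw Cz hG hC e).
  have [w [z [h [Gw Cz hG hC e]]]] := decomp_exists hV al0 be0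
    (ran_grad0_closed k oOm bOm) ran_curl_closed ran_grad0_H0 ran_curl_H1 E hm.
  exists w, z, h; split; [exact: Gw|exact: Cz|by split|exact: e|].
  by rewrite (pE _ _ _ Gw Cz hG hC e).
split=> [[hf hg /h3 hs]|[hf hg /h3 hs]]; split; [| |exact: hs| | |exact: hs].
- move=> y [u uy]; apply/ip_swap/oppr_inj; exact: etrans (esym (hf _ _ uy)) (hp _ _ uy).
- by move=> y /ran_curl_red[v vy]; apply/ip_swap; exact: etrans (esym (hg _ _ vy)) (hq _ _ vy).
- by move=> u du udu; rewrite (hp _ _ udu); congr (- _); apply/esym/ip_swap/hf; exists u.
- move=> phi w hw; rewrite (hq _ _ hw); apply/esym/ip_swap/hg; exists phi; by have [] := hw.
Qed.

End data.
End assembly.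

Theorem theorem2 (R : realType) (k : scalars) (Om : set (R3 R))
    (oOm : open Om) (bOm : bounded_set Om) (lipOm : lipschitz_boundary Om)
    (al be : R) (al_gt0 : 0 < al) (al_lt_be : al < be)
    (H0 : set (L2v k oOm)) (H0_adm : nonlocal_admissible H0)
    (eps_ : nat -> M k oOm al be) (eps : M k oOm al be)
    (eps_cvg : nonlocal_cvg H0 eps_ eps)
    (f : L2s k oOm -> scal R k) (f_Hm1 : Hm1 f)
    (g : L2v k oOm -> scal R k) (g_Hm1 : Hm1_curl_red g)
    (x : L2v k oOm) (x_HD : HD k oOm x)
    (E_ : nat -> L2v k oOm)
    (E_sol : forall n, solves (val (eps_ n)) f g x (E_ n)) :
  exists E : L2v k oOm,
    [/\ unique (solves (val eps) f g x) E,
        weakly_to E_ E,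
        weakly_to (fun n => val (eps_ n) (E_ n)) (val eps E) &
        (fun n => ip (val (eps_ n) (E_ n)) (E_ n)) @ \oo
          --> ip (val eps E) E].
Proof.
have hV := hilbert_ip k oOm.
have be_gt0 := lt_trans al_gt0 al_lt_be.
have cH0 := H0_closed H0_adm; have GH0 := ran_grad0_H0 H0_adm; have CH1 := ran_curl_H1 H0_adm.
have cG := ran_grad0_closed k oOm bOm; have cC := ran_curl_closed bOm lipOm H0_adm.
have cH := HD_closed k oOm; have HE := HD_orth k oOm.
have [bs [B [B0 hB]]] := HD_estimate k oOm bOm lipOm.
have /choice[b_ hb_] n := M_mop (eps_ n).
have [b hb] := M_mop eps.
have [hp hq _] := E_sol 0%N.
(* The solution with index 0 supplies L_2 fields representing [f] and [g] for all coefficients. *)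
pose p := val (eps_ 0%N) (E_ 0%N); pose q := E_ 0%N.
have sE a b' := @solves_spans _ _ _ _ bOm lipOm _ _ al_gt0 be_gt0 _ H0_adm a b' f g x _ p q ^~ hp
  ^~ hq.
have /choice[wz hwz] n : exists wz, sol (@ip _ _ _ oOm) (ran (@grad0 R k Om oOm)) (ran (@curl R k
  Om oOm))
    (val (eps_ n)) (b_ n) p q x wz.1 wz.2 /\ E_ n = (x + wz.1) + b_ n wz.2.
  have /(sE _ _ _ (hb_ n))[h1 h2 h3] := E_sol n.
  by have [w [z h]] := spans_sol hV cH cG GH0 CH1 HE (hb_ n) x_HD h1 h2 h3; exists (w, z).
have [w [z hs]] := sol_exists hV al_gt0 be_gt0 cG cC p q x hb.
have EE : E_ = fun n => x + (wz n).1 + b_ n (wz n).2 by apply/funext => n; exact: (hwz n).2.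
have [h1 h2 h3] := sol_cvg hV al_gt0 be_gt0 cH0 cH hB cG cC GH0 CH1 HE hb_ hb
  (nonlocal_cvg_Bop al_gt0 cH0 eps_cvg) (fun n => (hwz n).1) hs.
exists (x + w + b z); rewrite EE; split; [split|exact: h1|exact: h2|exact: h3].
  by apply/(sE _ _ _ hb); exact: (sol_spans hV al_gt0 be_gt0 cH cG cC GH0 CH1 HE hb x_HD hs).
move=> E' /(sE _ _ _ hb)[g1 g2 g3].
have [w' [z' [hs' ->]]] := spans_sol hV cH cG GH0 CH1 HE hb x_HD g1 g2 g3.
by have [-> ->] := sol_uniq hV al_gt0 be_gt0 cG cC hb hs' hs.
Qed.
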